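(* Let $c$ be a curve in $\mathbb{R}^3$ with finite total curvature $C:=\mathrm{TC}(c)$ and with no points of return. Then there exists a rectifiable curve $\mathfrak{t}_c:[0,C]\to\mathbb{S}^2$, parameterized by arc-length, so that $\mathcal{L}_{\mathbb{S}^2}(\mathfrak{t}_c)=\mathrm{TC}(c)$, satisfying the following property. For any sequence $\{P_h\}$ of polygonal curves inscribed in $c$ such that $\operatorname{mesh}P_h\to0$, denoting by $t_h:[0,C]\to\mathbb{S}^2$ the parameterization with constant velocity of the tangent indicatrix $\mathfrak{t}_{P_h}$ of $P_h$, one has $t_h\to\mathfrak{t}_c$ uniformly on $[0,C]$ and $\mathcal{L}_{\mathbb{S}^2}(t_h)\to\mathcal{L}_{\mathbb{S}^2}(\mathfrak{t}_c)$.
   Context: A curve in $\mathbb{R}^3$ is given by a continuous parameterization $c:[a,b]\to\mathbb{R}^3$. $\mathbb{S}^2\subset\mathbb{R}^3$ is the unit sphere with geodesic distance $d_{\mathbb{S}^2}$ and $\mathcal{L}_{\mathbb{S}^2}$ is the corresponding length. A polygonal $P$ in $\mathbb{R}^3$ has consecutive vertices $v_0,\dots,v_n$ and oriented segments $\sigma_i=[v_{i-1},v_i]$, identified with $v_i-v_{i-1}$, all of positive length (repeated consecutive vertices are discarded). Put $t_i:=\sigma_i/\|\sigma_i\|\in\mathbb{S}^2$ and let $\gamma_i$ be a minimal oriented geodesic arc in $\mathbb{S}^2$ from $t_i$ to $t_{i+1}$, $i=1,\dots,n-1$. The total curvature is $\mathrm{TC}(P):=\sum_{i=1}^{n-1}d_{\mathbb{S}^2}(t_i,t_{i+1})$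 (sum of turning angles), and the tangent indicatrix $\mathfrak{t}_P:[0,\mathrm{TC}(P)]\to\mathbb{S}^2$ is the arc-length parameterization of the spherical polygonal obtained by joining $\gamma_1,\dots,\gamma_{n-1}$; its length is $\mathrm{TC}(P)$. Its constant-velocity parameterization on $[0,C]$ is $s\mapsto\mathfrak{t}_P(\mathrm{TC}(P)s/C)$. For closed polygonals ($v_0=v_n$) indices are cyclic and the tangent indicatrix is a closed curve. $P$ is inscribed in $c$ ($P\ll c$) if there is a partition $a=\lambda_0<\dots<\lambda_n=b$ such that $P$ has vertices $v_i=c(\lambda_i)$; $\operatorname{mesh}P:=\max_i\|v_i-v_{i-1}\|$; $\mathrm{TC}(c):=\sup\{\mathrm{TC}(P):P\ll c\}$. A curve with $\mathrm{TC}(c)<\infty$ is rectifiable, and for its arc-length parameterization on $[0,L]$ the tangent $\mathfrak{t}=\dot c$ is a function of bounded variation, with one-sided limits $\mathfrak{t}(s\pm)\in\mathbb{S}^2$. A point of return is a point $c(s)$, $s\in\,]0,L[$, with $\mathfrak{t}(s-)=-\mathfrak{t}(s+)$.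
   Formalization: If c has loops (e.g. is closed), the arcs of c between consecutive vertices of P_h must also shrink to diameter 0, since mesh P_h→0 allows skipping a loop; for closed c the base point also counts as a possible point of return, i.e. t(L-) = -t(0+) is excluded. *)

(* Defs.v *)
From HB Require Import structures.
From mathcomp Require Import all_boot all_order all_algebra.
From mathcomp Require Import all_classical all_reals all_analysis.

Set Implicit Arguments.
Unset Strict Implicit.
Unset Printing Implicit Defensive.

Import Order.TTheory GRing.Theory Num.Theory.
Import numFieldNormedType.Exports.

Local Open Scope classical_set_scope.
Local Open Scope ring_scope.

Section Geometry.
Context {R : realType}.

Notation E3 := 'rV[R]_3.

(* The norm `|v| of MathComp-Analysis on row vectors is the sup norm (it
   induces the same topology), hence the explicit Euclidean norm. *)
Definition dot (u v : E3) : R := \sum_(i < 3) u 0 i * v 0 i.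

Definition enorm (v : E3) : R := Num.sqrt (dot v v).

Definition edist (u v : E3) : R := enorm (v - u).

Definition sphere2 : set E3 := [set u | enorm u = 1].

(* Only meaningful when u and v lie on the unit sphere. *)
Definition sphere_dist (u v : E3) : R := acos (dot u v).

(* Sum of the consecutive distances along the sequence x, s_0, s_1, ... *)
Definition path_length (dist : E3 -> E3 -> R) (x : E3) (s : seq E3) : R :=
  \sum_(l <- pairmap dist x s) l.

(* In itv_partition a b s the list s omits the initial point a. *)
Definition curve_length (dist : E3 -> E3 -> R) (a b : R) (f : R -> E3)
    : \bar R :=
  ereal_sup [set (path_length dist (f a) (map f s))%:E
            | s in [set s | itv_partition a b s]].

(* Polygonals are given by their list of vertices; filtering out the zero
   edge vectors amounts to discarding repeated consecutive vertices. *)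
Definition edges (P : seq E3) : seq E3 :=
  [seq e <- pairmap (fun x y => y - x) (head 0 P) (behead P) | e != 0].

Definition closed_polygonal (P : seq E3) : bool := head 0 P == last 0 P.

Definition directions (P : seq E3) : seq E3 :=
  [seq (enorm e)^-1 *: e | e <- edges P].

(* t_1, ..., t_n, followed by t_1 again when P is closed (cyclic indices).
   Empty exactly when P has no segment of positive length. *)
Definition indicatrix_vertices (P : seq E3) : seq E3 :=
  let t := directions P in
  if closed_polygonal P then t ++ take 1 t else t.

Definition TC_polygonal (P : seq E3) : R :=
  let w := indicatrix_vertices P in
  path_length sphere_dist (head 0 w) (behead w).

Definition mesh (P : seq E3) : R := \big[Num.max/0]_(e <- edges P) enorm e.

(* f restricted to [0, d(u, v)] is a shortest path of the sphere from u to v,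
   parameterized by arc length; it is not unique when v = - u. *)
Definition minimal_geodesic (f : R -> E3) (u v : E3) : Prop :=
  let d := sphere_dist u v in
  [/\ f 0 = u, f d = v,
      (forall s, s \in `[0, d] -> sphere2 (f s)) &
      (forall s s', s \in `[0, d] -> s' \in `[0, d] ->
         sphere_dist (f s) (f s') = `|s - s'|)].

(* f is the arc-length parameterization, from time 0 on, of a concatenation
   of minimal geodesic arcs from u to us_0, from us_0 to us_1, etc. *)
Fixpoint spherical_polygonal (f : R -> E3) (u : E3) (us : seq E3) : Prop :=
  if us is v :: us' then
    minimal_geodesic f u v /\
    spherical_polygonal (fun s => f (sphere_dist u v + s)) v us'
  else f 0 = u.

(* A relation rather than a function, because of the choice of the arcs
   between antipodal directions; polygonals without segment have none. *)
Definition tangent_indicatrix (P : seq E3) (f : R -> E3) : Prop :=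
  if indicatrix_vertices P is u :: us then spherical_polygonal f u us
  else False.

(* Division by zero yields zero in MathComp: for C = 0 the domain is {0} and
   the value there is f 0, as it should be. *)
Definition constant_velocity (P : seq E3) (C : R) (f : R -> E3) : R -> E3 :=
  fun s => f (TC_polygonal P * s / C).

Definition inscribed (c : R -> E3) (a : R) (D : seq R) : seq E3 :=
  c a :: map c D.

Definition TC (c : R -> E3) (a b : R) : \bar R :=
  ereal_sup [set (TC_polygonal (inscribed c a D))%:E
            | D in [set D | itv_partition a b D]].

Definition arc_length_param (c : R -> E3) (a b L : R) (g : R -> E3) : Prop :=
  curve_length edist a b c = L%:E /\
  forall x, x \in `[a, b] -> g (fine (curve_length edist a x c)) = c x.

(* The tangent of g is defined almost everywhere: one-sided limits are taken
   along the points of differentiability. *)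
Definition tangent_left (g : R -> E3) (s : R) (u : E3) : Prop :=
  derive1 g @ within [set x | derivable g x 1] s^'- --> u.

Definition tangent_right (g : R -> E3) (s : R) (u : E3) : Prop :=
  derive1 g @ within [set x | derivable g x 1] s^'+ --> u.

(* The parameter domain of a closed curve is a circle, as for closed
   polygonals: its base point, s = 0 and s = L, counts as an interior point. *)
Definition point_of_return (c : R -> E3) (a b : R) (p : E3) : Prop :=
  exists L g, arc_length_param c a b L g /\
  exists2 u, sphere2 u &
    (exists s, [/\ 0 < s < L, p = g s,
                   tangent_left g s u & tangent_right g s (- u)]) \/
    [/\ c a = c b, 0 < L, p = c a,
        tangent_left g L u & tangent_right g 0 (- u)].

(* c never passes twice through the same point, except by being stationary. *)
Definition loop_free (c : R -> E3) (a b : R) : Prop :=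
  forall x y, a <= x -> x <= y -> y <= b -> c x = c y ->
  forall z, x <= z <= y -> c z = c x.

(* The diameters of the arcs of c cut out by the partitions D_h tend to 0.
   Without loops this follows from mesh P_h --> 0; with loops it does not,
   since an inscribed polygonal of small mesh may skip a whole loop. *)
Definition arcs_shrink (c : R -> E3) (a : R) (D : nat -> seq R) : Prop :=
  forall e : R, 0 < e -> \forall h \near \oo,
  forall i, (i < size (D h))%N ->
  forall x y, x \in `[nth a (a :: D h) i, nth a (D h) i] ->
              y \in `[nth a (a :: D h) i, nth a (D h) i] ->
  edist (c x) (c y) < e.

End Geometry.

(* Main.v *)
Require Import Defs.
From HB Require Import structures.
From mathcomp Require Import all_boot all_order all_algebra.
From mathcomp Require Import all_classical all_reals all_analysis.
From mathcomp Require Import ring lra.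

(** The tangent indicatrices of fine inscribed polygonals are nearly the same
    curve, because they are forced to pass near the one-sided tangents of c at
    prescribed times and have no choice in between.

    Inserting a vertex in a polygonal does not decrease its turning: the
    direction of e1 + e2 lies on the minimal arc between those of e1 and e2
    (sphere_dist_dirD, turn_del_inner, turn_subset). Moreover the turning
    is lower semicontinuous in the vertices (turn_lsc). Hence the turnings of
    fine inscribed polygonals converge to C, and those of the parts inscribed
    in the piece [0, s] of the curve converge to the supremum A(s) of the
    turnings on this piece (fine_total_turning, fine_turning_upto).

    Finite total curvature bounds the length by a multiple of the diameter
    (length_le_diam), so that c is a reparameterization of a curve g with
    parameter arc length. There is little turning just after or just before a
    parameter s (small_turn_right, small_turn_left). Consequently the
    directions of the chords of g on either side of s have limits
    (chord_limit_right_ex, chord_limit_left_ex), which are the limits of the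
    derivative (chord_limit_right_tangent, chord_limit_left_tangent); the
    turning A is left-continuous, and its jump at s is at most the angle
    between the two tangents at s (turning_upto_left, turning_upto_jump).

    Given a time r in [0, C], let s be the last parameter such that A(s) <= r.
    The indicatrix of a fine polygonal is 1-Lipschitz, and passes near the left
    tangent at s about the time A(s), then near the right tangent at s before
    a time at which it has turned little more than A(s) plus their angle. As
    c has no point of return, this angle is less than pi, the minimal arc
    between the tangents is unique, and the indicatrix has to be near a
    definite point of that arc at the time r (geodesic_point,
    pointwise_limit). When the curve is closed and s is the end of the curve,
    the arc is that of the closing angle, towards the right tangent at the
    start. Convergence is uniform by the Lipschitz bound (limit_uniform).

    No length is lost in the limit: moving along a fine polygonal with
    directions read on the limit curve gives almost the same vertices, so by
    lower semicontinuity almost the turning C, and this turning is the length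
    of a polygonal inscribed in the limit (limit_length). As the limit is
    1-Lipschitz on [0, C] and has length C, it is parameterized by arc
    length. *)

Set Implicit Arguments.
Unset Strict Implicit.
Unset Printing Implicit Defensive.

Import Order.TTheory GRing.Theory Num.Theory.
Import numFieldNormedType.Exports.

Local Open Scope classical_set_scope.
Local Open Scope ring_scope.

Local Notation edist := Defs.edist.

(** * Euclidean vectors and angles *)

Section Vectors.
Context {R : realType}.
Notation E3 := 'rV[R]_3.
Implicit Types (u v w e : E3) (k : R).

Lemma dotC u v : dot u v = dot v u.
Proof. by apply: eq_bigr => i _; rewrite mulrC. Qed.

Lemma dotDl u v w : dot (u + v) w = dot u w + dot v w.
Proof. by rewrite -big_split; apply: eq_bigr => i _; rewrite mxE mulrDl. Qed.

Lemma dotDr u v w : dot w (u + v) = dot w u + dot w v.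
Proof. by rewrite dotC dotDl !(dotC w). Qed.

Lemma dotZl k u v : dot (k *: u) v = k * dot u v.
Proof. by rewrite /dot mulr_sumr; apply: eq_bigr => i _; rewrite mxE mulrA. Qed.

Lemma dotZr k u v : dot u (k *: v) = k * dot u v.
Proof. by rewrite dotC dotZl dotC. Qed.

Lemma dotNl u v : dot (- u) v = - dot u v.
Proof. by rewrite -scaleN1r dotZl mulN1r. Qed.

Lemma dotNr u v : dot u (- v) = - dot u v.
Proof. by rewrite dotC dotNl dotC. Qed.

Lemma dot0l u : dot 0 u = 0.
Proof. by rewrite -(scale0r 0) dotZl mul0r. Qed.

Definition dotE := (dotDl, dotDr, dotNl, dotNr, dotZl, dotZr).

Lemma dot_ge0 u : 0 <= dot u u.
Proof. by apply: sumr_ge0 => i _; rewrite -expr2 sqr_ge0. Qed.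

Lemma dot_eq0 u : (dot u u == 0) = (u == 0).
Proof.
apply/eqP/eqP => [|->]; last exact: dot0l.
move/eqP; rewrite psumr_eq0; last by move=> i _; rewrite -expr2 sqr_ge0.
move/allP => h; apply/rowP => i; rewrite mxE.
by have := h i (mem_index_enum _); rewrite /= mulf_eq0 orbb => /eqP.
Qed.

Lemma enorm_ge0 u : 0 <= enorm u.
Proof. exact: sqrtr_ge0. Qed.

Lemma enorm_sqr u : enorm u ^+ 2 = dot u u.
Proof. by rewrite sqr_sqrtr // dot_ge0. Qed.

Lemma enorm_eq0 u : (enorm u == 0) = (u == 0).
Proof. by rewrite -dot_eq0 -enorm_sqr sqrf_eq0. Qed.

Lemma enorm0 : enorm (0 : E3) = 0.
Proof. by apply/eqP; rewrite enorm_eq0. Qed.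

Lemma enorm_gt0 u : (0 < enorm u) = (u != 0).
Proof. by rewrite lt0r enorm_ge0 andbT enorm_eq0. Qed.

Lemma enormZ k u : enorm (k *: u) = `|k| * enorm u.
Proof.
rewrite /enorm !dotE mulrA -expr2 sqrtrM ?sqr_ge0 //.
by rewrite sqrtr_sqr.
Qed.

Lemma enormN u : enorm (- u) = enorm u.
Proof. by rewrite -scaleN1r enormZ normrN1 mul1r. Qed.

Lemma ler_enorm u k : 0 <= k -> (enorm u <= k) = (dot u u <= k ^+ 2).
Proof. by move=> k0; rewrite -enorm_sqr ler_pXn2r // nnegrE ?enorm_ge0. Qed.

Lemma dot_sqr_le u v : dot u v ^+ 2 <= dot u u * dot v v.
Proof.
have [->|v0] := eqVneq v 0; first by rewrite dotC !dot0l expr0n mulr0.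
have vv : 0 < dot v v by rewrite lt0r dot_eq0 v0 dot_ge0.
have := dot_ge0 (dot v v *: u - dot u v *: v).
rewrite !dotE (dotC v u) => h.
(* Gram determinant: h is the claim multiplied by dot v v *)
rewrite -subr_ge0 -(pmulr_rge0 _ vv); nra.
Qed.

Lemma dot_le u v : dot u v <= enorm u * enorm v.
Proof.
have n0 : 0 <= enorm u * enorm v by rewrite mulr_ge0 ?enorm_ge0.
have [d0|/ltW d0] := leP 0 (dot u v); last exact: le_trans d0 n0.
rewrite -(@ler_pXn2r _ 2) // ?nnegrE //.
by rewrite exprMn !enorm_sqr dot_sqr_le.
Qed.

Lemma enormD u v : enorm (u + v) <= enorm u + enorm v.
Proof.
rewrite ler_enorm ?addr_ge0 ?enorm_ge0 //.
have := dot_le u v; rewrite sqrrD !enorm_sqr !dotE (dotC v u); lra.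
Qed.

Lemma enormB u v w : enorm (u - w) <= enorm (u - v) + enorm (v - w).
Proof. by have := enormD (u - v) (v - w); rewrite addrA subrK. Qed.

Lemma enormBC u v : enorm (u - v) = enorm (v - u).
Proof. by rewrite -enormN opprB. Qed.

Lemma euclid_distxx u : edist u u = 0.
Proof. by rewrite /edist subrr enorm0. Qed.

Lemma euclid_dist_ge0 u v : 0 <= edist u v.
Proof. exact: enorm_ge0. Qed.

Lemma euclid_dist_triangle v u w : edist u w <= edist u v + edist v w.
Proof. by rewrite addrC; exact: enormB. Qed.

Lemma norm_le_enorm u : `|u| <= enorm u.
Proof.
rewrite [leLHS]/Num.norm /= mx_normrE; apply/bigmax_leP; split=> [|[i j] _ /=].
  exact: enorm_ge0.
rewrite ord1 -(@ler_pXn2r _ 2) // ?nnegrE ?enorm_ge0 ?normr_ge0 //.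
rewrite enorm_sqr real_normK ?num_real // /dot (bigD1 j) //= -expr2 lerDl.
by apply: sumr_ge0 => k _; rewrite -expr2 sqr_ge0.
Qed.

Lemma enorm_le_norm u : enorm u <= 2 * `|u|.
Proof.
rewrite ler_enorm ?mulr_ge0 ?normr_ge0 // exprMn.
have : dot u u <= \sum_(i < 3) `|u| ^+ 2.
  apply: ler_sum => i _; rewrite -expr2 -real_normK ?num_real //.
  rewrite ler_pXn2r ?nnegrE ?normr_ge0 //.
  by rewrite [leRHS]/Num.norm /= mx_normrE; apply/bigmax_geP; right; exists (0, i).
by rewrite sumr_const card_ord -mulr_natl; have := sqr_ge0 `|u|; lra.
Qed.

(** ** Angles between unit vectors *)

Lemma sphere2P u : sphere2 u <-> dot u u = 1.
Proof.
rewrite /sphere2 /=; split=> [h|h]; first by rewrite -enorm_sqr h expr1n.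
by rewrite /enorm h sqrtr1.
Qed.

Lemma sphere2_neq0 u : sphere2 u -> u != 0.
Proof. by move=> h; rewrite -enorm_gt0 h. Qed.

Lemma dot_itv u v : sphere2 u -> sphere2 v -> -1 <= dot u v <= 1.
Proof.
move=> hu hv; have := dot_le u v; have := dot_le (- u) v.
by rewrite enormN hu hv dotNl mulr1; lra.
Qed.

Lemma cos_sphere_dist u v : sphere2 u -> sphere2 v ->
  cos (sphere_dist u v) = dot u v.
Proof. by move=> hu hv; rewrite acosK // in_itv /= dot_itv. Qed.

Lemma sphere_dist_ge0 u v : sphere2 u -> sphere2 v -> 0 <= sphere_dist u v.
Proof. by move=> hu hv; rewrite acos_ge0 // dot_itv. Qed.

Lemma sphere_dist_lepi u v : sphere2 u -> sphere2 v -> sphere_dist u v <= pi.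
Proof. by move=> hu hv; rewrite acos_lepi // dot_itv. Qed.

Lemma sphere_distC u v : sphere_dist u v = sphere_dist v u.
Proof. by rewrite /sphere_dist dotC. Qed.

Lemma sphere_distxx u : sphere2 u -> sphere_dist u u = 0.
Proof. by move=> /sphere2P h; rewrite /sphere_dist h acos1. Qed.

Lemma enormB_sphere u v : sphere2 u -> sphere2 v ->
  enorm (u - v) ^+ 2 = 2 - 2 * cos (sphere_dist u v).
Proof.
move=> hu hv; rewrite cos_sphere_dist // enorm_sqr !dotE (dotC v u).
by move/sphere2P: hu => ->; move/sphere2P: hv => ->; lra.
Qed.

Lemma sphere_dist_eq0 u v : sphere2 u -> sphere2 v ->
  sphere_dist u v = 0 -> u = v.
Proof.
move=> hu hv h; apply/eqP; rewrite -subr_eq0 -enorm_eq0 -sqrf_eq0.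
by rewrite enormB_sphere // h cos0 mulr1 subrr.
Qed.

Lemma sphere_dist_eqpi u v : sphere2 u -> sphere2 v ->
  sphere_dist u v = pi -> v = - u.
Proof.
move=> hu hv h; apply/eqP; rewrite -subr_eq0 opprK -enorm_eq0 -sqrf_eq0.
rewrite enorm_sqr !dotE (dotC v u) -(cos_sphere_dist hu hv) h cospi.
by move/sphere2P: hu => ->; move/sphere2P: hv => ->; apply/eqP; lra.
Qed.

Lemma sphere_dist_le u v k : sphere2 u -> sphere2 v -> 0 <= k -> k <= pi ->
  (sphere_dist u v <= k) = (cos k <= dot u v).
Proof.
move=> hu hv k0 kpi; rewrite -cos_sphere_dist //.
rewrite !leNgt ltr_cos // in_itv /=; first by rewrite k0 kpi.
by rewrite sphere_dist_ge0 // sphere_dist_lepi.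
Qed.

Lemma sin_sphere_dist u v : sphere2 u -> sphere2 v ->
  sin (sphere_dist u v) = enorm (u - dot u v *: v).
Proof.
move=> hu hv; rewrite sin_acos ?dot_itv // /enorm; congr Num.sqrt.
rewrite !dotE (dotC v u).
by move/sphere2P: hu => ->; move/sphere2P: hv => ->; ring.
Qed.

(** Projecting u and w on the plane orthogonal to v, Cauchy-Schwarz gives
    dot u w >= cos (d u v + d v w). *)
Lemma sphere_dist_triangle v u w : sphere2 u -> sphere2 v -> sphere2 w ->
  sphere_dist u w <= sphere_dist u v + sphere_dist v w.
Proof.
move=> hu hv hw.
have [big|small] := leP pi (sphere_dist u v + sphere_dist v w).
  exact: le_trans (sphere_dist_lepi hu hw) big.
rewrite sphere_dist_le ?addr_ge0 ?sphere_dist_ge0 // ?(ltW small) //.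
rewrite cosD !cos_sphere_dist // sin_sphere_dist // sphere_distC.
rewrite sin_sphere_dist //.
have := dot_le (- (u - dot u v *: v)) (w - dot w v *: v).
rewrite enormN !dotE (dotC w v); move/sphere2P: hv => ->; lra.
Qed.

Definition dir e : E3 := (enorm e)^-1 *: e.

Lemma dir_sphere2 e : e != 0 -> sphere2 (dir e).
Proof.
rewrite -enorm_gt0 => h.
by rewrite /sphere2 /= /dir enormZ ger0_norm ?invr_ge0 ?ltW // mulVf // gt_eqF.
Qed.

Lemma dirE e : e = enorm e *: dir e.
Proof.
have [->|e0] := eqVneq e 0; first by rewrite enorm0 scale0r.
by rewrite /dir scalerA mulfV ?scale1r // enorm_eq0.
Qed.

Lemma dirZ k e : 0 < k -> dir (k *: e) = dir e.
Proof.
move=> k0; rewrite /dir enormZ gtr0_norm // scalerA invfM.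
by rewrite mulrAC mulVf ?mul1r // gt_eqF.
Qed.

Lemma dir_unit u : sphere2 u -> dir u = u.
Proof. by rewrite /sphere2 /dir /= => ->; rewrite invr1 scale1r. Qed.

(** The direction of e1 + e2 lies on the minimal arc from the direction of
    e1 to that of e2: its components orthogonal to dir (e1 + e2) are opposite,
    which is the equality case in the triangle inequality. *)
Lemma sphere_dist_dirD e1 e2 : e1 != 0 -> e2 != 0 -> e1 + e2 != 0 ->
  sphere_dist (dir e1) (dir (e1 + e2)) + sphere_dist (dir (e1 + e2)) (dir e2)
    <= sphere_dist (dir e1) (dir e2).
Proof.
move=> e10 e20 e0.
set t1 := dir e1; set t2 := dir e2; set t := dir (e1 + e2).
have h1 : sphere2 t1 by exact: dir_sphere2.
have h2 : sphere2 t2 by exact: dir_sphere2.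
have h : sphere2 t by exact: dir_sphere2.
pose n := (enorm (e1 + e2))^-1.
have n0 : 0 < n by rewrite invr_gt0 enorm_gt0.
pose p := n * enorm e1; pose q := n * enorm e2.
have p0 : 0 < p by rewrite mulr_gt0 ?enorm_gt0.
have q0 : 0 < q by rewrite mulr_gt0 ?enorm_gt0.
have tE : t = p *: t1 + q *: t2.
  by rewrite /p /q -!scalerA -/(dir e1) -!dirE -scalerDr.
clearbody t1 t2 t p q; clear n n0.
have d11 : dot t1 t1 = 1 by apply/sphere2P.
have d22 : dot t2 t2 = 1 by apply/sphere2P.
have dtt : dot t t = 1 by apply/sphere2P.
set x := dot t1 t2.
have x_itv : -1 <= x <= 1 by exact: dot_itv.
have d1t : dot t1 t = p + q * x by rewrite tE !dotE d11 -/x; ring.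
have d2t : dot t2 t = q + p * x by rewrite tE !dotE d22 dotC -/x; ring.
have s1 := sin_sphere_dist h1 h; have s2 := sin_sphere_dist h2 h.
have opp : p *: (t1 - dot t1 t *: t) = - (q *: (t2 - dot t2 t *: t)).
  apply/eqP; rewrite -addr_eq0 !scalerBr addrACA -tE -opprD !scalerA.
  rewrite -scalerDl -!dotZl -dotDl -tE dtt scale1r subrr //.
have s12 : p * sin (sphere_dist t1 t) = q * sin (sphere_dist t2 t).
  rewrite s1 s2 -{1}(gtr0_norm p0) -{1}(gtr0_norm q0) -!enormZ opp enormN //.
(* the arc through t is not the longer one, so that comparing cosines, which
   are equal by the addition formula, compares angles *)
have le_pi : sphere_dist t1 t <= pi - sphere_dist t2 t.
  rewrite sphere_dist_le ?subr_ge0 ?sphere_dist_lepi //; last first.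
    by rewrite gerBl sphere_dist_ge0.
  rewrite addrC cosDpi cosN cos_sphere_dist // d1t d2t; nra.
rewrite (sphere_distC t t2) addrC -lerBrDr lerBrDr addrC.
have sum_ge0 : 0 <= sphere_dist t1 t + sphere_dist t2 t.
  by rewrite addr_ge0 ?sphere_dist_ge0.
have sum_lepi : sphere_dist t1 t + sphere_dist t2 t <= pi by lra.
rewrite leNgt; apply/negP => lt.
have : cos (sphere_dist t1 t + sphere_dist t2 t) < cos (sphere_dist t1 t2).
  rewrite ltr_cos // in_itv /= ?sum_ge0 ?sum_lepi //.
  by rewrite sphere_dist_ge0 ?sphere_dist_lepi.
rewrite cosD !cos_sphere_dist // d1t d2t -/x.
have sq : sin (sphere_dist t2 t) ^+ 2 = 1 - (q + p * x) ^+ 2.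
  by rewrite sin2cos2 cos_sphere_dist // d2t.
have norm1 : p ^+ 2 + q ^+ 2 + 2 * p * q * x = 1.
  by move: dtt; rewrite tE !dotE d11 d22 (dotC t2) -/x => h1'; rewrite -[RHS]h1'; ring.
have -> : sin (sphere_dist t1 t) = q / p * sin (sphere_dist t2 t).
  by rewrite -mulrAC -s12 mulrAC mulfV ?mul1r // gt_eqF.
rewrite -[q / p * _ * _]mulrA -expr2 sq.
(* freeing the value 1 of norm1 turns the claim into a polynomial identity *)
have key o : p ^+ 2 + q ^+ 2 + 2 * p * q * x = o ->
    (p + q * x) * (q + p * x) - q / p * (o - (q + p * x) ^+ 2) = x * o.
  by move=> <-; field; exact: lt0r_neq0.
by rewrite (key 1 norm1) mulr1 ltxx.
Qed.

Lemma cos_lip (x y : R) : x <= y -> cos x - cos y <= y - x.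
Proof.
move=> xy; have [z _ e] := @MVT_segment R cos (fun x => - sin x) x y xy
  (fun x _ => is_derive_cos x) (continuous_subspaceT (@continuous_cos R)).
rewrite -opprB e; have := sin_le1 z; have : 0 <= y - x by rewrite subr_ge0.
nra.
Qed.

Lemma enorm_le_sphere_dist u v k : sphere2 u -> sphere2 v -> 0 <= k ->
  sphere_dist u v <= k ^+ 2 / 2 -> enorm (u - v) <= k.
Proof.
move=> hu hv k0 h; rewrite ler_enorm // -enorm_sqr enormB_sphere //.
by have := cos_lip (sphere_dist_ge0 hu hv); rewrite cos0; lra.
Qed.

(** The estimate is uniform in u and v because the cosine decreases strictly
    on [0, pi]. *)
Lemma sphere_dist_le_enorm k : 0 < k -> exists2 d, 0 < d &
  forall u v, sphere2 u -> sphere2 v -> enorm (u - v) <= d ->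
  sphere_dist u v <= k.
Proof.
move=> k0; pose l := Num.min k pi.
have l0 : 0 < l by rewrite lt_min k0 pi_gt0.
have lpi : l <= pi by rewrite ge_min lexx orbT.
have d0 : 0 < 2 - 2 * cos l.
  rewrite -{1}(mulr1 2) -mulrBr mulr_gt0 // subr_gt0 -cos0.
  by rewrite ltr_cos // in_itv /= ?lexx ?pi_ge0 // ltW.
exists (Num.sqrt (2 - 2 * cos l)); first by rewrite sqrtr_gt0.
move=> u v hu hv; rewrite ler_enorm ?sqrtr_ge0 // -enorm_sqr.
rewrite enormB_sphere // sqr_sqrtr ?(ltW d0) // cos_sphere_dist // => h.
suff : sphere_dist u v <= l by move/le_trans; apply; rewrite ge_min lexx.
by rewrite sphere_dist_le // ?(ltW l0) //; lra.
Qed.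

End Vectors.

(** * Lengths of sequences of points, and turning of polygonals *)

Section PointSequences.
Context {R : realType}.
Notation E3 := 'rV[R]_3.

(** Unlike path_length, a function of the whole sequence, which makes
    concatenation and deletion of points uniform. *)
Definition plength (d : E3 -> E3 -> R) (s : seq E3) : R :=
  path_length d (head 0 s) (behead s).

Definition cyc (b : bool) (t : seq E3) := if b then t ++ take 1 t else t.

Lemma plength_cons2 d x y s :
  plength d (x :: y :: s) = d x y + plength d (y :: s).
Proof. by rewrite /plength /path_length /= big_cons. Qed.

Lemma plength0 d : plength d [::] = 0.
Proof. by rewrite /plength /path_length big_nil. Qed.

Lemma plength1 d x : plength d [:: x] = 0.
Proof. by rewrite /plength /path_length big_nil. Qed.

Lemma plength_cat d s1 p s2 :
  plength d (s1 ++ p :: s2) = plength d (rcons s1 p) + plength d (p :: s2).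
Proof.
elim: s1 => [|x [|y s1] ih]; first by rewrite plength1 add0r.
  by rewrite /= !plength_cons2 plength1 addr0.
by move: ih; rewrite /= !plength_cons2 => ->; rewrite addrA.
Qed.

Lemma plength_rcons2 d s x y :
  plength d (rcons (rcons s x) y) = plength d (rcons s x) + d x y.
Proof. by rewrite -cats1 cat_rcons plength_cat plength_cons2 plength1 addr0. Qed.

(** Insertion of points does not shorten a sequence of points, as long as the
    distance satisfies the triangle inequality on the set of its points. *)
Section Monotone.
Context (d : E3 -> E3 -> R) (S : set E3).
Hypothesis d_ge0 : forall x y, S x -> S y -> 0 <= d x y.
Hypothesis d_triangle : forall y x z, S x -> S y -> S z ->
  d x z <= d x y + d y z.

Lemma plength_ge0 s : (forall x, x \in s -> S x) -> 0 <= plength d s.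
Proof.
elim: s => [|x [|y s] ih] h; rewrite ?plength0 ?plength1 // plength_cons2.
rewrite addr_ge0 ?d_ge0 ?ih //; try by apply: h; rewrite !inE eqxx ?orbT.
by move=> z zs; apply: h; rewrite inE zs orbT.
Qed.

Lemma plength_del s1 x s2 : (forall z, z \in s1 ++ x :: s2 -> S z) ->
  plength d (s1 ++ s2) <= plength d (s1 ++ x :: s2).
Proof.
elim: s1 => [|z [|z' s1] ih] h.
- case: s2 h => [|y s2] h /=; first by rewrite plength0 plength1.
  rewrite plength_cons2 lerDr d_ge0 //; apply: h; rewrite ?inE eqxx ?orbT //.
- case: s2 h {ih} => [|y s2] h /=; rewrite !plength_cons2 ?plength1 ?addr0.
    by rewrite d_ge0 //; apply: h; rewrite ?inE eqxx ?orbT.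
  rewrite addrA lerD2r d_triangle //; apply: h; rewrite ?inE eqxx ?orbT //.
- move: ih; rewrite /= !plength_cons2 lerD2l; apply => y ys; apply: h.
  by rewrite inE ys orbT.
Qed.

Lemma plength_cat_ge s t : (forall x, x \in s ++ t -> S x) ->
  plength d s + plength d t <= plength d (s ++ t).
Proof.
case: t => [|y t]; first by rewrite cats0 plength0 addr0.
move=> h; rewrite plength_cat lerD2r -cats1 -[s in leLHS]cats0.
apply: plength_del => x; rewrite mem_cat !inE => hx; apply: h.
by rewrite mem_cat inE; case/orP: hx => ->; rewrite ?orbT.
Qed.

Lemma plength_cyc_del b s1 x s2 : (forall z, z \in s1 ++ x :: s2 -> S z) ->
  plength d (cyc b (s1 ++ s2)) <= plength d (cyc b (s1 ++ x :: s2)).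
Proof.
case: b; last exact: plength_del.
rewrite /cyc; case: s1 => [|z s1] h; last first.
  rewrite /= !take0 -!catA; apply: (@plength_del (z :: s1) x (s2 ++ _)) => y.
  rewrite -cat_cons catA cats1 mem_rcons inE => /predU1P[->|/h //].
  by apply: h; rewrite inE eqxx.
case: s2 h => [|y s2] h /=; first by rewrite plength0 plength_cons2 plength1
  addr0 d_ge0 //; apply: h; rewrite inE eqxx.
have [Sx Sy] : S x /\ S y by split; apply: h; rewrite !inE eqxx ?orbT.
rewrite take0 plength_cons2 -!cat_cons.
move: h; rewrite (lastI y s2); set z := last _ _; move: (belast _ _) => q h.
rewrite !cats1 !plength_rcons2 addrCA lerD2l [leRHS]addrC d_triangle //; apply: h.
by rewrite inE mem_rcons inE eqxx orbT.
Qed.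

Lemma plength_cyc_subseq b s t : subseq s t -> (forall z, z \in t -> S z) ->
  plength d (cyc b s) <= plength d (cyc b t).
Proof.
suff: forall p, subseq s t -> (forall z, z \in p ++ t -> S z) ->
    plength d (cyc b (p ++ s)) <= plength d (cyc b (p ++ t)).
  by move=> /(_ [::]).
elim: t s => [|y t ih] s p; first by rewrite subseq0 => /eqP ->.
move=> st h; have h' : forall z, z \in p ++ t -> S z.
  move=> z hz; apply: h; move: hz; rewrite !mem_cat inE.
  by case/orP => ->; rewrite ?orbT.
case: s st => [_|x s] /=.
  by apply: le_trans (plength_cyc_del _ h); apply: ih => //; exact: sub0seq.
case: eqP => [->|_] st.
  by rewrite -!cat_rcons; apply: ih => //; rewrite cat_rcons.
by apply: le_trans (plength_cyc_del _ h); exact: ih.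
Qed.

(** A point t of a minimal arc from t1 to t2 may replace both: insert t, then
    delete t1 and t2. *)
Lemma plength_merge s1 t1 t t2 s2 : d t1 t + d t t2 <= d t1 t2 -> S t ->
  (forall z, z \in s1 ++ t1 :: t2 :: s2 -> S z) ->
  plength d (s1 ++ t :: s2) <= plength d (s1 ++ t1 :: t2 :: s2).
Proof.
move=> le St h; apply: (@le_trans _ _ (plength d (s1 ++ t1 :: t :: t2 :: s2))).
  have h1 : forall z, z \in s1 ++ t1 :: t :: t2 :: s2 -> S z.
    move=> z; rewrite mem_cat !inE => hz.
    case: (z =P t) hz => [-> //|_] /= hz; apply: h.
    by rewrite mem_cat !inE.
  have := plength_del h1; apply: le_trans.
  have := @plength_del (rcons s1 t) t2 s2; rewrite !cat_rcons; apply => z hz.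
  apply: h1; move: hz; rewrite !mem_cat !inE.
  by move=> /orP[->|->] //; rewrite !orbT.
by rewrite plength_cat [leRHS]plength_cat lerD2l !plength_cons2 addrA lerD2r.
Qed.

Lemma plength_cyc_merge b s1 t1 t t2 s2 : d t1 t + d t t2 <= d t1 t2 -> S t ->
  (forall z, z \in s1 ++ t1 :: t2 :: s2 -> S z) ->
  plength d (cyc b (s1 ++ t :: s2)) <= plength d (cyc b (s1 ++ t1 :: t2 :: s2)).
Proof.
case: b; last exact: plength_merge.
rewrite /cyc; case: s1 => [|z s1] le St h; last first.
  rewrite /= !take0 -!catA.
  apply: (@plength_merge (z :: s1) t1 t t2 (s2 ++ _)) => // y.
  rewrite -2!cat_cons catA cats1 mem_rcons inE.
  by move=> /predU1P[->|/h //]; apply: h; rewrite inE eqxx.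
have [St1 St2] : S t1 /\ S t2 by split; apply: h; rewrite !inE eqxx ?orbT.
rewrite /= !take0 plength_cons2 -!cat_cons.
apply: (@le_trans _ _ (plength d (t :: t2 :: s2 ++ [:: t1; t]))).
  have h1 : forall z, z \in t :: t2 :: s2 ++ [:: t1; t] -> S z.
    move=> z; rewrite !inE mem_cat !inE => /or4P[/eqP-> //|/eqP->//|zs|].
      by apply: h; rewrite !inE zs !orbT.
    by move=> /orP[] /eqP ->.
  apply: le_trans (@plength_del [:: t] t2 _ h1) => /=.
  rewrite -cat_cons; apply: (@plength_del (t :: s2) t1 [:: t]) => z.
  move=> hz; apply: h1; move: hz; rewrite inE mem_cat !inE.
  by rewrite mem_cat !inE => /orP[->|->]; rewrite ?orbT.
rewrite plength_cons2 -cat_cons plength_cat plength_cons2 plength1 addr0.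
by rewrite -cats1; lra.
Qed.

End Monotone.
Lemma mem_cyc b (t : seq E3) z : z \in cyc b t -> z \in t.
Proof. by case: b; rewrite /cyc // mem_cat => /orP[|/mem_take]. Qed.

End PointSequences.

Section Turning.
Context {R : realType}.
Notation E3 := 'rV[R]_3.
Implicit Types (b : bool) (V W : seq E3).

(** The closing angle is counted or not according to the flag b, and not to
    the coincidence of the ends of V: pieces of a closed curve are treated as
    open, and the flag does not change when vertices are moved. *)
Definition turn b V : R := plength sphere_dist (cyc b (directions V)).

Lemma TC_polygonalE V : TC_polygonal V = turn (closed_polygonal V) V.
Proof. by []. Qed.

Definition dir_seq (e : E3) := if e != 0 then [:: dir e] else [::].

Lemma directions_cons2 x y V :
  directions (x :: y :: V) = dir_seq (y - x) ++ directions (y :: V).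
Proof. by rewrite /directions /edges /dir_seq /=; case: ifP. Qed.

Lemma directions1 (x : E3) : directions [:: x] = [::].
Proof. by []. Qed.

Lemma directions_cat V p W :
  directions (V ++ p :: W) = directions (rcons V p) ++ directions (p :: W).
Proof.
elim: V => [//|x [|y V] ih].
  by rewrite /= !directions_cons2 directions1 cats0.
by rewrite /= !directions_cons2 -catA; congr (_ ++ _).
Qed.

Lemma directions_sphere2 V u : u \in directions V -> sphere2 u.
Proof.
move=> /mapP[e]; rewrite mem_filter => /andP[e0 _] ->.
exact: dir_sphere2.
Qed.

Lemma turn_ge0 b V : 0 <= turn b V.
Proof.
by apply: (plength_ge0 sphere_dist_ge0) => u /mem_cyc /directions_sphere2.
Qed.

Lemma turn_cat_ge V W : turn false V + turn false W <= turn false (V ++ W).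
Proof.
case: W => [|p W].
  by rewrite cats0 {2}/turn /cyc /= plength0 addr0.
rewrite /turn /cyc directions_cat.
set D := directions (rcons V p).
apply: (@le_trans _ _ (plength sphere_dist D
    + plength sphere_dist (directions (p :: W)))); last first.
  apply: (plength_cat_ge sphere_dist_ge0 sphere_dist_triangle) => x; rewrite mem_cat.
  by case/orP => /directions_sphere2.
rewrite lerD2r /D; case: V {D} => [|x V]; first exact: lexx.
have -> : rcons (x :: V) p = belast x V ++ last x V :: [:: p].
  by rewrite -cats1 lastI cat_rcons.
rewrite directions_cat -lastI; set D := directions (x :: V).
have := @plength_cat_ge _ _ _ sphere_dist_ge0 sphere_dist_triangle
  D (directions (last x V :: [:: p])).
move=> /(_ _)/(le_trans _); apply; last first.
  by move=> z; rewrite mem_cat => /orP[] /directions_sphere2.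
by rewrite lerDl (plength_ge0 sphere_dist_ge0) // => z /directions_sphere2.
Qed.

(** A segment is replaced by two, whose directions bound a minimal arc through
    its direction. *)
Lemma turn_del_inner b V x y z W :
  turn b (V ++ [:: x, z & W]) <= turn b (V ++ [:: x, y, z & W]).
Proof.
rewrite /turn ![directions (V ++ _)]directions_cat !directions_cons2.
set A := directions (rcons V x); set B := directions (z :: W).
have hA u : u \in A -> sphere2 u := @directions_sphere2 _ u.
have hB u : u \in B -> sphere2 u := @directions_sphere2 _ u.
have hD (e u : E3) : u \in dir_seq e -> sphere2 u.
  by rewrite /dir_seq; case: ifP => //= e0; rewrite inE => /eqP ->;
    exact: dir_sphere2.
have hS u : u \in A ++ dir_seq (y - x) ++ dir_seq (z - y) ++ B -> sphere2 u.
  rewrite !mem_cat.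
  by case/or4P => [/hA|/hD|/hD|/hB].
have zxE : z - x = (y - x) + (z - y) by rewrite [RHS]addrC addrA subrK.
have [yx|yx] := eqVneq (y - x) 0; first by rewrite zxE yx add0r /dir_seq eqxx.
have [zy|zy] := eqVneq (z - y) 0; first by rewrite zxE zy addr0 /dir_seq eqxx.
(* when the new segment vanishes, directions are only deleted *)
have [zx|zx] := eqVneq (z - x) 0.
  apply: (plength_cyc_subseq sphere_dist_ge0 sphere_dist_triangle _ _ hS).
  by rewrite zx /dir_seq eqxx /=; apply: cat_subseq => //;
    apply: subseq_trans (suffix_subseq _ _); exact: suffix_subseq.
move: hS; rewrite /dir_seq yx zy zx /= => hS.
apply: (plength_cyc_merge sphere_dist_ge0 sphere_dist_triangle) => //.
  by rewrite zxE; apply: sphere_dist_dirD; rewrite -?zxE.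
exact: dir_sphere2.
Qed.

Lemma turn1 b x : turn b [:: x] = 0.
Proof. by case: b; rewrite /turn /cyc /= plength0. Qed.

(** Deleting an end of the polygonal deletes the first or the last direction. *)
Lemma turn_del b V x W : turn b (V ++ W) <= turn b (V ++ x :: W).
Proof.
have mono (s t : seq E3) : subseq s t -> (forall z, z \in t -> sphere2 z) ->
    plength sphere_dist (cyc b s) <= plength sphere_dist (cyc b t).
  exact: (plength_cyc_subseq sphere_dist_ge0 sphere_dist_triangle).
have hdir V' u : u \in directions V' -> sphere2 u := @directions_sphere2 V' u.
case: W => [|z W].
  rewrite cats0 cats1; apply: mono; last exact: hdir.
  case/lastP: V => [|V y]; first by [].
  rewrite -[in X in subseq _ X]cats1 cat_rcons directions_cat.
  exact: prefix_subseq.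
case/lastP: V => [|V y].
  apply: mono; last exact: hdir.
  by rewrite /= directions_cons2; exact: suffix_subseq.
by rewrite !cat_rcons; exact: turn_del_inner.
Qed.

Lemma turn_subseq b V W : subseq W V -> turn b W <= turn b V.
Proof.
suff: forall P, subseq W V -> turn b (P ++ W) <= turn b (P ++ V).
  by move=> /(_ [::]).
elim: V W => [|y V ih] W P; first by rewrite subseq0 => /eqP ->.
case: W => [_|x W] /=.
  by apply: le_trans (turn_del _ _ _ _); apply: ih; exact: sub0seq.
case: eqP => [->|_] st; first by rewrite -!cat_rcons; exact: ih.
by apply: le_trans (turn_del _ _ _ _); exact: ih.
Qed.

End Turning.

(** * Polygonals inscribed at sorted parameters *)

Section SortedParameters.
Context {R : realType}.
Notation E3 := 'rV[R]_3.
Implicit Types (xs ys zs : seq R) (g h : R -> E3).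

Notation sorted := (sorted <=%R).

Lemma le_sorted_head x xs y : sorted (x :: xs) -> y \in x :: xs -> x <= y.
Proof.
rewrite /= (path_sortedE le_trans) inE => /andP[/allP h _] /predU1P[->//|].
exact: h.
Qed.

Lemma undup_cons x xs :
  undup (x :: xs) = if x \in xs then undup xs else x :: undup xs.
Proof. by []. Qed.

Lemma undup_sorted_head x y xs : sorted (x :: xs) ->
  head y (undup (x :: xs)) = x.
Proof.
elim: xs x => [//|z xs ih] x xs_s; rewrite undup_cons; case: ifP => [xin|//].
have zx : z = x.
  apply/le_anti; move: xs_s => /= /andP[xz s]; rewrite xz andbT.
  exact: le_sorted_head s xin.
by rewrite ih //; case/andP: xs_s.
Qed.

Lemma undup_last x xs : last x (undup xs) = last x xs.
Proof.
elim: xs x => [//|y xs ih] x /=; case: ifP => [yin|_] /=; last exact: ih.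
rewrite ih; case/lastP: xs yin {ih} => [//|xs z] _.
by rewrite !last_rcons.
Qed.

(** Visiting the same parameter twice in a row adds a null segment, which has
    no direction. *)
Lemma directions_undup g xs : sorted xs ->
  directions (map g (undup xs)) = directions (map g xs).
Proof.
elim: xs => [//|x [//|y xs] ih] xs_s.
have ys_s : sorted (y :: xs) by case/andP: xs_s.
rewrite undup_cons [map g [:: x, y & xs]]/= directions_cons2.
rewrite -[g y :: _]/(map g (y :: xs)).
case: ifP => [xin|xnin].
  have -> : x = y.
    apply/le_anti; case/andP: (xs_s) => -> /= s.
    exact: le_sorted_head s xin.
  by rewrite subrr /dir_seq eqxx ih.
have := undup_sorted_head x ys_s; move: (ih ys_s).
case: (undup _) => [_ /= xy|z zs ihz /= zy].
  by move: xnin; rewrite xy inE eqxx.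
by rewrite directions_cons2 -[_ :: map g zs]/(map g (z :: zs)) ihz zy.
Qed.

Lemma turn_undup g b xs : sorted xs ->
  turn b (map g (undup xs)) = turn b (map g xs).
Proof. by move=> s; rewrite /turn directions_undup. Qed.

Lemma undup_subseq_sorted xs ys : sorted xs -> sorted ys ->
  {subset ys <= xs} -> subseq (undup ys) (undup xs).
Proof.
move=> sx sy sub.
have -> : undup ys = [seq z <- undup xs | z \in ys].
  apply: lt_sorted_eq.
  - by rewrite lt_sorted_uniq_le undup_uniq undup_sorted //; exact: le_trans.
  - rewrite lt_sorted_uniq_le filter_uniq ?undup_uniq //= sorted_filter //.
      exact: le_trans.
    by rewrite undup_sorted //; exact: le_trans.
  - move=> z; rewrite mem_filter !mem_undup /=.
    by case: (boolP (z \in ys)) => // /sub ->.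
exact: filter_subseq.
Qed.

(** Refinement of the set of parameters, repetitions being harmless. *)
Lemma turn_subset g b xs ys : sorted xs -> sorted ys -> {subset ys <= xs} ->
  turn b (map g ys) <= turn b (map g xs).
Proof.
move=> sx sy sub; rewrite -(turn_undup g _ sx) -(turn_undup g _ sy).
by apply/turn_subseq/map_subseq/undup_subseq_sorted.
Qed.

(** ** Lower semicontinuity of the turning *)

Lemma dir_continuous (e : E3) k : e != 0 -> 0 < k -> exists2 d, 0 < d &
  forall e', enorm (e' - e) <= d ->
    e' != 0 /\ sphere_dist (dir e') (dir e) <= k.
Proof.
move=> e0 k0; have [d d0 hd] := @sphere_dist_le_enorm R k k0.
have n0 : 0 < enorm e by rewrite enorm_gt0.
exists (Num.min (enorm e / 2) (d * enorm e / 2)).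
  by rewrite lt_min !divr_gt0 // mulr_gt0.
move=> e'; rewrite le_min => /andP[h1 h2].
have tri := enormD e' (e - e'); rewrite addrC subrK enormBC in tri.
have n'0 : 0 < enorm e' by lra.
have e'0 : e' != 0 by rewrite -enorm_gt0.
split=> //; apply: hd; [exact: dir_sphere2|exact: dir_sphere2|].
have -> : dir e' - dir e
    = (enorm e)^-1 *: ((e' - e) + (enorm e - enorm e') *: dir e').
  rewrite scalerDr scalerA mulrBr scalerBl scalerBr mulVf ?gt_eqF //.
  by rewrite scale1r -scalerA -dirE -/(dir e) [RHS]addrC addrA subrK.
rewrite enormZ gtr0_norm ?invr_gt0 // mulrC ler_pdivrMr //.
apply: le_trans (enormD _ _) _; rewrite enormZ dir_sphere2 // mulr1.
have : `|enorm e - enorm e'| <= enorm (e' - e).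
  rewrite ler_norml; have tri2 := enormD e (e' - e); rewrite addrC subrK in tri2.
  by apply/andP; split; lra.
lra.
Qed.

Lemma plength_close k (ts us : seq E3) : 0 <= k ->
  all2 (fun t u => sphere_dist t u <= k) ts us ->
  (forall t, t \in ts -> sphere2 t) -> (forall u, u \in us -> sphere2 u) ->
  plength sphere_dist us <= plength sphere_dist ts + k * 2 * (size us)%:R.
Proof.
move=> k0; elim: ts us => [|t ts ih] [|u us] //= h hts hus.
  by rewrite plength0 mulr0 addr0.
case/andP: h => tu; case: ts us ih hts hus => [|t' ts] [|u' us] // ih hts hus h.
  by rewrite !plength1 add0r !mulr_ge0.
rewrite !plength_cons2; have {ih} := ih (u' :: us) h.
have mem_t z : z \in t' :: ts -> z \in t :: t' :: ts.
  by move=> zin; rewrite inE zin orbT.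
have mem_u z : z \in u' :: us -> z \in u :: u' :: us.
  by move=> zin; rewrite inE zin orbT.
move=> /(_ (fun z hz => hts z (mem_t z hz)) (fun z hz => hus z (mem_u z hz))).
case/andP: h => tu' _.
have [Su Su'] : sphere2 u /\ sphere2 u'.
  by split; apply: hus; rewrite !inE eqxx ?orbT.
have [St St'] : sphere2 t /\ sphere2 t'.
  by split; apply: hts; rewrite !inE eqxx ?orbT.
have := sphere_dist_triangle Su St Su'; have := sphere_dist_triangle St St' Su'.
rewrite (sphere_distC u t) /= -[in X in _ -> _ -> _ -> _ <= X]natr1.
rewrite -[(size us).+1%:R]natr1; nra.
Qed.

(** Only the directions of null segments are discontinuous, and small segments
    created from null ones can only lengthen the indicatrix. *)
Lemma turn_lsc g b xs k : 0 < k -> exists2 d, 0 < d &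
  forall h, {in xs, forall x, enorm (h x - g x) <= d} ->
    turn b (map g xs) <= turn b (map h xs) + k.
Proof.
move=> k0.
have main l : 0 < l -> exists2 d, 0 < d &
  forall h, {in xs, forall x, enorm (h x - g x) <= d} ->
    exists2 ts, subseq ts (directions (map h xs)) &
      all2 (fun t u => sphere_dist t u <= l) ts (directions (map g xs)).
  move=> l0; elim: xs => [|x [|y xs] ih].
  - by exists 1 => // h _; exists [::].
  - by exists 1 => // h _; exists [::].
  have [d d0 hd] := ih.
  have [e0|e0] := eqVneq (g y - g x) 0.
    exists d => // h hh; have [|ts sub ts_all] := hd h.
      by move=> z zin; apply: hh; rewrite inE zin orbT.
    exists ts; first by apply: subseq_trans sub _; rewrite [X in subseq _ X]/=
      directions_cons2; exact: suffix_subseq.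
    by rewrite [map _ _]/= directions_cons2 e0 /dir_seq eqxx.
  have [d' d'0 hd'] := dir_continuous e0 l0.
  exists (Num.min d (d' / 2)); first by rewrite lt_min d0 divr_gt0.
  move=> h hh; have [|ts sub ts_all] := hd h.
    move=> z zin; apply: le_trans (hh z _) _; first by rewrite inE zin orbT.
    by rewrite ge_min lexx.
  have hx := hh x (mem_head _ _).
  have hy : enorm (h y - g y) <= Num.min d (d' / 2).
    by apply: hh; rewrite !inE eqxx orbT.
  rewrite le_min in hx; rewrite le_min in hy.
  case/andP: hx => _ hx; case/andP: hy => _ hy.
  have [|e'0 close] := hd' (h y - h x).
    have -> : h y - h x - (g y - g x) = (h y - g y) - (h x - g x).
      by rewrite !opprB addrACA [RHS]addrACA; congr (_ + _); rewrite addrC.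
    by apply: le_trans (enormD _ _) _; rewrite enormN; lra.
  exists (dir (h y - h x) :: ts).
    rewrite [X in subseq _ X]/= directions_cons2 /dir_seq e'0.
    by rewrite -[_ :: ts]cat1s subseq_cat2l.
  by rewrite [map _ _]/= directions_cons2 /dir_seq e0 /= close.
pose n := size (cyc b (directions (map g xs))).
(* each of the at most n directions contributes twice its displacement *)
have l0 : 0 < k / (2 * n.+1%:R) by rewrite divr_gt0 // mulr_gt0.
have [d d0 hd] := main _ l0; exists d => // h /hd[ts sub ts_all].
apply: (@le_trans _ _ (plength sphere_dist (cyc b ts) + k)); last first.
  rewrite lerD2r.
  apply: (plength_cyc_subseq sphere_dist_ge0 sphere_dist_triangle _ sub).
  by move=> z /directions_sphere2.
have ts_S t : t \in ts -> sphere2 t.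
  by move=> /(mem_subseq sub) /directions_sphere2.
have ts_cyc : all2 (fun t u => sphere_dist t u <= k / (2 * n.+1%:R))
    (cyc b ts) (cyc b (directions (map g xs))).
  case: (b) => //=; move: ts_all; case: (ts) (directions _) => [|t s] [|u us] //=.
  move=> /andP[tu]; rewrite !take0 tu /=; elim: s us => [|? ? ihs] [|? ?] //=.
    by rewrite tu.
  by case/andP => -> /ihs.
apply: le_trans (plength_close (ltW l0) ts_cyc _ _) _.
- by move=> t /mem_cyc; exact: ts_S.
- by move=> t /mem_cyc; exact: directions_sphere2.
- rewrite lerD2l -/n -[leRHS]mulr1 -!mulrA ler_pM2l // mulrC.
  by rewrite ler_pdivrMr ?mulr_gt0 // mul1r ler_pM2l // ler_nat.
Qed.

End SortedParameters.

(** * Local geometry of a curve of finite total curvature *)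

Section ArcLengthCurve.
Context {R : realType}.
Notation E3 := 'rV[R]_3.
Notation sorted := (sorted <=%R).
Implicit Types (g : R -> E3) (b : bool) (x y s k : R) (xs ys zs : seq R).

(** Length and total curvature as suprema over weakly increasing sequences of
    parameters: images of such sequences under monotone maps, such as moving
    points to a partition or changing the parameter, are again of this kind,
    whereas partitions may collapse. The Lipschitz bound says that a piece of
    g has at most the length of its interval of parameters, the last field
    that it has at least this length. *)
Record arclength_curve g (L : R) : Prop := ArclengthCurve {
  arclength_gt0 : 0 < L;
  arclength_lip : forall x y, 0 <= x -> x <= y -> y <= L ->
    enorm (g y - g x) <= y - x;
  arclength_adherent : forall x y k, 0 <= x -> x <= y -> y <= L -> 0 < k ->
    exists xs, [/\ sorted (x :: xs), last x xs = y &
      y - x - k <= plength edist (map g (x :: xs))] }.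

Record total_turning b g (L C : R) : Prop := TotalTurning {
  total_turning_ub : forall xs, sorted (0 :: xs) -> last 0 xs = L ->
    turn b (map g (0 :: xs)) <= C;
  total_turning_adherent : forall k, 0 < k -> exists xs,
    [/\ sorted (0 :: xs), last 0 xs = L & C - k <= turn b (map g (0 :: xs))] }.

Definition between (x y : R) xs := forall z, z \in xs -> x <= z <= y.

Lemma sorted_split xs z : sorted xs ->
  xs = [seq x <- xs | x <= z] ++ [seq x <- xs | z < x].
Proof.
elim: xs => [//|x xs ih] sx.
have sxs : sorted xs by exact: path_sorted sx.
rewrite /=; case: (leP x z) => [xz|zx]; first by rewrite cat_cons -ih.
have h y : y \in xs -> z < y.
  move=> yin; apply: lt_le_trans zx _; apply: le_sorted_head sx _.
  by rewrite inE yin orbT.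
have -> : [seq x <- xs | x <= z] = [::].
  by apply/eqP; rewrite -[_ == _]negbK -has_filter; apply/hasPn => y /h;
    rewrite -ltNge.
rewrite cat0s; congr cons; apply/esym/all_filterP/allP => y; exact: h.
Qed.

Lemma sorted_cat_le xs ys : sorted xs -> sorted ys ->
  (forall x y, x \in xs -> y \in ys -> x <= y) -> sorted (xs ++ ys).
Proof.
elim: xs => [//|x xs ih] sx sy h.
rewrite cat_cons /= (path_sortedE le_trans); apply/andP; split.
  apply/allP => y; rewrite mem_cat => /orP[yin|yin].
    by apply: le_sorted_head sx _; rewrite inE yin orbT.
  by apply: h => //; exact: mem_head.
apply: ih => //; first exact: path_sorted sx.
by move=> x' y x'in; apply: h; rewrite inE x'in orbT.
Qed.

Lemma le_sorted_last z xs y : sorted xs -> y \in xs -> y <= last z xs.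
Proof.
elim: xs z => [//|x xs ih] z sx; rewrite inE => /predU1P[->|yin] /=.
  exact: le_sorted_head sx (mem_last _ _).
by apply: ih => //; exact: path_sorted sx.
Qed.

Lemma sorted_map_homo (f : R -> R) xs : {homo f : x y / x <= y} ->
  sorted xs -> sorted (map f xs).
Proof. by move=> hf; apply: homo_sorted. Qed.

Lemma turn_le_cyc b (V : seq E3) : turn false V <= turn b V.
Proof.
case: b => //; rewrite /turn /cyc; set D := directions V.
have := @plength_cat_ge _ _ _ sphere_dist_ge0 sphere_dist_triangle D (take 1 D).
move=> /(_ _)/(le_trans _); apply; last first.
  by move=> z; rewrite mem_cat => /orP[|/mem_take] /directions_sphere2.
by rewrite lerDl (plength_ge0 sphere_dist_ge0) // => z /mem_take /directions_sphere2.
Qed.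

Lemma turn_between_le (c : R -> E3) b (lo hi C : R) xs : lo <= hi ->
  (forall ys, sorted (lo :: ys) -> last lo ys = hi ->
     turn b (map c (lo :: ys)) <= C) ->
  sorted xs -> between lo hi xs -> turn b (map c xs) <= C.
Proof.
move=> lohi h sx hx; have s1 : sorted (lo :: rcons xs hi).
  rewrite -cats1 -cat1s; apply: sorted_cat_le => //.
    apply: sorted_cat_le => // x y xin; rewrite inE => /eqP ->.
    by case/andP: (hx _ xin).
  move=> x y; rewrite inE => /eqP ->; rewrite mem_cat inE => /orP[yin|/eqP-> //].
  by case/andP: (hx _ yin).
apply: le_trans (h _ s1 _); last by rewrite last_rcons.
apply: turn_subset => // x xin.
by rewrite inE mem_rcons inE xin !orbT.
Qed.

(** ** Polygonals of small turning *)

Lemma ex_sphere2 : exists u : E3, sphere2 u.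
Proof.
exists (delta_mx 0 0); apply/sphere2P; rewrite /dot (bigD1 ord0) //= big1.
  by rewrite !mxE !eqxx mulr1 addr0.
by move=> i i0; rewrite !mxE /= (negPf i0) mulr0.
Qed.

Lemma sphere_dist_head_le (t : E3) ts u :
  (forall z, z \in t :: ts -> sphere2 z) -> u \in t :: ts ->
  sphere_dist t u <= plength sphere_dist (t :: ts).
Proof.
move=> h; rewrite inE => /predU1P[->|uin].
  rewrite sphere_distxx; last by apply: h; rewrite mem_head.
  exact: plength_ge0 sphere_dist_ge0 _ h.
have sub : subseq [:: t; u] (t :: ts).
  by rewrite -[t :: ts]cat1s -[[:: t; u]]cat1s subseq_cat2l sub1seq.
have := plength_cyc_subseq sphere_dist_ge0 sphere_dist_triangle false sub h.
by rewrite /cyc plength_cons2 plength1 addr0.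
Qed.

(** When the directions deviate from t by at most k, the component along t of
    each segment is at least cos k times its length. *)
Lemma dot_chord_ge (V : seq E3) t k : sphere2 t -> 0 <= k -> k <= pi ->
  (forall u, u \in directions V -> sphere_dist t u <= k) ->
  cos k * plength edist V <= dot (last 0 V - head 0 V) t.
Proof.
move=> ht k0 kpi; elim: V => [|x [|y V] ih] h.
- by rewrite plength0 /= subrr dot0l mulr0.
- by rewrite plength1 /= subrr dot0l mulr0.
have -> : last 0 [:: x, y & V] - head 0 [:: x, y & V] =
    (y - x) + (last 0 (y :: V) - head 0 (y :: V)).
  by rewrite /= [RHS]addrC addrA subrK.
rewrite plength_cons2 mulrDr dotDl lerD //; last first.
  by apply: ih => u uin; apply: h; rewrite directions_cons2 mem_cat uin orbT.
rewrite /Defs.edist; have [->|e0] := eqVneq (y - x) 0.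
  by rewrite enorm0 mulr0 dot0l.
rewrite [in leRHS](dirE (y - x)) dotZl mulrC ler_wpM2l ?enorm_ge0 // dotC.
rewrite -(sphere_dist_le ht (dir_sphere2 e0)) //.
by apply: h; rewrite directions_cons2 /dir_seq e0 mem_head.
Qed.

(** The first direction is one from which all the others deviate by at most
    the turning. *)
Lemma chord_ge (V : seq E3) k : 0 <= k -> k <= pi -> turn false V <= k ->
  cos k * plength edist V <= enorm (last 0 V - head 0 V).
Proof.
move=> k0 kpi hV.
have [t ht close] : exists2 t : E3, sphere2 t &
    forall u, u \in directions V -> sphere_dist t u <= k.
  move: hV; rewrite /turn /cyc; have := @directions_sphere2 _ V.
  case: (directions V) => [|t ts] h hV; first by have [t] := ex_sphere2; exists t.
  exists t => [|u uin]; first by apply: h; rewrite mem_head.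
  exact: le_trans (sphere_dist_head_le h uin) hV.
apply: le_trans (dot_chord_ge ht k0 kpi close) _.
by apply: le_trans (dot_le _ _) _; rewrite ht mulr1.
Qed.

Section Local.
Context (g : R -> E3) (L C : R) (b : bool).
Hypothesis hg : arclength_curve g L.
Hypothesis hC : total_turning b g L C.

Let L0 := arclength_gt0 hg.

Lemma turn_open_le xs : sorted xs -> between 0 L xs ->
  turn false (map g xs) <= C.
Proof.
move=> sx hx; apply: le_trans (turn_le_cyc b _) _.
exact: (turn_between_le (ltW L0) (total_turning_ub hC)).
Qed.

Lemma norm_lip x y : 0 <= x <= L -> 0 <= y <= L ->
  enorm (g y - g x) <= `|y - x|.
Proof.
move=> /andP[x0 xL] /andP[y0 yL]; case: (leP x y) => [xy|/ltW yx].
  by rewrite ger0_norm ?subr_ge0 // (arclength_lip hg).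
by rewrite enormBC ler0_norm ?subr_le0 // opprB (arclength_lip hg).
Qed.

(** Turning measured strictly after s is bounded by C, and a polygonal that
    nearly realizes its supremum starts after s, which leaves no turning
    between s and that start. *)
Lemma small_turn_right s k : 0 <= s -> s < L -> 0 < k -> exists d,
  [/\ 0 < d, s + d <= L & forall ys, sorted ys -> between s (s + d) ys ->
    turn false (map g ys) <= k].
Proof.
move=> s0 sL k0.
pose ok := [set xs | sorted xs /\ forall x, x \in xs -> s < x <= L].
pose E := [set turn false (map g xs) | xs in ok].
have supE : has_sup E.
  split; first by exists (turn false (map g [::])); exists [::].
  exists C => _ [xs [sx hx] <-]; apply: turn_open_le => // x /hx /andP[sx' ->].
  by rewrite (le_trans s0 (ltW sx')).
have [_ [xs [sx hx] <-] adh] := sup_adherent k0 supE.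
pose m := head L xs.
have sm : s < m by rewrite /m; case: (xs) hx => //= x xs' /(_ x (mem_head _ _))
  /andP[].
have mL : m <= L.
  by rewrite /m; case: (xs) hx => //= x xs' /(_ x (mem_head _ _)) /andP[].
have mx x : x \in xs -> m <= x.
  by rewrite /m; case: (xs) sx => //= y xs' sx; exact: le_sorted_head.
exists ((m - s) / 2); split; [by rewrite divr_gt0 // subr_gt0|by lra|].
move=> ys sy hy; apply/ler_addgt0Pr => e e0.
have [d d0 hd] := turn_lsc g false ys e0.
pose c := Num.min d ((m - s) / 2).
have c0 : 0 < c by rewrite lt_min d0 divr_gt0 // subr_gt0.
have cm : c <= (m - s) / 2 by rewrite ge_min lexx orbT.
have cd : c <= d by rewrite ge_min lexx.
(* moving the vertices away from s, by at most c, lets them precede xs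
   without meeting s *)
pose f y := Num.max (s + c) y.
have f_itv y : y \in ys -> s < f y <= (m + s) / 2.
  move=> /hy /andP[y1 y2]; rewrite lt_max ltrDl c0 /= ge_max; apply/andP.
  by split; lra.
have close : {in ys, forall y, enorm ((g \o f) y - g y) <= d}.
  move=> y yin; have /andP[f1 f2] := f_itv _ yin; have /andP[y1 y2] := hy _ yin.
  apply: le_trans (norm_lip _ _) _; [|
    by clear -f1 f2 s0 sm mL; apply/andP; split; lra|].
    by clear -y1 y2 s0 sm mL; apply/andP; split; lra.
  clear -y1 cd c0; apply: le_trans cd; rewrite /f; case: (leP (s + c) y) => ?.
    by rewrite subrr normr0 ltW.
  by rewrite ler_norml; apply/andP; split; lra.
apply: le_trans (hd _ close) _; rewrite lerD2r map_comp.
have mono : {homo f : x y / x <= y}.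
  by move=> x y xy; rewrite /f ge_max !le_max lexx xy orbT.
have ok_cat : ok (map f ys ++ xs).
  split=> [|x].
    apply: sorted_cat_le => //; first exact: sorted_map_homo.
    by move=> _ y /mapP[x xin ->] /mx ym; have /andP[] := f_itv _ xin; lra.
  rewrite mem_cat => /orP[/mapP[y yin ->]|/hx//].
  by have /andP[-> /=] := f_itv _ yin; lra.
have := turn_cat_ge (map g (map f ys)) (map g xs); rewrite -map_cat.
have : turn false (map g (map f ys ++ xs)) <= sup E.
  by apply: ub_le_sup; [case: supE|exists (map f ys ++ xs)].
lra.
Qed.

Lemma small_turn_left s k : 0 < s -> s <= L -> 0 < k -> exists d,
  [/\ 0 < d, 0 <= s - d & forall ys, sorted ys -> between (s - d) s ys ->
    turn false (map g ys) <= k].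
Proof.
move=> s0 sL k0.
pose ok := [set xs | sorted xs /\ forall x, x \in xs -> 0 <= x < s].
pose E := [set turn false (map g xs) | xs in ok].
have supE : has_sup E.
  split; first by exists (turn false (map g [::])); exists [::].
  exists C => _ [xs [sx hx] <-]; apply: turn_open_le => // x /hx /andP[-> sx'].
  by rewrite (le_trans (ltW sx')).
have [_ [xs [sx hx] <-] adh] := sup_adherent k0 supE.
pose m := last 0 xs.
have mx x : x \in xs -> x <= m by exact: le_sorted_last.
have [m0 ms] : 0 <= m /\ m < s.
  rewrite /m; case/lastP: (xs) hx => [//|ys y] /(_ y).
  by rewrite last_rcons mem_rcons mem_head => /(_ isT) /andP[].
exists ((s - m) / 2); split; [by rewrite divr_gt0 // subr_gt0|by lra|].
move=> ys sy hy; apply/ler_addgt0Pr => e e0.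
have [d d0 hd] := turn_lsc g false ys e0.
pose c := Num.min d ((s - m) / 2).
have c0 : 0 < c by rewrite lt_min d0 divr_gt0 // subr_gt0.
have cm : c <= (s - m) / 2 by rewrite ge_min lexx orbT.
have cd : c <= d by rewrite ge_min lexx.
pose f y := Num.min (s - c) y.
have f_itv y : y \in ys -> (m + s) / 2 <= f y < s.
  move=> /hy /andP[y1 y2]; rewrite gt_min gtrBl c0 /= le_min andbT; apply/andP.
  by split; lra.
have close : {in ys, forall y, enorm ((g \o f) y - g y) <= d}.
  move=> y yin; have /andP[f1 f2] := f_itv _ yin; have /andP[y1 y2] := hy _ yin.
  apply: le_trans (norm_lip _ _) _; [|
    by clear -f1 f2 sL ms m0; apply/andP; split; lra|].
    by clear -y1 y2 sL ms m0; apply/andP; split; lra.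
  clear -y2 cd c0; apply: le_trans cd; rewrite /f; case: (leP (s - c) y) => ?.
    by rewrite ler_norml; apply/andP; split; lra.
  by rewrite subrr normr0 ltW.
apply: le_trans (hd _ close) _; rewrite lerD2r map_comp.
have mono : {homo f : x y / x <= y}.
  by move=> x y xy; rewrite /f le_min !ge_min lexx xy orbT.
have ok_cat : ok (xs ++ map f ys).
  split=> [|x].
    apply: sorted_cat_le => //; first exact: sorted_map_homo.
    by move=> x _ /mx xm /mapP[y yin ->]; have /andP[] := f_itv _ yin; lra.
  rewrite mem_cat => /orP[/hx//|/mapP[y yin ->]].
  by have /andP[? ->] := f_itv _ yin; rewrite andbT; lra.
have := turn_cat_ge (map g xs) (map g (map f ys)); rewrite -map_cat.
have : turn false (map g (xs ++ map f ys)) <= sup E.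
  by apply: ub_le_sup; [case: supE|exists (xs ++ map f ys)].
lra.
Qed.

End Local.
End ArcLengthCurve.

(** ** One-sided tangents *)

Section Tangents.
Context {R : realType}.
Notation E3 := 'rV[R]_3.
Notation sorted := (sorted <=%R).
Implicit Types (x y s k : R) (xs ys zs : seq R).

(** Tangents as limits of the directions of all chords, in place of limits of
    the derivative: chords are the segments of inscribed polygonals, and the
    limits exist at every point. *)
Definition chord_limit_right (g : R -> E3) (L s : R) (u : E3) :=
  sphere2 u /\ forall k, 0 < k -> exists2 d, 0 < d &
    forall x y, s <= x -> x < y -> y <= s + d -> y <= L ->
      g y - g x != 0 /\ sphere_dist (dir (g y - g x)) u <= k.

Definition chord_limit_left (g : R -> E3) (s : R) (u : E3) :=
  sphere2 u /\ forall k, 0 < k -> exists2 d, 0 < d &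
    forall x y, 0 <= x -> s - d <= x -> x < y -> y <= s ->
      g y - g x != 0 /\ sphere_dist (dir (g y - g x)) u <= k.

(** Cauchy criterion on the sphere: Q d is the set of directions of chords at
    distance at most d from a point. *)
Lemma sphere_cauchy (Q : R -> E3 -> Prop) :
  (forall d u, Q d u -> sphere2 u) -> (forall d, 0 < d -> exists u, Q d u) ->
  (forall d d' u, d <= d' -> Q d u -> Q d' u) ->
  (forall k, 0 < k -> exists2 d, 0 < d &
     forall u v, Q d u -> Q d v -> sphere_dist u v <= k) ->
  exists2 u, sphere2 u & forall k, 0 < k -> exists2 d, 0 < d &
    forall v, Q d v -> sphere_dist v u <= k.
Proof.
move=> QS Qex Qmono Qsmall.
have n0 (n : nat) : 0 < n.+1%:R^-1 :> R by rewrite invr_gt0.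
have [w hw] := choice (fun n : nat => Qex _ (n0 n)).
have wS n : sphere2 (w n) by exact: QS (hw n).
have near_w d : 0 < d -> exists N, forall n, (N <= n)%N -> Q d (w n).
  move=> d0; pose N := Num.bound d^-1; exists N => n Nn.
  apply: Qmono (hw n); rewrite invf_ple ?posrE //.
  apply/ltW; apply: lt_le_trans (archi_boundP _) _; first by rewrite invr_ge0 ltW.
  by rewrite ler_nat ltnW // ltnS.
have wcvg : cvg (w @ \oo).
  apply: cauchy_cvg; apply: cauchy_exP => e e0.
  have e20 : 0 < e / 2 by rewrite divr_gt0.
  have e2 : 0 < (e / 2) ^+ 2 / 2 by rewrite divr_gt0 // exprn_gt0.
  have [d d0 hd] := Qsmall _ e2.
  have [N hN] := near_w d d0; exists (w N).
  exists N => // n /= Nn; rewrite -ball_normE /= /ball_.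
  apply: le_lt_trans (norm_le_enorm _) _.
  apply: (@le_lt_trans _ _ (e / 2)); last by lra.
  apply: enorm_le_sphere_dist => //; first exact: ltW.
  by apply: hd; exact: hN.
pose u := lim (w @ \oo).
have wu e : 0 < e -> exists N, forall n, (N <= n)%N -> enorm (u - w n) <= e.
  move=> e0; have e20 : 0 < e / 2 by rewrite divr_gt0.
  have /cvgrPdist_le /(_ _ e20) [N _ hN] := wcvg.
  exists N => n /hN h; apply: le_trans (enorm_le_norm _) _.
  by move: h; rewrite -/u; lra.
have uS : sphere2 u.
  rewrite /sphere2 /=; apply/le_anti/andP; split; apply/ler_addgt0Pr => e e0.
    have [N hN] := wu e e0; have := hN N (leqnn _).
    by have := enormD (u - w N) (w N); rewrite subrK wS; lra.
  have [N hN] := wu e e0; have := hN N (leqnn _).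
  by have := enormD (w N - u) u; rewrite subrK wS enormBC; lra.
exists u => // k k0; have k20 : 0 < k / 2 by rewrite divr_gt0.
have [d d0 hd] := Qsmall _ k20; exists d => // v Qv.
have [d' d'0 hd'] := sphere_dist_le_enorm k20.
have [N1 h1] := near_w d d0; have [N2 h2] := wu d' d'0.
pose n := maxn N1 N2.
apply: le_trans (sphere_dist_triangle (QS _ _ Qv) (wS n) uS) _.
have := hd _ _ Qv (h1 n (leq_maxl _ _)).
have := hd' _ _ uS (wS n) (h2 n (leq_maxr _ _)).
by rewrite (sphere_distC u); lra.
Qed.

Section Local.
Context (g : R -> E3) (L C : R) (b : bool).
Hypothesis hg : arclength_curve g L.
Hypothesis hC : total_turning b g L C.

(** The piece has length y - x and its inscribed polygonals turn little. *)
Lemma chord_lower x y k : 0 <= x -> x < y -> y <= L -> 0 <= k -> k <= pi / 2 ->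
  (forall zs, sorted zs -> between x y zs -> turn false (map g zs) <= k) ->
  cos k * (y - x) <= enorm (g y - g x).
Proof.
move=> x0 xy yL k0 kpi h.
have c0 : 0 <= cos k by apply: cos_ge0_pihalf; apply/andP; split => //; lra.
have c1 := cos_le1 k.
apply/ler_addgt0Pr => e e0.
have [xs [sxs lxs len]] := arclength_adherent hg x0 (ltW xy) yL e0.
have bt : between x y (x :: xs).
  move=> z zin; rewrite (le_sorted_head sxs zin) /=.
  by have := le_sorted_last x sxs zin; rewrite /= lxs.
have kpi' : k <= pi by have := @pi_ge0 R; lra.
have := chord_ge k0 kpi' (h _ sxs bt).
rewrite /= last_map lxs; set l := plength _ _ => hl.
have : cos k * (y - x - e) <= cos k * l by rewrite ler_wpM2l.
nra.
Qed.

Lemma chord_neq0 x y : 0 <= x -> x < y -> y <= L ->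
  (forall zs, sorted zs -> between x y zs -> turn false (map g zs) <= 1) ->
  g y - g x != 0.
Proof.
move=> x0 xy yL h; rewrite -enorm_gt0.
have pi2 := @pihalf_ge1 R.
apply: lt_le_trans (chord_lower x0 xy yL _ _ h) => //.
by rewrite mulr_gt0 ?subr_gt0 // cos1_gt0.
Qed.

(** Two chords, one after the other, are two segments of an inscribed
    polygonal, so the angle between them is at most its turning. *)
Lemma consecutive_chords x y z t k : x <= y -> y <= z -> z <= t ->
  turn false (map g [:: x; y; z; t]) <= k ->
  g y - g x != 0 -> g t - g z != 0 ->
  sphere_dist (dir (g y - g x)) (dir (g t - g z)) <= k.
Proof.
move=> xy yz zt h e1 e2; apply: le_trans h; rewrite /turn /cyc /=.
have hS := @directions_sphere2 _ [:: g x; g y; g z; g t].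
move: hS; rewrite !directions_cons2 directions1 cats0 /dir_seq e1 e2 /= => hS.
apply: sphere_dist_head_le hS _.
by rewrite inE mem_cat !inE eqxx !orbT.
Qed.

Lemma nondeg_right s : 0 <= s -> s < L -> exists2 d, 0 < d &
  s + d <= L /\ forall x y, s <= x -> x < y -> y <= s + d -> g y - g x != 0.
Proof.
move=> s0 sL; have [d [d0 dL hd]] := small_turn_right hg hC s0 sL ltr01.
exists d => //; split=> // x y sx xy yd; apply: chord_neq0 => //.
- exact: le_trans sx.
- exact: le_trans dL.
- move=> zs szs bt; apply: hd => // z /bt /andP[xz zy].
  by rewrite (le_trans sx xz) (le_trans zy yd).
Qed.

Lemma nondeg_left s : 0 < s -> s <= L -> exists2 d, 0 < d &
  0 <= s - d /\ forall x y, s - d <= x -> x < y -> y <= s -> g y - g x != 0.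
Proof.
move=> s0 sL; have [d [d0 dL hd]] := small_turn_left hg hC s0 sL ltr01.
exists d => //; split=> // x y sx xy yd; apply: chord_neq0 => //.
- exact: le_trans sx.
- exact: le_trans sL.
- move=> zs szs bt; apply: hd => // z /bt /andP[xz zy].
  by rewrite (le_trans sx xz) (le_trans zy yd).
Qed.

(** All the chords of a short piece on the right of s make a small angle with
    the chord of the next short piece, hence with each other. *)
Lemma chord_limit_right_ex s : 0 <= s -> s < L ->
  exists u, chord_limit_right g L s u.
Proof.
move=> s0 sL; have [d1 d10 [d1L nondeg]] := nondeg_right s0 sL.
pose Q d u := exists x y, [/\ s <= x, x < y, y <= s + d, y <= L &
  g y - g x != 0 /\ u = dir (g y - g x)].
have [||||u uS hu] := @sphere_cauchy Q.
- by move=> d u [x [y [_ _ _ _ [e0 ->]]]]; exact: dir_sphere2.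
- move=> d d0; pose e := Num.min d d1.
  have e0 : 0 < e by rewrite lt_min d0.
  have ed : e <= d by rewrite ge_min lexx.
  have ed1 : e <= d1 by rewrite ge_min lexx orbT.
  exists (dir (g (s + e) - g s)), s, (s + e); split; [lra|lra|lra|lra|].
  by split => //; apply: nondeg; lra.
- move=> d d' u dd' [x [y [sx xy yd yL e]]]; exists x, y; split=> //.
  by apply: le_trans yd _; rewrite lerD2l.
- move=> k k0; have k20 : 0 < k / 2 by rewrite divr_gt0.
  have [d [d0 dL hd]] := small_turn_right hg hC s0 sL k20.
  pose e := Num.min d d1.
  have e0 : 0 < e by rewrite lt_min d0.
  have ed : e <= d by rewrite ge_min lexx.
  have ed1 : e <= d1 by rewrite ge_min lexx orbT.
  pose f := dir (g (s + e) - g (s + e / 2)).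
  have fne : g (s + e) - g (s + e / 2) != 0 by apply: nondeg; lra.
  have close u : Q (e / 2) u -> sphere2 u /\ sphere_dist u f <= k / 2.
    move=> [x [y [sx xy ye yL [ne ->]]]]; split; first exact: dir_sphere2.
    clear -sx xy ye ne fne hd e0 ed.
    apply: (consecutive_chords _ _ _ _ ne fne); [exact: ltW|by []|lra|].
    apply: hd => [|z]; first by rewrite /= ltW // ye andbT; lra.
    clear -sx xy ye e0 ed.
    by rewrite !inE => /or4P[] /eqP ->; apply/andP; split; lra.
  exists (e / 2); first by rewrite divr_gt0.
  move=> u v /close[uS hu] /close[vS hv].
  apply: le_trans (sphere_dist_triangle uS (dir_sphere2 fne) vS) _.
  by rewrite (sphere_distC _ v); lra.
exists u; split=> // k k0; have [d d0 hd] := hu k k0.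
exists (Num.min d d1); first by rewrite lt_min d0.
move=> x y sx xy; rewrite -lerBlDl le_min => /andP[yd yd1] yL.
have ne : g y - g x != 0 by apply: nondeg => //; lra.
by split=> //; apply: hd; exists x, y; split=> //; lra.
Qed.

Lemma chord_limit_left_ex s : 0 < s -> s <= L ->
  exists u, chord_limit_left g s u.
Proof.
move=> s0 sL; have [d1 d10 [d1L nondeg]] := nondeg_left s0 sL.
pose Q d u := exists x y, [/\ 0 <= x, s - d <= x, x < y, y <= s &
  g y - g x != 0 /\ u = dir (g y - g x)].
have [||||u uS hu] := @sphere_cauchy Q.
- by move=> d u [x [y [_ _ _ _ [e0 ->]]]]; exact: dir_sphere2.
- move=> d d0; pose e := Num.min d d1.
  have e0 : 0 < e by rewrite lt_min d0.
  have ed : e <= d by rewrite ge_min lexx.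
  have ed1 : e <= d1 by rewrite ge_min lexx orbT.
  exists (dir (g s - g (s - e))), (s - e), s; split; [lra|lra|lra|lra|].
  by split => //; apply: nondeg; lra.
- move=> d d' u dd' [x [y [x0 sx xy ys e]]]; exists x, y; split=> //.
  by apply: le_trans sx; rewrite lerD2l lerN2.
- move=> k k0; have k20 : 0 < k / 2 by rewrite divr_gt0.
  have [d [d0 dL hd]] := small_turn_left hg hC s0 sL k20.
  pose e := Num.min d d1.
  have e0 : 0 < e by rewrite lt_min d0.
  have ed : e <= d by rewrite ge_min lexx.
  have ed1 : e <= d1 by rewrite ge_min lexx orbT.
  pose f := dir (g (s - e / 2) - g (s - e)).
  have fne : g (s - e / 2) - g (s - e) != 0 by apply: nondeg; lra.
  have close u : Q (e / 2) u -> sphere2 u /\ sphere_dist f u <= k / 2.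
    move=> [x [y [x0 sx xy ys [ne ->]]]]; split; first exact: dir_sphere2.
    clear -sx xy ys ne fne hd e0 ed.
    apply: (consecutive_chords _ _ _ _ fne ne); [lra|by []|exact: ltW|].
    apply: hd => [|z]; first by rewrite /= (ltW xy) sx !andbT; lra.
    clear -sx xy ys e0 ed.
    by rewrite !inE => /or4P[] /eqP ->; apply/andP; split; lra.
  exists (e / 2); first by rewrite divr_gt0.
  move=> u v /close[uS hu] /close[vS hv].
  apply: le_trans (sphere_dist_triangle uS (dir_sphere2 fne) vS) _.
  by rewrite (sphere_distC u); lra.
exists u; split=> // k k0; have [d d0 hd] := hu k k0.
exists (Num.min d d1); first by rewrite lt_min d0.
move=> x y x0; rewrite lerBlDr -lerBlDl le_min => /andP[yd yd1] xy ys.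
have ne : g y - g x != 0 by apply: nondeg => //; lra.
by split=> //; apply: hd; exists x, y; split=> //; lra.
Qed.

(** ** Turning of the initial pieces *)

(** The closing angle never counts here, even on a closed curve: it is reached
    only after all of g has been run through. *)
Definition turning_upto s : R :=
  sup [set turn false (map g xs) | xs in [set xs | sorted xs /\ between 0 s xs]].

Let has_sup_turning s : s <= L -> has_sup
  [set turn false (map g xs) | xs in [set xs | sorted xs /\ between 0 s xs]].
Proof.
move=> sL; split; first by exists (turn false (map g [::])); exists [::].
exists C => _ [xs [sx hx] <-]; apply: (turn_open_le hg hC) => // x /hx /andP[-> h].
exact: le_trans sL.
Qed.

Lemma turning_upto_ub s xs : s <= L -> sorted xs -> between 0 s xs ->
  turn false (map g xs) <= turning_upto s.
Proof.
move=> sL sx hx; apply: ub_le_sup; last by exists xs.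
by case: (has_sup_turning sL).
Qed.

Lemma turning_upto_adherent s k : s <= L -> 0 < k -> exists xs,
  [/\ sorted xs, between 0 s xs & turning_upto s - k < turn false (map g xs)].
Proof.
move=> sL k0; have [_ [xs [sx hx] <-] h] := sup_adherent k0 (has_sup_turning sL).
by exists xs.
Qed.

Lemma turning_upto_le s k : 0 <= s -> s <= L ->
  (forall xs, sorted xs -> between 0 s xs -> turn false (map g xs) <= k) ->
  turning_upto s <= k.
Proof.
move=> s0 sL h; apply: ge_sup; first by case: (has_sup_turning sL).
by move=> _ [xs [sx hx] <-]; exact: h.
Qed.

(** Left-continuity: by lower semicontinuity, the vertices of a polygonal can
    be moved slightly before s. *)
Lemma turning_upto_left s k : 0 < s -> s <= L ->
  (forall x, 0 <= x -> x < s -> turning_upto x <= k) -> turning_upto s <= k.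
Proof.
move=> s0 sL h; apply: turning_upto_le => // [|xs sx hx]; first exact: ltW.
apply/ler_addgt0Pr => e e0.
have [d d0 hd] := turn_lsc g false xs e0.
pose c := Num.min d s.
have c0 : 0 < c by rewrite lt_min d0.
have cs : c <= s by rewrite ge_min lexx orbT.
have cd : c <= d by rewrite ge_min lexx.
pose f y := Num.min (s - c) y.
have f_itv y : y \in xs -> 0 <= f y <= s - c.
  by move=> /hx /andP[y1 y2]; rewrite ge_min lexx le_min; apply/andP; split=> //;
    apply/andP; split; lra.
apply: le_trans (hd (g \o f) _) _ => [y yin|].
  have /andP[f1 f2] := f_itv _ yin; have /andP[y1 y2] := hx _ yin.
  apply: le_trans (norm_lip hg _ _) _; [by apply/andP; split; lra..|].
  apply: le_trans cd; rewrite /f; case: (leP (s - c) y) => ?.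
    by rewrite ler_norml; apply/andP; split; lra.
  by rewrite subrr normr0 ltW.
rewrite lerD2r map_comp; apply: le_trans (h (s - c) _ _); [|lra|lra].
apply: turning_upto_ub; first lra.
  by apply: sorted_map_homo => // x y xy; rewrite /f le_min !ge_min lexx xy orbT.
by move=> _ /mapP[y yin ->]; exact: f_itv.
Qed.

Lemma turning_upto_zero k : 0 < k -> exists y, [/\ 0 < y, y <= L &
  turning_upto y <= k].
Proof.
move=> k0; have L0 := arclength_gt0 hg.
have [d [d0 dL hd]] := small_turn_right hg hC (lexx 0) L0 k0.
rewrite add0r in dL hd; exists d; split=> //; apply: turning_upto_le => //.
exact: ltW.
Qed.

Lemma turn_join (V : seq E3) p W :
  turn false (V ++ p :: W) <= turn false (rcons V p) + turn false (p :: W) +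
    (if rev (directions (rcons V p)) is u :: _ then
       if directions (p :: W) is v :: _ then sphere_dist u v else 0 else 0).
Proof.
rewrite /turn /cyc directions_cat.
case/lastP: (directions (rcons V p)) => [|D u].
  by rewrite /= plength0 add0r addr0.
rewrite rev_rcons; case: (directions (p :: W)) => [|v D'].
  by rewrite cats0 plength0 !addr0.
by rewrite cat_rcons plength_cat plength_cons2; lra.
Qed.

Lemma directionsP (xs : seq R) u : sorted xs -> u \in directions (map g xs) ->
  exists x y, [/\ x \in xs, y \in xs, x < y & u = dir (g y - g x)].
Proof.
elim: xs => [//|x [//|y xs] ih] sx; rewrite [map _ _]/= directions_cons2 mem_cat.
case/orP => [|/ih]; last first.
  case=> [|x' [y' [xin yin xy ->]]]; first exact: path_sorted sx.
  by exists x', y'; split=> //; rewrite inE ?xin ?yin orbT.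
rewrite /dir_seq; case: ifP => // ne; rewrite inE => /eqP ->.
exists x, y; rewrite !inE !eqxx orbT; split=> //.
rewrite lt_neqAle; apply/andP; split; last by case/andP: sx.
by apply: contraTneq ne => ->; rewrite subrr eqxx.
Qed.

End Local.
End Tangents.

(** ** The jump of the turning at a point *)

Section Jump.
Context {R : realType}.
Notation E3 := 'rV[R]_3.
Notation sorted := (sorted <=%R).
Implicit Types (x y s k d : R) (xs ys zs : seq R) (V W : seq E3).

Lemma directions_nil p V : directions (p :: V) = [::] -> last p V = p.
Proof.
elim: V p => [//|q V ih] p; rewrite directions_cons2 /dir_seq.
case: eqP => [/eqP|//]; rewrite subr_eq0 => /eqP -> /= h; exact: ih.
Qed.

Section Local.
Context (g : R -> E3) (L C : R) (b : bool).
Hypothesis hg : arclength_curve g L.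
Hypothesis hC : total_turning b g L C.

(** A polygonal running slightly beyond s may be assumed to have s as a vertex.
    Its part up to s turns at most by A(s), its part after s turns little, and
    the angle at the vertex s is almost that of the one-sided tangents, as the
    adjacent segments are chords close to s. *)
Lemma turning_upto_jump s u v k : 0 < s -> s < L -> chord_limit_left g s u ->
  chord_limit_right g L s v -> 0 < k -> exists y, [/\ s < y, y <= L &
    turning_upto g y <= turning_upto g s + sphere_dist u v + k].
Proof.
move=> s0 sL [uS hu] [vS hv] k0.
have k30 : 0 < k / 3 by rewrite divr_gt0.
have [dl dl0 hdl] := hu _ k30; have [dr dr0 hdr] := hv _ k30.
have [ds [ds0 dsL hds]] := small_turn_right hg hC (ltW s0) sL k30.
pose e := Num.min dr ds.
have e0 : 0 < e by rewrite lt_min dr0.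
have edr : e <= dr by rewrite ge_min lexx.
have eds : e <= ds by rewrite ge_min lexx orbT.
pose z := Num.max 0 (s - dl).
have z0 : 0 <= z by rewrite le_max lexx.
have zdl : s - dl <= z by rewrite le_max lexx orbT.
have zs : z < s by rewrite gt_max s0 /=; lra.
exists (s + e); split; [lra|lra|].
apply: (turning_upto_le hg hC) => [||xs sx hx]; [lra|lra|].
(* with z as a vertex, the segment arriving at s is a chord of [z, s] *)
pose X1 := [seq x <- xs | x <= z].
pose X2 := [seq x <- [seq x <- xs | z < x] | x <= s].
pose X3 := [seq x <- [seq x <- xs | z < x] | s < x].
have sX : sorted [seq x <- xs | z < x] by apply: sorted_filter => //; exact: le_trans.
have s1 : sorted X1 by apply: sorted_filter => //; exact: le_trans.
have s2 : sorted X2 by apply: sorted_filter => //; exact: le_trans.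
have s3 : sorted X3 by apply: sorted_filter => //; exact: le_trans.
have m1 x : x \in X1 -> 0 <= x <= z.
  by rewrite mem_filter => /andP[-> /hx /andP[->]].
have m2 x : x \in X2 -> z <= x <= s.
  by rewrite !mem_filter => /and3P[-> /ltW ->].
have m3 x : x \in X3 -> s <= x <= s + e.
  by rewrite !mem_filter => /and3P[/ltW -> _ /hx /andP[]].
have sl : sorted (X1 ++ z :: rcons X2 s).
  apply: sorted_cat_le => // [|x y /m1/andP[_ xz]].
    rewrite -cat1s -cats1; apply: sorted_cat_le => //.
      by apply: sorted_cat_le => // x y /m2/andP[_ xs']; rewrite inE => /eqP ->.
    move=> x y; rewrite inE => /eqP ->; rewrite mem_cat inE.
    by case/orP => [/m2/andP[]//|/eqP ->]; exact: ltW.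
  rewrite inE mem_rcons inE => /or3P[/eqP -> //|/eqP->|/m2/andP[zy _]].
    exact: le_trans (ltW zs).
  exact: le_trans zy.
have sr : sorted (s :: X3).
  rewrite -cat1s; apply: sorted_cat_le => // x y; rewrite inE => /eqP ->.
  by case/m3/andP.
have sub : {subset xs <= X1 ++ z :: X2 ++ s :: X3}.
  move=> x xin; rewrite mem_cat inE mem_cat inE !mem_filter xin !andbT.
  by case: (leP x z) => //= zx; case: (leP x s) => //= sx'; rewrite !orbT.
have sall : sorted (X1 ++ z :: X2 ++ s :: X3).
  have -> : X1 ++ z :: X2 ++ s :: X3 = (X1 ++ z :: rcons X2 s) ++ X3.
    by rewrite -catA /= cat_rcons.
  apply: sorted_cat_le => // x y xin /m3/andP[sy _]; apply: le_trans sy.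
  have := le_sorted_last 0 sl xin.
  by rewrite last_cat /= last_rcons.
apply: le_trans (turn_subset g false sall sx sub) _.
have -> : map g (X1 ++ z :: X2 ++ s :: X3) =
    (map g X1 ++ g z :: map g X2) ++ g s :: map g X3.
  by rewrite map_cat /= map_cat -catA.
apply: le_trans (turn_join _ _ _) _.
have lE : rcons (map g X1 ++ g z :: map g X2) (g s) =
    map g (X1 ++ z :: rcons X2 s).
  by rewrite map_cat /= map_rcons rcons_cat.
rewrite lE -[g s :: map g X3]/(map g (s :: X3)).
have leftT : turn false (map g (X1 ++ z :: rcons X2 s)) <= turning_upto g s.
  apply: (turning_upto_ub hg hC) => //; first exact: ltW.
  move=> x; rewrite mem_cat inE mem_rcons inE.
  case/or4P => [/m1/andP[-> xz]|/eqP->|/eqP->|/m2/andP[zx ->]].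
  - by rewrite (le_trans xz) // ltW.
  - by rewrite z0 ltW.
  - by rewrite lexx ltW.
  - by rewrite (le_trans z0).
have rightT : turn false (map g (s :: X3)) <= k / 3.
  apply: hds => // x; rewrite inE => /predU1P[->|/m3/andP[-> xe]].
    by rewrite lexx lerDl ltW.
  by rewrite (le_trans xe) // lerD2l.
apply: le_trans (lerD (lerD leftT rightT) (lexx _)) _.
rewrite map_cat [map g (z :: _)]/= directions_cat rev_cat.
rewrite -[g z :: _]/(map g (z :: rcons X2 s)).
case E1 : (rev (directions (map g (z :: rcons X2 s)))) => [|u' D].
  exfalso; have /directions_nil : directions (map g (z :: rcons X2 s)) = [::].
    by rewrite -[LHS]revK E1.
  rewrite last_map last_rcons => /eqP; rewrite -subr_eq0 => /eqP e00.
  have [] := hdl z s z0 zdl zs (lexx _).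
  by rewrite e00; case/eqP.
have [x' [y' [xin yin xy u'E]]] : exists x y, [/\ x \in z :: rcons X2 s,
    y \in z :: rcons X2 s, x < y & u' = dir (g y - g x)].
  apply: directionsP; last by rewrite -mem_rev E1 mem_head.
  by case/cat_sorted2: sl.
have zin x : x \in z :: rcons X2 s -> z <= x <= s.
  rewrite inE mem_rcons inE => /or3P[/eqP->|/eqP->|/m2//].
    by rewrite lexx ltW.
  by rewrite lexx ltW.
have uu' : sphere2 u' /\ sphere_dist u' u <= k / 3.
  have /andP[zx' _] := zin _ xin; have /andP[_ ys'] := zin _ yin.
  have [ne cl] := hdl x' y' (le_trans z0 zx') (le_trans zdl zx') xy ys'.
  by rewrite u'E; split=> //; exact: dir_sphere2.
case: uu' => u'S uu'.
case E2 : (directions (map g (s :: X3))) => [|v' D'] /=.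
  by have := sphere_dist_ge0 uS vS; clear -k30; lra.
have [x2 [y2 [x2in y2in xy2 v'E]]] : exists x y, [/\ x \in s :: X3,
    y \in s :: X3, x < y & v' = dir (g y - g x)].
  by apply: directionsP => //; rewrite E2 mem_head.
have sin x : x \in s :: X3 -> s <= x <= s + e.
  by rewrite inE => /predU1P[->|/m3//]; rewrite lexx lerDl ltW.
have [v'S vv'] : sphere2 v' /\ sphere_dist v' v <= k / 3.
  have /andP[sx2 _] := sin _ x2in; have /andP[_ ys2] := sin _ y2in.
  have [] := hdr x2 y2 sx2 xy2; [by clear -ys2 edr; lra|by clear -ys2 eds dsL; lra|move=> ne cl].
  by rewrite v'E; split=> //; exact: dir_sphere2.
have := sphere_dist_triangle u'S uS v'S; have := sphere_dist_triangle uS vS v'S.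
by rewrite (sphere_distC v v'); clear -uu' vv'; lra.
Qed.

End Local.
End Jump.

(** * Fine partitions *)

Section FinePartitions.
Context {R : realType}.
Notation E3 := 'rV[R]_3.
Notation sorted := (sorted <=%R).
Implicit Types (x y z s k d : R) (xs ys zs : seq R).

(** Fine in arc length, and allowed to repeat points: several parameters of c
    may have the same arc-length coordinate. *)
Definition fine_partition d L xs :=
  path (fun x y => (x <= y) && (y <= x + d)) 0 xs /\ last 0 xs = L.

Lemma fine_sorted d L xs : fine_partition d L xs -> sorted (0 :: xs).
Proof. by move=> [h _]; apply: sub_path h => x y /andP[]. Qed.

Lemma fine_between d L xs : fine_partition d L xs -> between 0 L (0 :: xs).
Proof.
move=> h z zin; have s := fine_sorted h; case: h => _ <-.
by rewrite (le_sorted_head s zin) (le_sorted_last 0 s zin).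
Qed.

Lemma fine_ex L d : 0 < L -> 0 < d -> exists2 xs,
  fine_partition d L xs & path <%R 0 xs.
Proof.
move=> L0 d0.
have step n x e : 0 < e -> e <= d -> exists2 xs,
    path (fun x y => (x < y) && (y <= x + d)) x xs & last x xs = x + e * n%:R.
  move=> e0 ed; elim: n x => [|n ih] x.
    by exists [::]; rewrite //= mulr0 addr0.
  have [xs pxs lxs] := ih (x + e); exists (x + e :: xs) => /=.
    by rewrite pxs ltrDl e0 lerD2l ed.
  by rewrite lxs -natr1; ring.
pose n := Num.bound (L / d).
have n0' : 0 < n%:R :> R.
  apply: le_lt_trans (archi_boundP _); exact: divr_ge0 (ltW L0) (ltW d0).
have [||xs pxs lxs] := step n 0 (L / n%:R).
- by rewrite divr_gt0.
- rewrite ler_pdivrMr // mulrC -ler_pdivrMr //.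
  by apply/ltW/archi_boundP; rewrite divr_ge0 // ltW.
exists xs; last by apply: sub_path pxs => x y /andP[].
split; first by apply: sub_path pxs => x y /andP[/ltW ->].
by rewrite lxs add0r mulrVK // unitfE gt_eqF.
Qed.

Definition floor_in xs z : R := last 0 [seq x <- xs | x <= z].

Lemma floor_in_mem xs z : floor_in xs z \in 0 :: xs.
Proof.
have := mem_last 0 [seq x <- xs | x <= z].
by rewrite !inE mem_filter => /orP[->//|/andP[_ ->]]; rewrite orbT.
Qed.

Lemma floor_in_le xs z : 0 <= z -> floor_in xs z <= z.
Proof.
move=> z0; have := mem_last 0 [seq x <- xs | x <= z].
by rewrite inE mem_filter -/(floor_in xs z) => /orP[/eqP ->|/andP[]].
Qed.

Lemma floor_in_max xs z x : sorted (0 :: xs) -> x \in 0 :: xs -> 0 <= z ->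
  x <= z -> x <= floor_in xs z.
Proof.
move=> sx xin z0 xz.
have s' : sorted (0 :: [seq x <- xs | x <= z]).
  have := sorted_filter le_trans (fun x => x <= z) sx.
  by rewrite /= z0.
apply: (le_sorted_last 0 s'); move: xin; rewrite !inE mem_filter xz.
by [].
Qed.

Lemma floor_in_homo xs z z' : sorted (0 :: xs) -> 0 <= z -> z <= z' ->
  floor_in xs z <= floor_in xs z'.
Proof.
move=> sx z0 zz'; apply: floor_in_max => //.
- exact: floor_in_mem.
- exact: le_trans zz'.
- by apply: le_trans zz'; exact: floor_in_le.
Qed.

Lemma floor_in_ge d L xs z : 0 <= d -> fine_partition d L xs -> 0 <= z ->
  z <= L -> z - d <= floor_in xs z.
Proof.
move=> d0 [pxs lxs] z0 zL; rewrite lerBlDr.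
suff: forall y, y <= z -> path (fun x y => (x <= y) && (y <= x + d)) y xs ->
    z <= last y xs -> z <= last y [seq x <- xs | x <= z] + d.
  by apply=> //; rewrite lxs.
elim: xs {pxs lxs} => [|x xs ih] y yz /=.
  by move=> _ /le_trans; apply; rewrite lerDl.
move=> /andP[/andP[yx xd] pxs] zl; case: (leP x z) => [xz|zx] /=.
  exact: ih.
have -> : [seq x <- xs | x <= z] = [::].
  apply/eqP; rewrite -[_ == _]negbK -has_filter; apply/hasPn => w win.
  rewrite -ltNge; apply: lt_le_trans zx _.
  have sx : sorted (x :: xs) by apply: sub_path pxs => ? ? /andP[].
  by apply: le_sorted_head sx _; rewrite inE win orbT.
exact: le_trans (ltW zx) xd.
Qed.

Section Local.
Context (g : R -> E3) (L C : R) (b : bool).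
Hypothesis hg : arclength_curve g L.
Hypothesis hC : total_turning b g L C.

Let L0 := arclength_gt0 hg.

Lemma floor_in_close d d' xs zs : 0 <= d -> d <= d' -> fine_partition d L xs ->
  between 0 L zs ->
  {in zs, forall z, enorm ((g \o floor_in xs) z - g z) <= d'}.
Proof.
move=> d0 dd' fxs hzs z /hzs /andP[z0 zL]; apply: le_trans dd'.
have f1 := floor_in_ge d0 fxs z0 zL; have f2 := floor_in_le xs z0.
have /andP[f3 f4] := fine_between fxs (floor_in_mem xs z).
apply: le_trans (norm_lip hg _ _) _; [by apply/andP|by apply/andP|].
by rewrite ler_norml; apply/andP; split; lra.
Qed.

Lemma floor_in_sorted xs zs s : sorted (0 :: xs) -> sorted zs -> between 0 s zs ->
  sorted (map (floor_in xs) zs).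
Proof.
move=> sx + hz; elim: zs hz => [//|z [//|z' zs] ih] hz /= /andP[zz' szs].
rewrite floor_in_homo //=; last by have /andP[] := hz z (mem_head _ _).
by apply: ih => // w win; apply: hz; rewrite inE win orbT.
Qed.

(** Valid for any curve w, because it only compares sets of parameters. *)
Lemma turn_floor_in (w : R -> E3) b' d xs zs : fine_partition d L xs ->
  sorted (0 :: zs) -> last 0 zs = L ->
  turn b' (map w (map (floor_in xs) (0 :: zs))) <= turn b' (map w (0 :: xs)).
Proof.
move=> fxs szs lzs; have sx := fine_sorted fxs.
have hzsL : between 0 L (0 :: zs).
  move=> z zin; rewrite (le_sorted_head szs zin) /= -lzs.
  exact: (le_sorted_last 0 szs zin).
apply: turn_subset => //; first exact: floor_in_sorted hzsL.
by move=> _ /mapP[z _ ->]; exact: floor_in_mem.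
Qed.

(** Finely inscribed polygonals nearly realize the supremum of the turning of
    each initial piece: a fixed polygonal is approximated by moving its
    vertices back to points of the partition. *)
Lemma fine_turning_upto s k : 0 <= s -> s <= L -> 0 < k -> exists2 d, 0 < d &
  forall xs ys, fine_partition d L xs -> sorted ys ->
    (forall x, x \in 0 :: xs -> x <= s -> x \in ys) ->
    turning_upto g s - k <= turn false (map g ys).
Proof.
move=> s0 sL k0; have k20 : 0 < k / 2 by rewrite divr_gt0.
have [zs [szs hzs hA]] := turning_upto_adherent hg hC sL k20.
have [d d0 hd] := turn_lsc g false zs k20.
exists d => // xs ys fxs sys sub.
have hzsL : between 0 L zs by move=> z /hzs /andP[-> /le_trans]; apply.
have := hd _ (floor_in_close (ltW d0) (lexx d) fxs hzsL); rewrite map_comp.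
have : turn false (map g (map (floor_in xs) zs)) <= turn false (map g ys).
  apply: turn_subset => //; first exact: floor_in_sorted (fine_sorted fxs) szs hzs.
  move=> _ /mapP[z /hzs /andP[z0 zs'] ->]; apply: sub; first exact: floor_in_mem.
  exact: le_trans (floor_in_le _ z0) zs'.
lra.
Qed.

Lemma fine_total_turning k : 0 < k -> exists2 d, 0 < d &
  forall xs, fine_partition d L xs -> C - k <= turn b (map g (0 :: xs)).
Proof.
move=> k0; have k20 : 0 < k / 2 by rewrite divr_gt0.
have [zs [szs lzs hA]] := total_turning_adherent hC k20.
have [d d0 hd] := turn_lsc g b (0 :: zs) k20.
exists d => // xs fxs; have sx := fine_sorted fxs.
have hzsL : between 0 L (0 :: zs).
  move=> z zin; rewrite (le_sorted_head szs zin) /= -lzs.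
  exact: (le_sorted_last 0 szs zin).
have := hd _ (floor_in_close (ltW d0) (lexx d) fxs hzsL); rewrite map_comp.
have := turn_floor_in g b fxs szs lzs.
lra.
Qed.

End Local.
End FinePartitions.

(** * Tangent indicatrices *)

Section Indicatrix.
Context {R : realType}.
Notation E3 := 'rV[R]_3.
Implicit Types (f : R -> E3) (u v : E3) (us V : seq E3) (s : R).

Lemma spherical_polygonal_lip f u us :
  (forall v, v \in u :: us -> sphere2 v) -> spherical_polygonal f u us ->
  forall s s', 0 <= s -> s <= s' -> s' <= plength sphere_dist (u :: us) ->
  [/\ sphere2 (f s), sphere2 (f s') & sphere_dist (f s) (f s') <= s' - s].
Proof.
elim: us f u => [|v us ih] f u h hf s s' s0 ss' s'l.
  rewrite plength1 in s'l; have -> : s = 0 by lra.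
  have -> : s' = 0 by lra.
  have uS : sphere2 u by apply: h; exact: mem_head.
  by rewrite /= in hf; rewrite hf sphere_distxx // subrr.
case: hf => -[f0 fd fS fdist] hf'; set d := sphere_dist u v in f0 fd fS fdist hf'.
rewrite plength_cons2 -/d in s'l.
have d0 : 0 <= d.
  by apply: sphere_dist_ge0; apply: h; rewrite !inE eqxx ?orbT.
have h' w : w \in v :: us -> sphere2 w.
  by move=> win; apply: h; rewrite inE win orbT.
have l0 : 0 <= plength sphere_dist (v :: us) by exact: plength_ge0 sphere_dist_ge0 _ h'.
have arc r r' : 0 <= r -> r <= r' -> r' <= d ->
    [/\ sphere2 (f r), sphere2 (f r') & sphere_dist (f r) (f r') <= r' - r].
  move=> r0 rr' r'd; split.
  - by apply: fS; rewrite in_itv /= r0; exact: le_trans r'd.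
  - by apply: fS; rewrite in_itv /= r'd andbT; exact: le_trans rr'.
  rewrite fdist ?in_itv /= ?r0 ?r'd ?(le_trans r0) ?(le_trans rr') //.
  by rewrite ler0_norm ?opprB // subr_le0.
have rest r r' : d <= r -> r <= r' -> r' <= d + plength sphere_dist (v :: us) ->
    [/\ sphere2 (f r), sphere2 (f r') & sphere_dist (f r) (f r') <= r' - r].
  move=> dr rr' r'l; have := ih _ _ h' hf' (r - d) (r' - d).
  rewrite !(addrC d) !subrK => -[||| S1 S2 D]; [lra|lra|lra|].
  by split=> //; lra.
have [s'd|/ltW ds'] := leP s' d; first exact: arc.
have [sd|/ltW ds] := leP s d; last exact: rest.
have [S1 S2 D1] := arc s d s0 sd (lexx d).
have [_ S3 D2] := rest d s' (lexx d) ds' s'l.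
split=> //; apply: le_trans (sphere_dist_triangle S1 S2 S3) _; lra.
Qed.

Lemma spherical_polygonal_pos f u us1 us2 :
  spherical_polygonal f u (us1 ++ us2) ->
  f (plength sphere_dist (u :: us1)) = last u us1.
Proof.
elim: us1 f u => [|v us1 ih] f u /= hf.
  rewrite plength1; case: us2 hf => [//|v us2] /= [[] //].
by case: hf => _ /ih; rewrite plength_cons2.
Qed.

(** The flag b stands for closed_polygonal V, as in turn. *)
Definition is_indicatrix (b : bool) V f : Prop :=
  if cyc b (directions V) is u :: us then spherical_polygonal f u us else False.

Lemma tangent_indicatrixE V f :
  tangent_indicatrix V f = is_indicatrix (closed_polygonal V) V f.
Proof. by []. Qed.

Lemma cyc_sphere2 b V u : u \in cyc b (directions V) -> sphere2 u.
Proof. by move=> /mem_cyc /directions_sphere2. Qed.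

Lemma indicatrix_lip b V f : is_indicatrix b V f ->
  forall s s', 0 <= s -> s <= s' -> s' <= turn b V ->
  [/\ sphere2 (f s), sphere2 (f s') & sphere_dist (f s) (f s') <= s' - s].
Proof.
rewrite /is_indicatrix /turn; have := @cyc_sphere2 b V.
case: (cyc b _) => [//|u us] h; exact: spherical_polygonal_lip.
Qed.

Lemma indicatrix_pos b V f D1 u D2 : is_indicatrix b V f ->
  directions V = rcons D1 u ++ D2 ->
  f (plength sphere_dist (rcons D1 u)) = u.
Proof.
rewrite /is_indicatrix => + VE.
have [E ->] : exists E, cyc b (directions V) = rcons D1 u ++ E.
  rewrite VE; case: b => /=; last by exists D2.
  by exists (D2 ++ take 1 (rcons D1 u ++ D2)); rewrite catA.
case: D1 {VE} => [|w D1] /=; first exact: (@spherical_polygonal_pos f u [::]).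
by move/spherical_polygonal_pos; rewrite last_rcons.
Qed.

Lemma indicatrix0 b V f u D : is_indicatrix b V f -> directions V = u :: D ->
  f 0 = u.
Proof.
move=> hf VE; have := @indicatrix_pos b V f [::] u D hf VE.
by rewrite plength1.
Qed.

Lemma indicatrix_closed V f : is_indicatrix true V f -> f (turn true V) = f 0.
Proof.
move=> hf; have := hf; rewrite /is_indicatrix /turn.
case VE : (directions V) => [//|u D]; rewrite (indicatrix0 hf VE) /= take0.
rewrite cats1 -[rcons D u]cats0 => /spherical_polygonal_pos.
by rewrite last_rcons cats0.
Qed.

Lemma directions_prefix (V W : seq E3) :
  exists E, directions (V ++ W) = directions V ++ E.
Proof.
case: W => [|p W]; first by exists [::]; rewrite !cats0.
case/lastP: V => [|V q]; first by exists (directions (p :: W)).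
rewrite cat_rcons directions_cat; by exists (directions [:: q, p & W]).
Qed.

(** An indicatrix passes through the directions of its polygonal at the times
    given by the turning of the initial parts of the polygonal. *)
Lemma indicatrix_prefix b (g : R -> E3) f (xs ys zs : seq R) (z : R) :
  sorted <=%R (xs ++ z :: ys ++ zs) ->
  is_indicatrix b (map g (xs ++ z :: ys ++ zs)) f -> g (last z ys) != g z ->
  exists x y, [/\ x \in z :: ys, y \in z :: ys, x < y, g y - g x != 0 &
    f (turn false (map g (xs ++ z :: ys))) = dir (g y - g x)].
Proof.
move=> sx hf ne; case/lastP E1 : (directions (map g (z :: ys))) => [|D u].
  by move/directions_nil: E1; rewrite last_map => /eqP; rewrite (negPf ne).
have sz : sorted <=%R (z :: ys).
  by move: sx => /cat_sorted2[_]; rewrite -cat_cons => /cat_sorted2[].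
have [|x [y [xin yin xy uE]]] := @directionsP _ g (z :: ys) u sz.
  by rewrite E1 mem_rcons mem_head.
have E2 : directions (map g (xs ++ z :: ys)) =
    rcons (directions (rcons (map g xs) (g z)) ++ D) u.
  by rewrite map_cat [map g (z :: _)]/= directions_cat rcons_cat -E1.
have [E] := directions_prefix (map g (xs ++ z :: ys)) (map g zs).
rewrite -map_cat -catA E2 => E3'.
exists x, y; split=> //; last first.
  by rewrite -uE /turn /cyc E2; exact: indicatrix_pos hf E3'.
apply/negP => /eqP e0; have : sphere2 u.
  by apply: (@directions_sphere2 _ (map g (z :: ys))); rewrite E1 mem_rcons mem_head.
by rewrite uE e0 /dir scaler0 => /sphere2_neq0; rewrite eqxx.
Qed.

End Indicatrix.

(** ** Minimal geodesics *)

Section Geodesics.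
Context {R : realType}.
Notation E3 := 'rV[R]_3.
Implicit Types (f : R -> E3) (u v w z : E3) (us V : seq E3) (s k : R).

(** If the angle of u and v is less than pi, a point whose distances to u and
    v almost add up to that angle is close to a definite point of the minimal
    arc: its scalar products with u and v, hence with that point, are almost
    the largest possible. *)
Lemma geodesic_point u v s : sphere2 u -> sphere2 v -> v <> - u -> 0 <= s ->
  s <= sphere_dist u v -> exists2 w, sphere2 w & forall k, 0 < k ->
  exists2 e, 0 < e & forall u' v' z, sphere2 u' -> sphere2 v' -> sphere2 z ->
    sphere_dist u' u <= e -> sphere_dist v' v <= e ->
    sphere_dist u' z <= s + e -> sphere_dist z v' <= sphere_dist u v - s + e ->
    sphere_dist z w <= k.
Proof.
move=> uS vS vNu s0; set d := sphere_dist u v => sd.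
have d0 : 0 <= d by exact: sphere_dist_ge0.
have dpi : d < pi.
  rewrite lt_neqAle sphere_dist_lepi // andbT; apply/eqP => h.
  exact: vNu (sphere_dist_eqpi uS vS h).
have [d00|dn0] := eqVneq d 0.
  exists u => // k k0; exists (k / 2); first by rewrite divr_gt0.
  move=> u' v' z u'S _ zS h1 _ h2 _.
  have := sphere_dist_triangle zS u'S uS; rewrite (sphere_distC z u') => h.
  have s00 : s = 0 by lra.
  lra.
have sind : 0 < sin d by apply: sin_gt0_pi; rewrite dpi lt0r dn0 d0.
pose a := d - s.
have sa : 0 <= sin a by rewrite sin_ge0_pi //; apply/andP; rewrite /a; split; lra.
have ss : 0 <= sin s by rewrite sin_ge0_pi //; apply/andP; split; lra.
have dE : sin d = sin a * cos s + cos a * sin s.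
  by rewrite -sinD /a subrK.
have cE : dot u v = cos a * cos s - sin a * sin s.
  by rewrite -cosD /a subrK cos_sphere_dist.
(* spherical interpolation between u and v *)
pose w := (sin d)^-1 *: (sin a *: u + sin s *: v).
have uu : dot u u = 1 by apply/sphere2P.
have vv : dot v v = 1 by apply/sphere2P.
have wS : sphere2 w.
  apply/sphere2P; rewrite /w dotZl dotZr mulrA -invfM -expr2.
  have -> : dot (sin a *: u + sin s *: v) (sin a *: u + sin s *: v)
      = sin d ^+ 2; last by rewrite mulVf // expf_neq0 // gt_eqF.
  rewrite !dotE uu vv (dotC v) cE dE; apply/eqP; rewrite -subr_eq0.
  have ca : 1 - cos a ^+ 2 - sin a ^+ 2 = 0 by rewrite sin2cos2 subrr.
  have cs : 1 - cos s ^+ 2 - sin s ^+ 2 = 0 by rewrite sin2cos2 subrr.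
  set lhs := (X in X == 0).
  have -> : lhs = sin a ^+ 2 * (1 - cos s ^+ 2 - sin s ^+ 2)
      + sin s ^+ 2 * (1 - cos a ^+ 2 - sin a ^+ 2) by rewrite /lhs; ring.
  by rewrite ca cs !mulr0 addr0.
exists w => // k k0; have [d' d'0 hd'] := @sphere_dist_le_enorm R k k0.
(* the total loss 4 * e in dot z w * sin d has to be d' ^+ 2 / 2 * sin d *)
pose e := d' ^+ 2 * sin d / 8.
have e0 : 0 < e by rewrite !mulr_gt0 // exprn_gt0.
exists e => // u' v' z u'S v'S zS h1 h2 h3 h4; apply: hd' => //.
have cos_ge (p q x : E3) l : sphere2 p -> sphere2 q -> 0 <= l -> l <= pi ->
    sphere_dist p q <= l + 2 * e -> cos l - 2 * e <= dot p q.
  move=> pS qS l0 lpi h; rewrite -cos_sphere_dist //.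
  have [le|/ltW le] := leP l (sphere_dist p q).
    by have := cos_lip le; lra.
  suff : cos l <= cos (sphere_dist p q) by lra.
  by have := sphere_dist_le pS qS l0 lpi; rewrite le cos_sphere_dist.
have zu : cos s - 2 * e <= dot z u.
  apply: cos_ge => //; first by lra.
  have := sphere_dist_triangle uS u'S zS.
  by rewrite (sphere_distC u u') (sphere_distC u z); lra.
have zv : cos a - 2 * e <= dot z v.
  apply: cos_ge => //; [by rewrite subr_ge0|by rewrite /a; lra|].
  by have := sphere_dist_triangle zS v'S vS; rewrite /a; lra.
rewrite ler_enorm ?(ltW d'0) // -enorm_sqr enormB_sphere // cos_sphere_dist //.
have zw : dot z w * sin d = sin a * dot z u + sin s * dot z v.
  by rewrite /w !dotE mulrC mulrA mulfV ?mul1r // gt_eqF.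
have s1 := sin_le1 s; have a1 := sin_le1 a.
suff : sin d - 4 * e <= dot z w * sin d.
  move=> h; have : 1 - d' ^+ 2 / 2 <= dot z w; last by lra.
  rewrite -(ler_pM2r sind); apply: le_trans h.
  by have -> : sin d - 4 * e = (1 - d' ^+ 2 / 2) * sin d by rewrite /e; field.
rewrite zw dE.
have : sin a * (cos s - 2 * e) <= sin a * dot z u by rewrite ler_wpM2l.
have : sin s * (cos a - 2 * e) <= sin s * dot z v by rewrite ler_wpM2l.
have : e * sin a <= e * 1 by rewrite ler_pM2l.
have : e * sin s <= e * 1 by rewrite ler_pM2l.
lra.
Qed.

Lemma ex_orthogonal u : exists2 n, sphere2 n & dot u n = 0.
Proof.
pose p : E3 := \row_(j < 3) (if j == 0 then - u 0 1 else if j == 1 then u 0 0 else 0).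
have dp : dot u p = 0.
  rewrite /dot !big_ord_recl big_ord0 !mxE /=.
  have -> : lift ord0 ord0 = 1 :> 'I_3 by exact/val_inj.
  by rewrite -[ord0]/(0 : 'I_3) /=; ring.
have [p0|p0] := eqVneq p 0; last first.
  by exists (dir p); [exact: dir_sphere2|rewrite /dir dotZr dp mulr0].
exists (delta_mx 0 0).
  apply/sphere2P; rewrite /dot (bigD1 ord0) //= big1.
    by rewrite !mxE !eqxx mulr1 addr0.
  by move=> i i0; rewrite !mxE /= (negPf i0) mulr0.
rewrite /dot (bigD1 ord0) //= big1 => [|i i0]; last first.
  by rewrite !mxE /= (negPf i0) mulr0.
have := congr1 (fun m : E3 => m 0 1) p0; rewrite !mxE /= => ->.
by rewrite mul0r addr0.
Qed.

Lemma ex_minimal_geodesic u v : sphere2 u -> sphere2 v ->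
  exists f, minimal_geodesic f u v.
Proof.
move=> uS vS; rewrite /minimal_geodesic; set d := sphere_dist u v.
have d0 : 0 <= d by exact: sphere_dist_ge0.
have dpi : d <= pi by exact: sphere_dist_lepi.
have [n nS [un vE]] : exists2 n, sphere2 n &
    dot u n = 0 /\ v = cos d *: u + sin d *: n.
  have [d00|dn0] := eqVneq d 0.
    have [n nS un] := ex_orthogonal u; exists n => //; split=> //.
    by rewrite d00 cos0 sin0 scale1r scale0r addr0 (sphere_dist_eq0 uS vS d00).
  have [dpi'|dnpi] := eqVneq d pi.
    have [n nS un] := ex_orthogonal u; exists n => //; split=> //.
    rewrite dpi' cospi sinpi scaleN1r scale0r addr0.
    exact: sphere_dist_eqpi uS vS dpi'.
  have sd : 0 < sin d.
    by apply: sin_gt0_pi; rewrite !lt_neqAle d0 dpi dnpi eq_sym dn0.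
  have cd : cos d = dot u v by exact: cos_sphere_dist.
  have uu : dot u u = 1 by apply/sphere2P.
  have vv : dot v v = 1 by apply/sphere2P.
  exists ((sin d)^-1 *: (v - cos d *: u)).
    apply/sphere2P; rewrite !dotE uu vv (dotC v u) -cd.
    apply: (@mulfI _ (sin d ^+ 2)); first by rewrite expf_neq0 // gt_eqF.
    rewrite [RHS]mulr1 [RHS]sin2cos2; field; exact: lt0r_neq0.
  split; first by rewrite !dotE uu -cd; ring.
  by rewrite scalerA mulfV ?gt_eqF // scale1r addrC subrK.
have uu : dot u u = 1 by apply/sphere2P.
have nn : dot n n = 1 by apply/sphere2P.
pose f s : E3 := cos s *: u + sin s *: n.
have ff s s' : dot (f s) (f s') = cos (s - s').
  by rewrite /f !dotE uu nn (dotC n u) un cosB; ring.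
exists f; split=> [||s _|s s'].
- by rewrite /f cos0 sin0 scale1r scale0r addr0.
- by [].
- by apply/sphere2P; rewrite ff subrr cos0.
rewrite !in_itv /= => /andP[s0 sd] /andP[s'0 s'd].
rewrite /sphere_dist ff -cos_norm cosK // in_itv /= normr_ge0 /=.
by rewrite ler_norml; apply/andP; split; lra.
Qed.

Lemma spherical_polygonal_ext f f' u us : (forall s, 0 <= s -> f s = f' s) ->
  (forall v, v \in u :: us -> sphere2 v) ->
  spherical_polygonal f u us -> spherical_polygonal f' u us.
Proof.
elim: us f f' u => [|v us ih] f f' u ff' h /=; first by rewrite ff'.
have d0 : 0 <= sphere_dist u v.
  by apply: sphere_dist_ge0; apply: h; rewrite !inE eqxx ?orbT.
case=> -[f0 fd fS fdist] hf; split; last first.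
  apply: ih hf => [s s0|w win]; first by rewrite ff' // addr_ge0.
  by apply: h; rewrite inE win orbT.
have in_ge0 s : s \in `[0, sphere_dist u v] -> 0 <= s.
  by rewrite in_itv /= => /andP[].
split=> [||s hs|s s' hs hs'].
- by rewrite -ff'.
- by rewrite -ff'.
- by rewrite -ff'; [exact: fS|exact: in_ge0].
- by rewrite -!ff'; [exact: fdist|exact: in_ge0|exact: in_ge0].
Qed.

Lemma ex_spherical_polygonal u us : (forall v, v \in u :: us -> sphere2 v) ->
  exists f, spherical_polygonal f u us.
Proof.
elim: us u => [|v us ih] u h; first by exists (fun=> u).
have [||f [f0 fd fS fdist]] := @ex_minimal_geodesic u v.
- by apply: h; rewrite mem_head.
- by apply: h; rewrite !inE eqxx orbT.
have hus w : w \in v :: us -> sphere2 w.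
  by move=> win; apply: h; rewrite inE win orbT.
have [f' hf'] := ih v hus.
pose d := sphere_dist u v.
pose F s := if s <= d then f s else f' (s - d).
have Ff s : s \in `[0, d] -> F s = f s by rewrite in_itv /= /F => /andP[_ ->].
have d0 : 0 <= d.
  by apply: sphere_dist_ge0; apply: h; rewrite !inE eqxx ?orbT.
have f'0 : f' 0 = v.
  by case: (us) hf' => [//|? ?] /= [[]].
exists F => /=; split; last first.
  apply: spherical_polygonal_ext hf' => // s s0; rewrite /F -/d gerDl.
  case: leP => [s0'|_]; last by rewrite addrC addKr.
  have -> : s = 0 by lra.
  by rewrite addr0 fd.
split=> [||s hs|s s' hs hs'].
- by rewrite Ff // in_itv /= lexx.
- by rewrite Ff // in_itv /= lexx andbT.
- by rewrite Ff //; exact: fS.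
- by rewrite !Ff //; exact: fdist.
Qed.

(** The indicatrices of fine polygonals exist, hence properties of the limit
    can be read on them. *)
Lemma ex_indicatrix b V : directions V != [::] -> exists f, is_indicatrix b V f.
Proof.
rewrite /is_indicatrix; have := @cyc_sphere2 _ b V.
case: (directions V) => [//|u us] h _.
have [E hE] : exists E, cyc b (u :: us) = u :: E.
  by case: b {h}; rewrite /cyc /=; [exists (us ++ [:: u]); rewrite take0|exists us].
by rewrite hE in h *; exact: ex_spherical_polygonal.
Qed.

End Geodesics.

(** * Pointwise convergence of the indicatrices *)

Section Pointwise.
Context {R : realType}.
Notation E3 := 'rV[R]_3.
Notation sorted := (sorted <=%R).
Implicit Types (x y z s k d r : R) (xs ys zs : seq R) (f : R -> E3).

(** A constant-velocity time r in [0, C] corresponds to almost the same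
    arc-length time when the turning T is almost C. *)
Lemma rescale_close (T C r e : R) : 0 <= r -> r <= C -> 0 <= T -> T <= C ->
  C - e <= T -> [/\ 0 <= T * r / C, T * r / C <= T & `|T * r / C - r| <= e].
Proof.
move=> r0 rC T0 TC Te; have C0 : 0 <= C by exact: le_trans TC.
have [CE|Cn0] := eqVneq C 0.
  have -> : T = 0 by lra.
  have -> : r = 0 by lra.
  by rewrite mul0r mul0r subrr normr0; split=> //; lra.
have Cgt0 : 0 < C by rewrite lt0r Cn0.
have q0 : 0 <= r / C by rewrite divr_ge0.
have q1 : r / C <= 1 by rewrite ler_pdivrMr // mul1r.
have rE : r = C * (r / C) by rewrite mulrC divfK.
rewrite -mulrA; split; [exact: mulr_ge0|by rewrite ler_piMr|].
rewrite [X in _ - X]rE -mulrBl normrM (ger0_norm q0).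
rewrite ler0_norm ?subr_le0 // opprB.
have : (C - T) * (r / C) <= C - T by rewrite ler_piMr // subr_ge0.
lra.
Qed.

(** The turning of the polygonal at these points is the time at which the
    indicatrix reaches the direction of its last segment. *)
Definition points_upto xs m := [seq x <- 0 :: xs | x <= m].

Lemma points_uptoE xs m : 0 <= m -> points_upto xs m = 0 :: [seq x <- xs | x <= m].
Proof. by move=> m0; rewrite /points_upto /= m0. Qed.

Lemma points_upto_subseq xs m m' : m <= m' -> subseq (points_upto xs m) (points_upto xs m').
Proof.
move=> mm'; rewrite subseq_filter filter_subseq andbT.
by apply/allP => x; rewrite mem_filter => /andP[/le_trans h _]; apply: h.
Qed.

Lemma indicatrix_dist b (V : seq E3) f : is_indicatrix b V f ->
  forall s s', 0 <= s <= turn b V -> 0 <= s' <= turn b V ->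
  sphere2 (f s) /\ sphere_dist (f s) (f s') <= `|s - s'|.
Proof.
move=> hf s s' /andP[s0 sT] /andP[s'0 s'T]; have [ss'|/ltW s's] := leP s s'.
  have [S1 S2 D] := indicatrix_lip hf s0 ss' s'T; split=> //.
  by rewrite ler0_norm ?opprB // subr_le0.
have [S1 S2 D] := indicatrix_lip hf s'0 s's sT; split=> //.
by rewrite sphere_distC ger0_norm // subr_ge0.
Qed.

(** The closed indicatrix ends with a minimal arc back to its origin. *)
Lemma turn_closed_indicatrix (V : seq E3) f : is_indicatrix true V f ->
  turn true V = turn false V + sphere_dist (f (turn false V)) (f 0).
Proof.
move=> hf; have := hf; rewrite /is_indicatrix.
case VE : (directions V) => [//|u D] _.
rewrite (indicatrix0 hf VE); case/lastP E : (u :: D) VE => [//|D' w] VE.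
have VE' : directions V = rcons D' w ++ [::] by rewrite cats0 VE.
rewrite {2 3}/turn /cyc VE (indicatrix_pos hf VE') /turn /cyc VE -E /= take0.
by rewrite -cat_cons E cats1 plength_rcons2.
Qed.

Section Local.
Context (g : R -> E3) (L C : R) (b : bool).
Hypothesis hg : arclength_curve g L.
Hypothesis hC : total_turning b g L C.

Let L0 := arclength_gt0 hg.

Lemma prefix_turn_homo xs m m' : m <= m' ->
  turn false (map g (points_upto xs m)) <= turn false (map g (points_upto xs m')).
Proof. by move=> mm'; apply/turn_subseq/map_subseq/points_upto_subseq. Qed.

Lemma prefix_turn_le xs m :
  turn false (map g (points_upto xs m)) <= turn b (map g (0 :: xs)).
Proof.
apply: le_trans (turn_le_cyc b _).
exact/turn_subseq/map_subseq/filter_subseq.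
Qed.

Lemma prefix_turn_upto d xs m : fine_partition d L xs -> m <= L ->
  turn false (map g (points_upto xs m)) <= turning_upto g m.
Proof.
move=> fxs mL; apply: (turning_upto_ub hg hC) => //.
  by apply: sorted_filter (fine_sorted fxs); exact: le_trans.
move=> x; rewrite mem_filter => /andP[-> xin].
by have /andP[->] := fine_between fxs xin.
Qed.

Lemma prefix_turn_adherent m k : 0 <= m -> m <= L -> 0 < k -> exists2 d, 0 < d &
  forall xs, fine_partition d L xs ->
    turning_upto g m - k <= turn false (map g (points_upto xs m)).
Proof.
move=> m0 mL k0; have [d d0 hd] := fine_turning_upto hg hC m0 mL k0.
exists d => // xs fxs; apply: (hd _ _ fxs).
  by apply: sorted_filter (fine_sorted fxs); exact: le_trans.
by move=> x xin xm; rewrite mem_filter xm.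
Qed.

Lemma fine_partition_le d d' xs : d <= d' -> fine_partition d L xs ->
  fine_partition d' L xs.
Proof.
move=> dd' [p l]; split=> //; apply: sub_path p => x y /andP[-> h] /=.
by apply: le_trans h _; rewrite lerD2l.
Qed.

(** When all the chords of the piece of g on [lo, m] have almost the direction
    u, so does the last segment before the time m of a fine polygonal. *)
Lemma indicatrix_at lo m u k : 0 <= lo -> lo < m -> m <= L -> sphere2 u ->
  (forall x y, lo <= x -> x < y -> y <= m ->
     g y - g x != 0 /\ sphere_dist (dir (g y - g x)) u <= k) ->
  exists2 d, 0 < d & forall xs f, fine_partition d L xs ->
    is_indicatrix b (map g (0 :: xs)) f ->
    let p := turn false (map g (points_upto xs m)) in
    sphere2 (f p) /\ sphere_dist (f p) u <= k.
Proof.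
move=> lo0 lom mL uS hu; pose d := (m - lo) / 3.
have d0 : 0 < d by rewrite divr_gt0 // subr_gt0.
exists d => // xs f fxs hf p.
have m0 : 0 <= m by lra.
have sx := fine_sorted fxs.
pose z := floor_in xs (m - 2 * d).
have q0 : 0 <= m - 2 * d by rewrite /d; lra.
have z1 : lo <= z.
  by have := floor_in_ge (ltW d0) fxs q0; rewrite -/z /d => h; lra.
have z2 : z <= m - 2 * d by exact: floor_in_le.
have l1 := floor_in_ge (ltW d0) fxs m0 mL.
(* z and the last point before m are distinct and both in [lo, m], thus so
   are the ends of the last segment of positive length *)
have zin : z \in points_upto xs m.
  by rewrite mem_filter floor_in_mem andbT; lra.
have sp : sorted (points_upto xs m) by apply: sorted_filter sx; exact: le_trans.
have lastp : last 0 (points_upto xs m) = floor_in xs m by rewrite points_uptoE.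
have pm x : x \in points_upto xs m -> x <= m by rewrite mem_filter => /andP[].
have split_xs := sorted_split m sx; rewrite -/(points_upto xs m) in split_xs.
rewrite /p; move: zin sp lastp pm split_xs.
case/splitPr : {p} (points_upto xs m) / => X Y sp lastp pm split_xs.
rewrite last_cat /= in lastp.
have hin x : x \in z :: Y -> z <= x <= m.
  move=> xin; rewrite pm ?mem_cat ?xin ?orbT // andbT.
  by apply: le_sorted_head xin; case/cat_sorted2: sp.
have mem_l : last z Y \in z :: Y by exact: mem_last.
rewrite split_xs -catA in hf sx.
have zl : z < last z Y by rewrite lastp; lra.
have [|x [y [xin yin xy ne ->]]] := indicatrix_prefix sx hf.
  rewrite -subr_eq0; apply: (hu _ _ z1 zl _).1.
  by case/andP: (hin _ mem_l).
split; first exact: dir_sphere2.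
have /andP[zx _] := hin _ xin; have /andP[_ ym] := hin _ yin.
by have [] := hu x y (le_trans z1 zx) xy ym.
Qed.

(** The initial direction is reached from that of a slightly later segment by
    going back in time by no more than the small turning of the beginning. *)
Lemma indicatrix_start v k : chord_limit_right g L 0 v -> 0 < k ->
  exists2 d, 0 < d & forall xs f, fine_partition d L xs ->
    is_indicatrix b (map g (0 :: xs)) f ->
    sphere2 (f 0) /\ sphere_dist (f 0) v <= k.
Proof.
move=> [vS hv] k0; have k20 : 0 < k / 2 by rewrite divr_gt0.
have [dr dr0 hdr] := hv _ k20.
have [y [y0 yL Ay]] := turning_upto_zero hg hC k20.
pose m := Num.min y dr.
have m0 : 0 < m by rewrite lt_min y0.
have my : m <= y by rewrite ge_min lexx.
have mdr : m <= dr by rewrite ge_min lexx orbT.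
have [|d d0 hd] := indicatrix_at (lexx 0) m0 (le_trans my yL) vS _ (k := k / 2).
  move=> x x' x0 xx' x'm; apply: hdr => //; first by rewrite add0r; lra.
  by lra.
exists d => // xs f fxs hf; have [pS pv] := hd xs f fxs hf.
move: pS pv; set p := turn false _ => pS pv.
have pT : p <= turn b (map g (0 :: xs)) by exact: prefix_turn_le.
have p0 : 0 <= p by exact: turn_ge0.
have pk : p <= k / 2.
  apply: le_trans Ay; apply: le_trans (prefix_turn_homo xs my) _.
  exact: prefix_turn_upto fxs yL.
have [S0 _ D] := indicatrix_lip hf (lexx 0) p0 pT.
split=> //; apply: le_trans (sphere_dist_triangle S0 pS vS) _; lra.
Qed.

End Local.
End Pointwise.

Section Limit.
Context {R : realType}.
Notation E3 := 'rV[R]_3.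
Notation sorted := (sorted <=%R).
Implicit Types (x y z s k d r : R) (xs ys zs : seq R) (f : R -> E3).

Section Local.
Context (g : R -> E3) (L C : R) (b : bool).
Hypothesis hg : arclength_curve g L.
Hypothesis hC : total_turning b g L C.

Let L0 := arclength_gt0 hg.

Lemma turning_upto_homo x y : 0 <= x -> x <= y -> y <= L ->
  turning_upto g x <= turning_upto g y.
Proof.
move=> x0 xy yL; apply: (turning_upto_le hg hC) => //; first exact: le_trans yL.
move=> xs sx hx; apply: (turning_upto_ub hg hC) => // z /hx /andP[-> h].
exact: le_trans xy.
Qed.

Lemma turning_upto0 : turning_upto g 0 <= 0.
Proof.
apply/ler_addgt0Pr => k k0; rewrite add0r.
have [y [y0 yL Ay]] := turning_upto_zero hg hC k0.
by apply: le_trans Ay; apply: turning_upto_homo => //; exact: ltW.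
Qed.

Lemma fine_ex_indicatrix : exists2 d, 0 < d & forall xs,
  fine_partition d L xs -> exists f, is_indicatrix b (map g (0 :: xs)) f.
Proof.
have [d d0 [dL nondeg]] := nondeg_left hg hC L0 (lexx L).
exists (d / 2); first by rewrite divr_gt0.
move=> xs fxs; apply: ex_indicatrix; apply/eqP => E.
have q0 : 0 <= L - d / 2 by lra.
have d20 : 0 <= d / 2 by lra.
have := floor_in_mem xs (L - d / 2); have := floor_in_le xs q0.
have qL : L - d / 2 <= L by lra.
have := floor_in_ge d20 fxs q0 qL.
move: (floor_in _ _) => z z1 z2 zin; have lL : last 0 (0 :: xs) = L by case: fxs.
move: zin lL E; case/splitPr => X Y; rewrite last_cat /= => lL.
rewrite map_cat [map g (z :: _)]/= directions_cat.
case: (directions (rcons _ _)) => //= /directions_nil.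
rewrite last_map lL => /eqP; rewrite -subr_eq0; apply/negP.
by apply: nondeg; lra.
Qed.

Hypothesis no_return : forall s u v, 0 < s -> s < L ->
  chord_limit_left g s u -> chord_limit_right g L s v -> v <> - u.
Hypothesis no_return_base : b -> forall u v,
  chord_limit_left g L u -> chord_limit_right g L 0 v -> v <> - u.

(** Quantifies over all fine polygonals, and not over a sequence of them, so
    that the limit curve does not depend on a sequence. *)
Definition fine_limit r w := sphere2 w /\ forall k, 0 < k -> exists2 d, 0 < d &
  forall xs f, fine_partition d L xs -> is_indicatrix b (map g (0 :: xs)) f ->
    let t := f (turn b (map g (0 :: xs)) * r / C) in
    sphere2 t /\ sphere_dist t w <= k.

Let indicatrix_left s u k : 0 < s -> s <= L -> chord_limit_left g s u ->
  0 < k -> exists2 d, 0 < d & forall xs f, fine_partition d L xs ->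
    is_indicatrix b (map g (0 :: xs)) f ->
    let p := turn false (map g (points_upto xs s)) in
    [/\ sphere2 (f p), sphere_dist (f p) u <= k & `|p - turning_upto g s| <= k].
Proof.
move=> s0 sL [uS hu] k0; have [dl dl0 hdl] := hu k k0.
pose lo := Num.max 0 (s - dl).
have lo0 : 0 <= lo by rewrite le_max lexx.
have los : lo < s by rewrite gt_max s0 /=; lra.
have lodl : s - dl <= lo by rewrite le_max lexx orbT.
have [|d d0 hd] := @indicatrix_at R g L b lo s u k lo0 los sL uS.
  move=> x y lx xy ys; apply: hdl => //; first exact: le_trans lx.
  exact: le_trans lx.
have [d' d'0 hd'] := prefix_turn_adherent hg hC (ltW s0) sL k0.
exists (Num.min d d'); first by rewrite lt_min d0.
move=> xs f fxs hf p.
have dd : Num.min d d' <= d by rewrite ge_min lexx.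
have dd' : Num.min d d' <= d' by rewrite ge_min lexx orbT.
have [pS pu] := hd xs f (fine_partition_le dd fxs) hf.
have := hd' xs (fine_partition_le dd' fxs); have := prefix_turn_upto hg hC fxs sL.
by rewrite -/p => h1 h2; split=> //; rewrite ler_norml; apply/andP; split; lra.
Qed.

(** The indicatrix is near u about the time A(s), and near v before a time
    hardly later than A(s) + d; the Lipschitz bound towards both leaves only
    the neighbourhood of one point of the arc at the time r between. *)
Lemma fine_limit_interior s r : 0 <= r -> r <= C -> 0 < s -> s < L ->
  turning_upto g s <= r ->
  (forall y, s < y -> y <= L -> r <= turning_upto g y) ->
  exists w, fine_limit r w.
Proof.
move=> r0 rC s0 sL As hy.
have [u hu] := chord_limit_left_ex hg hC s0 (ltW sL).
have [v hv] := chord_limit_right_ex hg hC (ltW s0) sL.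
have uS : sphere2 u by case: hu.
have vS : sphere2 v by case: hv.
set d := sphere_dist u v.
have rd : r <= turning_upto g s + d.
  apply/ler_addgt0Pr => k k0.
  have [y [sy yL Ay]] := turning_upto_jump hg hC s0 sL hu hv k0.
  exact: le_trans (hy y sy yL) Ay.
have [||w wS hw] := @geodesic_point R u v (r - turning_upto g s) uS vS
  (no_return s0 sL hu hv); [by rewrite subr_ge0|by rewrite -/d; lra|].
exists w; split=> // k k0; have [e e0 he] := hw k k0.
pose q := e / 4; have q0 : 0 < q by rewrite divr_gt0.
(* a chord of [s, m] has almost the direction v, and little more than
   A(s) + d has been turned at m *)
have [y [sy yL Ay]] := turning_upto_jump hg hC s0 sL hu hv q0.
have [d1 d10 hd1] := indicatrix_left s0 (ltW sL) hu q0.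
have [dr dr0 hdr] := hv.2 _ q0.
pose m := Num.min y (s + dr).
have sm : s < m by rewrite lt_min sy ltrDl.
have my : m <= y by rewrite ge_min lexx.
have mdr : m <= s + dr by rewrite ge_min lexx orbT.
have mL : m <= L by exact: le_trans yL.
have [|d2 d20 hd2] := @indicatrix_at R g L b s m v q (ltW s0) sm mL vS.
  by move=> x x' sx xx' x'm; apply: hdr => //; exact: le_trans x'm _.
have [d3 d30 hd3] := fine_total_turning hg hC q0.
exists (Num.min d1 (Num.min d2 d3)); first by rewrite !lt_min d10 d20.
move=> xs f fxs hf t.
have f1 : fine_partition d1 L xs by apply: fine_partition_le fxs; rewrite ge_min lexx.
have f2 : fine_partition d2 L xs.
  by apply: fine_partition_le fxs; rewrite !ge_min lexx orbT.
have f3 : fine_partition d3 L xs.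
  by apply: fine_partition_le fxs; rewrite !ge_min lexx !orbT.
have [p1S p1u p1A] := hd1 xs f f1 hf; have [p2S p2v] := hd2 xs f f2 hf.
have := prefix_turn_le g b xs s; have := prefix_turn_le g b xs m.
have := prefix_turn_homo g xs (ltW sm); have := prefix_turn_upto hg hC f1 mL.
have := turning_upto_homo (ltW (lt_trans s0 sm)) my yL.
have TC : turn b (map g (0 :: xs)) <= C.
  by apply: (total_turning_ub hC (fine_sorted fxs)); case: fxs.
have [ro0 roT ror] := rescale_close r0 rC (turn_ge0 b _) TC (hd3 xs f3).
move: p1S p1u p1A p2S p2v ro0 roT ror TC; rewrite /t {t}.
have := turn_ge0 false (map g (points_upto xs s)).
have := turn_ge0 false (map g (points_upto xs m)).
set p1 := turn false (map g (points_upto xs s)).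
set p2 := turn false (map g (points_upto xs m)).
set T := turn b _; set ro := T * r / C.
move=> p20 p10 p1S p1u p1A p2S p2v ro0 roT ror TC Amy p2A p12 p2T p1T.
have in1 : 0 <= p1 <= T by rewrite p10.
have in2 : 0 <= p2 <= T by rewrite p20.
have in3 : 0 <= ro <= T by rewrite ro0.
have [_ D1] := indicatrix_dist hf in1 in3.
have [tS D2] := indicatrix_dist hf in3 in2.
have [_ D12] := indicatrix_dist hf in1 in2.
split=> //; apply: (he (f p1) (f p2)) => //.
- by apply: le_trans p1u _; rewrite /q; lra.
- by apply: le_trans p2v _; rewrite /q; lra.
- apply: le_trans D1 _; move: p1A ror; rewrite /q !ler_norml.
  by move=> /andP[? ?] /andP[? ?]; apply/andP; split; lra.
- apply: le_trans D2 _.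
  have := sphere_dist_triangle uS p1S vS; rewrite (sphere_distC u (f p1)) -/d.
  have := sphere_dist_triangle p1S p2S vS.
  move: D12; rewrite ler0_norm ?subr_le0 // => D12.
  move: p1A ror; rewrite /q !ler_norml -/d; rewrite /q -/d in p1u p2v Ay.
  by move=> /andP[? ?] /andP[? ?] ? ?; apply/andP; split; lra.
Qed.

(** Without closing angle A(L) = C, so that only r = C is left. *)
Lemma fine_limit_end_open r : b = false -> 0 <= r -> r <= C ->
  turning_upto g L <= r -> exists w, fine_limit r w.
Proof.
move=> bF r0 rC Ar.
have [u hu] := chord_limit_left_ex hg hC L0 (lexx L).
have uS : sphere2 u by case: hu.
have CA : C <= turning_upto g L.
  apply/ler_addgt0Pr => k k0.
  have [zs [szs lzs zk]] := total_turning_adherent hC k0.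
  rewrite -lerBlDr; apply: le_trans zk _; rewrite bF; apply: (turning_upto_ub hg hC) => // z zin.
  by rewrite (le_sorted_head szs zin) -lzs (le_sorted_last 0 szs zin).
exists u; split=> // k k0; pose q := k / 4; have q0 : 0 < q by rewrite divr_gt0.
have [d1 d10 hd1] := indicatrix_left L0 (lexx L) hu q0.
have [d3 d30 hd3] := fine_total_turning hg hC q0.
exists (Num.min d1 d3); first by rewrite !lt_min d10.
move=> xs f fxs hf t.
have f1 : fine_partition d1 L xs by apply: fine_partition_le fxs; rewrite ge_min lexx.
have f3 : fine_partition d3 L xs.
  by apply: fine_partition_le fxs; rewrite !ge_min lexx !orbT.
have [p1S p1u p1A] := hd1 xs f f1 hf.
have TC : turn b (map g (0 :: xs)) <= C.
  by apply: (total_turning_ub hC (fine_sorted fxs)); case: fxs.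
have [ro0 roT ror] := rescale_close r0 rC (turn_ge0 b _) TC (hd3 xs f3).
have in1 : 0 <= turn false (map g (points_upto xs L)) <= turn b (map g (0 :: xs)).
  by rewrite turn_ge0 prefix_turn_le.
have in3 : 0 <= turn b (map g (0 :: xs)) * r / C <= turn b (map g (0 :: xs)).
  by rewrite ro0.
have [tS D1] := indicatrix_dist hf in3 in1.
split=> //; apply: le_trans (sphere_dist_triangle tS p1S uS) _.
apply: le_trans (lerD D1 p1u) _; rewrite /q in q0 p1A ror *.
have : `|turn b [seq g i | i <- 0 :: xs] * r / C
    - turn false [seq g i | i <- points_upto xs L]| <= k / 2; last by lra.
move: p1A ror; rewrite !ler_norml => /andP[? ?] /andP[? ?].
by apply/andP; split; lra.
Qed.

(** After the time A(L), the indicatrix follows the minimal arc of the closing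
    angle, from almost the left tangent at L to almost the right one at 0. *)
Lemma fine_limit_end_closed r : b -> 0 <= r -> r <= C ->
  turning_upto g L <= r -> exists w, fine_limit r w.
Proof.
move=> bT r0 rC Ar.
have [u hu] := chord_limit_left_ex hg hC L0 (lexx L).
have [v hv] := chord_limit_right_ex hg hC (lexx 0) L0.
have uS : sphere2 u by case: hu.
have vS : sphere2 v by case: hv.
set d := sphere_dist u v.
have closing xs f : fine_partition L L xs ->
    is_indicatrix b (map g (0 :: xs)) f ->
    turn b (map g (0 :: xs)) = turn false (map g (points_upto xs L)) +
      sphere_dist (f (turn false (map g (points_upto xs L)))) (f 0)
    /\ f (turn b (map g (0 :: xs))) = f 0.
  move=> fxs; have -> : points_upto xs L = 0 :: xs.
    by apply/all_filterP/allP => x /(fine_between fxs) /andP[].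
  rewrite bT => hf; split; last exact: indicatrix_closed.
  exact: turn_closed_indicatrix.
have near k : 0 < k -> exists2 e, 0 < e & forall xs f, fine_partition e L xs ->
    is_indicatrix b (map g (0 :: xs)) f ->
    let p := turn false (map g (points_upto xs L)) in let T := turn b (map g (0 :: xs)) in
    [/\ fine_partition L L xs, sphere2 (f p), sphere2 (f 0) &
     [/\ sphere_dist (f p) u <= k,
       sphere_dist (f 0) v <= k, `|p - turning_upto g L| <= k & C - k <= T]].
  move=> k0; have [d1 d10 hd1] := indicatrix_left L0 (lexx L) hu k0.
  have [d2 d20 hd2] := indicatrix_start hg hC hv k0.
  have [d3 d30 hd3] := fine_total_turning hg hC k0.
  exists (Num.min L (Num.min d1 (Num.min d2 d3))); first by rewrite !lt_min L0 d10 d20.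
  move=> xs f fxs hf p T.
  have fL : fine_partition L L xs by apply: fine_partition_le fxs; rewrite ge_min lexx.
  have f1 : fine_partition d1 L xs by apply: fine_partition_le fxs; rewrite !ge_min lexx !orbT.
  have f2 : fine_partition d2 L xs by apply: fine_partition_le fxs; rewrite !ge_min lexx !orbT.
  have f3 : fine_partition d3 L xs by apply: fine_partition_le fxs; rewrite !ge_min lexx !orbT.
  have [p1S p1u p1A] := hd1 xs f f1 hf; have [p2S p2v] := hd2 xs f f2 hf.
  by split=> //; split=> //; exact: hd3.
have CA : C <= turning_upto g L + d.
  apply/ler_addgt0Pr => k k0; pose q := k / 4.
  have q0 : 0 < q by rewrite divr_gt0.
  have [e e0 he] := near q q0; have [e' e'0 he'] := fine_ex_indicatrix.
  have m0 : 0 < Num.min e e' by rewrite lt_min e0.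
  have [xs fxs _] := fine_ex L0 m0.
  have [|f hf] := he' xs; first by apply: fine_partition_le fxs; rewrite ge_min lexx orbT.
  have [|fL pS S0 [pu pv pA TC]] := he xs f _ hf.
    by apply: fine_partition_le fxs; rewrite ge_min lexx.
  have [TE _] := closing xs f fL hf; move: pA; rewrite ler_norml => /andP[_ pA].
  have := sphere_dist_triangle pS uS S0; have := sphere_dist_triangle uS vS S0.
  rewrite (sphere_distC v (f 0)) -/d => h1 h2; rewrite /q in TC pu pv pA.
  by rewrite TE in TC; lra.
have [||w wS hw] := @geodesic_point R u v (r - turning_upto g L) uS vS
  (no_return_base bT hu hv); [by rewrite subr_ge0|by rewrite -/d; lra|].
exists w; split=> // k k0; have [e e0 he] := hw k k0.
pose q := e / 4; have q0 : 0 < q by rewrite divr_gt0.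
have [e' e'0 he'] := near q q0; exists e' => // xs f fxs hf t.
have [fL pS S0 [pu pv pA Tq]] := he' xs f fxs hf.
have TC : turn b (map g (0 :: xs)) <= C.
  by apply: (total_turning_ub hC (fine_sorted fxs)); case: fxs.
have [_ TE] := closing xs f fL hf.
have [ro0 roT ror] := rescale_close r0 rC (turn_ge0 b _) TC Tq.
have in1 : 0 <= turn false (map g (points_upto xs L)) <= turn b (map g (0 :: xs)).
  by rewrite turn_ge0 prefix_turn_le.
have in2 : 0 <= turn b (map g (0 :: xs)) <= turn b (map g (0 :: xs)).
  by rewrite turn_ge0 lexx.
have in3 : 0 <= turn b (map g (0 :: xs)) * r / C <= turn b (map g (0 :: xs)).
  by rewrite ro0.
have [_ D1] := indicatrix_dist hf in1 in3.
have [tS D2] := indicatrix_dist hf in3 in2.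
rewrite TE in D2; split=> //; apply: (he (f (turn false (map g (points_upto xs L)))) (f 0)) => //.
- by apply: le_trans pu _; rewrite /q; lra.
- by apply: le_trans pv _; rewrite /q; lra.
- apply: le_trans D1 _; move: pA ror; rewrite /q !ler_norml.
  by move=> /andP[? ?] /andP[? ?]; apply/andP; split; lra.
- apply: le_trans D2 _; rewrite ler0_norm ?subr_le0 // -/d.
  by move: ror; rewrite /q ler_norml => /andP[? ?]; lra.
Qed.

(** At time r, the indicatrices converge to the point of the minimal arc
    between the one-sided tangents at s which is at distance r - A(s) from its
    origin, where s is the last parameter with A(s) <= r and A(s) the turning
    on [0, s]. *)
Lemma pointwise_limit r : 0 <= r -> r <= C -> exists w, fine_limit r w.
Proof.
move=> r0 rC.
pose S := [set s | 0 <= s <= L /\ turning_upto g s <= r].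
have S0 : S 0 by split; [by rewrite lexx ltW|exact: (le_trans turning_upto0 r0)].
have supS : has_sup S by split; [exists 0|exists L => s [/andP[_ sL] _]].
pose s := sup S.
have s0 : 0 <= s by apply: ub_le_sup => //; case: supS.
have sL : s <= L by apply: ge_sup; [exists 0|move=> x [/andP[_ xL] _]].
have hy y : s < y -> y <= L -> r <= turning_upto g y.
  move=> sy yL; rewrite leNgt; apply/negP => /ltW h.
  have : y <= s.
    apply: ub_le_sup; first by case: supS.
    by split=> //; rewrite yL andbT (le_trans s0) // ltW.
  by rewrite leNgt sy.
have hx x : 0 <= x -> x < s -> turning_upto g x <= r.
  move=> x0 xs; have e0 : 0 < s - x by rewrite subr_gt0.
  have [s' [/andP[_ s'L] As'] s's] := sup_adherent e0 supS.
  apply: le_trans As'; apply: turning_upto_homo => //.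
  by move: s's; rewrite -/s; lra.
(* at 0 the only tangent is that on the right, and A(0+) = 0 forces r = 0 *)
have [sE|sn0] := eqVneq s 0.
  have rE : r = 0.
    apply/le_anti; rewrite r0 andbT; apply/ler_addgt0Pr => k k0; rewrite add0r.
    have [y [y0 yL Ay]] := turning_upto_zero hg hC k0.
    by apply: le_trans Ay; apply: hy => //; rewrite sE.
  have [v hv] := chord_limit_right_ex hg hC (lexx 0) L0.
  exists v; split=> [|k k0]; first by case: hv.
  have [d d0 hd] := indicatrix_start hg hC hv k0; exists d => // xs f fxs hf.
  by rewrite /= rE mulr0 mul0r; exact: (hd xs).
have {sn0 s0} s0 : 0 < s by rewrite lt0r sn0.
have As : turning_upto g s <= r by exact: (turning_upto_left hg hC).
have [sE|snL] := eqVneq s L.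
  rewrite sE in As; case: (boolP b) => [bT|/negbTE bF].
    exact: fine_limit_end_closed.
  exact: fine_limit_end_open.
by apply: (@fine_limit_interior s) => //; rewrite lt_neqAle snL.
Qed.

End Local.
End Limit.

(** * The limit curve *)

Section LimitCurve.
Context {R : realType}.
Notation E3 := 'rV[R]_3.
Notation sorted := (sorted <=%R).
Implicit Types (x y z s k d r p : R) (xs ys zs : seq R) (f : R -> E3).

(** The polygonal inscribed in g at x :: xs, with its directions replaced by
    the unit vectors q and the lengths of its segments kept; as a function of
    the parameter, to be compared with g by turn_lsc. *)
Fixpoint walk (g q : R -> E3) (P : E3) x xs y : E3 :=
  if xs is x' :: xs' then
    if y < x' then P else walk g q (P + enorm (g x' - g x) *: q x') x' xs' y
  else P.

Lemma walk0 g q P x xs : path <%R x xs -> walk g q P x xs x = P.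
Proof. by case: xs => [//|x' xs] /= /andP[->]. Qed.

Lemma map_walk g q P x x' xs : path <%R x (x' :: xs) ->
  map (walk g q P x (x' :: xs)) [:: x, x' & xs] =
  P :: map (walk g q (P + enorm (g x' - g x) *: q x') x' xs) (x' :: xs).
Proof.
move=> h; rewrite map_cons walk0 //; congr cons; apply/eq_in_map => y yin.
case/andP: h => _ h /=; rewrite ltNge (_ : x' <= y) //=.
have /allP h' := order_path_min lt_trans h.
by move: yin; rewrite inE => /predU1P[->//|/h' /ltW].
Qed.

Lemma walk_directions g q P x xs : path <%R x xs ->
  (forall x', x' \in xs -> sphere2 (q x')) ->
  exists2 ns, subseq ns xs &
    directions (map (walk g q P x xs) (x :: xs)) = map q ns.
Proof.
elim: xs P x => [|x' xs ih] P x h hq; first by exists [::].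
have h' : path <%R x' xs by case/andP: h.
have [|ns sub E] := ih (P + enorm (g x' - g x) *: q x') x' h'.
  by move=> y yin; apply: hq; rewrite inE yin orbT.
rewrite map_walk // [map _ (x' :: xs)]/= directions_cons2.
rewrite -[_ :: map _ xs]/(map _ (x' :: xs)) E walk0 // addrC addKr.
have [e0|e0] := eqVneq (g x' - g x) 0.
  exists ns; first by apply: subseq_trans sub _; exact: subseq_cons.
  by rewrite e0 enorm0 scale0r /dir_seq eqxx.
have qS : sphere2 (q x') by apply: hq; exact: mem_head.
have n0 : enorm (g x' - g x) != 0 by rewrite enorm_eq0.
exists (x' :: ns); first by rewrite /= eqxx.
rewrite /dir_seq scaler_eq0 negb_or n0 sphere2_neq0 //=.
by rewrite dirZ ?enorm_gt0 // dir_unit.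
Qed.

Lemma walk_close g q P x xs k : 0 <= k ->
  path (fun x x' => (x < x') &&
    (enorm (enorm (g x' - g x) *: q x' - (g x' - g x)) <= k * (x' - x))) x xs ->
  forall y, y \in x :: xs ->
  enorm (walk g q P x xs y - g y) <= enorm (P - g x) + k * (y - x).
Proof.
move=> k0; elim: xs P x => [|x' xs ih] P x h y.
  by rewrite inE => /eqP ->; rewrite /= subrr mulr0 addr0.
move: h; rewrite [path _ _ _]/= => /andP[/andP[xx' hx'] h].
rewrite inE => /predU1P[->|yin].
  by rewrite /= xx' subrr mulr0 addr0.
have hs : path <%R x' xs by apply: sub_path h => ? ? /andP[].
have x'y : x' <= y.
  have /allP hs' := order_path_min lt_trans hs.
  by move: yin; rewrite inE => /predU1P[->//|/hs' /ltW].
rewrite /= ltNge x'y /=; apply: le_trans (ih _ _ h _ yin) _.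
have -> : P + enorm (g x' - g x) *: q x' - g x' =
    (P - g x) + (enorm (g x' - g x) *: q x' - (g x' - g x)).
  by rewrite [in RHS]opprB [RHS]addrACA addKr.
have := enormD (P - g x) (enorm (g x' - g x) *: q x' - (g x' - g x)).
have -> : k * (y - x) = k * (y - x') + k * (x' - x) by ring.
lra.
Qed.

(** Gives access to the whole sequence around two consecutive points. *)
Lemma path_of_splits (e : rel R) x xs :
  (forall X y y' Y, x :: xs = X ++ [:: y, y' & Y] -> e y y') -> path e x xs.
Proof.
elim: xs x => [//|x' xs ih] x h /=; apply/andP; split; first exact: (h [::]).
by apply: ih => X y y' Y E; apply: (h (x :: X) y y' Y); rewrite E.
Qed.

Section Local.
Context (g : R -> E3) (L C : R) (b : bool) (tc : R -> E3).
Hypothesis hg : arclength_curve g L.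
Hypothesis hC : total_turning b g L C.
Hypothesis htc : forall r, 0 <= r -> r <= C -> fine_limit g L C b r (tc r).

Let L0 := arclength_gt0 hg.

Let turn_le_C d xs : fine_partition d L xs -> turn b (map g (0 :: xs)) <= C.
Proof. by move=> fxs; apply: (total_turning_ub hC (fine_sorted fxs)); case: fxs. Qed.

Lemma total_turning_ge0 : 0 <= C.
Proof.
have [xs fxs _] := fine_ex L0 ltr01.
exact: le_trans (turn_ge0 b _) (turn_le_C fxs).
Qed.

Lemma fine_indicatrix_ex d : 0 < d -> exists xs f,
  [/\ fine_partition d L xs, path <%R 0 xs & is_indicatrix b (map g (0 :: xs)) f].
Proof.
move=> d0; have [e e0 he] := fine_ex_indicatrix hg hC.
have m0 : 0 < Num.min d e by rewrite lt_min d0.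
have [xs fxs pxs] := fine_ex L0 m0.
have [|f hf] := he xs; first by apply: fine_partition_le fxs; rewrite ge_min lexx orbT.
by exists xs, f; split=> //; apply: fine_partition_le fxs; rewrite ge_min lexx.
Qed.

Lemma limit_sphere2 r : 0 <= r -> r <= C -> sphere2 (tc r).
Proof. by move=> r0 rC; have [] := htc r0 rC. Qed.

Lemma rescaled_lip d xs f r r' : fine_partition d L xs ->
  is_indicatrix b (map g (0 :: xs)) f -> 0 <= r -> r <= r' -> r' <= C ->
  let T := turn b (map g (0 :: xs)) in
  [/\ sphere2 (f (T * r / C)), sphere2 (f (T * r' / C)) &
    sphere_dist (f (T * r / C)) (f (T * r' / C)) <= r' - r].
Proof.
move=> fxs hf r0 rr' r'C T; have TC : T <= C := turn_le_C fxs.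
have T0 : 0 <= T by exact: turn_ge0.
have Tl : C - (C - T) <= T by lra.
have [q0 qT _] := rescale_close r0 (le_trans rr' r'C) T0 TC Tl.
have [q0' qT' _] := rescale_close (le_trans r0 rr') r'C T0 TC Tl.
have C0 := total_turning_ge0.
have qq : T * r' / C - T * r / C <= r' - r.
  rewrite -mulrBl -mulrBr; have [->|Cn0] := eqVneq C 0.
    by rewrite invr0 mulr0 subr_ge0.
  have Cgt0 : 0 < C by rewrite lt0r Cn0.
  by rewrite mulrAC ler_piMl ?subr_ge0 // ler_pdivrMr // mul1r.
have le : T * r / C <= T * r' / C.
  by rewrite ler_wpM2r ?invr_ge0 // ler_wpM2l.
have [S1 S2 D] := indicatrix_lip hf q0 le qT'.
by split=> //; exact: le_trans D qq.
Qed.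

Lemma limit_lip r r' : 0 <= r -> r <= r' -> r' <= C ->
  sphere_dist (tc r) (tc r') <= r' - r.
Proof.
move=> r0 rr' r'C; apply/ler_addgt0Pr => k k0; pose q := k / 2.
have q0 : 0 < q by rewrite divr_gt0.
have [S hS] := htc r0 (le_trans rr' r'C); have [S' hS'] := htc (le_trans r0 rr') r'C.
have [d d0 hd] := hS q q0; have [d' d'0 hd'] := hS' q q0.
have m0 : 0 < Num.min d d' by rewrite lt_min d0.
have [xs [f [fxs _ hf]]] := fine_indicatrix_ex m0.
have fd : fine_partition d L xs by apply: fine_partition_le fxs; rewrite ge_min lexx.
have fd' : fine_partition d' L xs.
  by apply: fine_partition_le fxs; rewrite ge_min lexx orbT.
have [T1 D1] := hd xs f fd hf.
have [T2 D2] := hd' xs f fd' hf.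
have [_ _ D] := rescaled_lip fxs hf r0 rr' r'C.
have := sphere_dist_triangle S T1 S'; have := sphere_dist_triangle T1 T2 S'.
by rewrite (sphere_distC (tc r) (f _)) /q in D1 D2 *; lra.
Qed.

(** Pointwise convergence of 1-Lipschitz maps on a segment is uniform. *)
Lemma limit_uniform k : 0 < k -> exists2 d, 0 < d & forall xs f,
  fine_partition d L xs -> is_indicatrix b (map g (0 :: xs)) f ->
  forall r, 0 <= r -> r <= C -> let t := f (turn b (map g (0 :: xs)) * r / C) in
    sphere2 t /\ sphere_dist t (tc r) <= k.
Proof.
move=> k0; pose h := k / 3; have h0 : 0 < h by rewrite divr_gt0.
have C0 := total_turning_ge0.
have main (n : nat) : exists2 d, 0 < d & forall xs f,
    fine_partition d L xs -> is_indicatrix b (map g (0 :: xs)) f ->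
    forall r, 0 <= r -> r <= C -> r <= h * n%:R ->
    let t := f (turn b (map g (0 :: xs)) * r / C) in
    sphere2 t /\ sphere_dist t (tc r) <= k.
  elim: n => [|n [d d0 hd]].
    have [S hS] := htc (lexx 0) C0; have [d d0 hd] := hS k k0.
    exists d => // xs f fxs hf r r0 rC; rewrite mulr0 => r0'.
    have -> : r = 0 by apply/le_anti; rewrite r0 r0'.
    exact: (hd xs).
  pose p := Num.min C (h * n%:R).
  have p0 : 0 <= p by rewrite le_min C0 mulr_ge0 // ltW.
  have pC : p <= C by rewrite ge_min lexx.
  have pn : p <= h * n%:R by rewrite ge_min lexx orbT.
  have [Sp hSp] := htc p0 pC; have [e e0 he] := hSp h h0.
  exists (Num.min d e); first by rewrite lt_min d0.
  move=> xs f fxs hf r r0 rC rn t.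
  have fd : fine_partition d L xs by apply: fine_partition_le fxs; rewrite ge_min lexx.
  have fe : fine_partition e L xs.
    by apply: fine_partition_le fxs; rewrite ge_min lexx orbT.
  have [rn'|/ltW rn'] := leP r (h * n%:R); first exact: (hd xs).
  have pr : p <= r by rewrite ge_min rn' orbT.
  have rp : r - p <= h.
    rewrite -natr1 mulrDr mulr1 in rn.
    by rewrite /p /Num.min; case: ltP => ?; lra.
  have [S1 S2 D] := rescaled_lip fd hf p0 pr rC.
  have [S3 D3] := he xs f fe hf; have Sr := limit_sphere2 r0 rC.
  split=> //; apply: le_trans (sphere_dist_triangle S2 S1 Sr) _.
  have := sphere_dist_triangle S1 Sp Sr; have := limit_lip p0 pr rC.
  by rewrite (sphere_distC (f (_ * r / C))); rewrite /h in rp D3; lra.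
pose n := Num.bound (C / h).
have [d d0 hd] := main n; exists d => // xs f fxs hf r r0 rC.
apply: (hd xs) => //; apply: le_trans rC _.
rewrite mulrC -ler_pdivrMr //; apply/ltW/archi_boundP.
by rewrite divr_ge0 // ltW.
Qed.

(** Passes to the limit in the closedness of the indicatrices; the turning of
    the limit then includes the closing angle. *)
Lemma limit_closed : b -> tc C = tc 0.
Proof.
move=> bT; have C0 := total_turning_ge0.
have [CE|Cn0] := eqVneq C 0; first by rewrite CE.
have S0 := limit_sphere2 (lexx 0) C0; have SC := limit_sphere2 C0 (lexx C).
apply: sphere_dist_eq0 => //; apply/le_anti.
rewrite sphere_dist_ge0 // andbT; apply/ler_addgt0Pr => k k0; rewrite add0r.
have k20 : 0 < k / 2 by rewrite divr_gt0.
have [d d0 hd] := limit_uniform k20; have [xs [f [fxs _ hf]]] := fine_indicatrix_ex d0.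
have [T1 D1] := hd xs f fxs hf C C0 (lexx C).
have [T2 D2] := hd xs f fxs hf 0 (lexx 0) C0.
move: T1 D1 T2 D2; rewrite mulfK // mulr0 mul0r.
have -> : f (turn b (map g (0 :: xs))) = f 0.
  by move: hf; rewrite bT => /indicatrix_closed.
move=> T1 D1 _ D2; have := sphere_dist_triangle SC T1 S0.
by rewrite (sphere_distC (tc C) (f 0)); lra.
Qed.

(** The length of the limit is not less than C: the polygonal which follows a
    fine inscribed polygonal with directions taken on the limit curve has
    almost the same vertices, so by lower semicontinuity almost the turning C,
    while its turning is the length of a polygonal inscribed in the limit. *)
Lemma limit_length k : 0 < k -> exists rs, [/\ sorted (0 :: rs), last 0 rs = C &
  C - k <= plength sphere_dist (map tc (0 :: rs))].
Proof.
move=> k0; have C0 := total_turning_ge0.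
have [CE|Cn0] := eqVneq C 0.
  by exists [::]; split=> //; rewrite plength1 CE; lra.
have Cgt0 : 0 < C by rewrite lt0r Cn0.
have k20 : 0 < k / 2 by rewrite divr_gt0.
have [zs [szs lzs hzs]] := total_turning_adherent hC k20.
have [e e0 he] := turn_lsc g b (0 :: zs) k20.
pose l := e / (2 * L); have l0 : 0 < l by rewrite divr_gt0 // mulr_gt0.
have l20 : 0 < l ^+ 2 / 2 by rewrite divr_gt0 // exprn_gt0.
have [d1 d10 hd1] := limit_uniform l20.
have C20 : 0 < C / 2 by rewrite divr_gt0.
have [d2 d20 hd2] := fine_total_turning hg hC C20.
have e20 : 0 < e / 2 by rewrite divr_gt0.
have m0 : 0 < Num.min (e / 2) (Num.min d1 d2) by rewrite !lt_min e20 d10.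
have [xs [f [fxs pxs hf]]] := fine_indicatrix_ex m0.
have f1 : fine_partition d1 L xs.
  by apply: fine_partition_le fxs; rewrite !ge_min lexx !orbT.
have f2 : fine_partition d2 L xs.
  by apply: fine_partition_le fxs; rewrite !ge_min lexx !orbT.
have f3 : fine_partition (e / 2) L xs.
  by apply: fine_partition_le fxs; rewrite !ge_min lexx.
set T := turn b (map g (0 :: xs)).
have T0 : 0 < T by have := hd2 xs f2; rewrite -/T; lra.
have sx := fine_sorted fxs; have bx := fine_between fxs.
(* pos y is the time at which f has the direction of the segment ending at y,
   and rho y the corresponding time on the limit curve *)
pose pos y := turn false (map g (points_upto xs y)).
pose rho y := pos y * C / T.
have pos_itv y : 0 <= pos y <= T by rewrite turn_ge0 prefix_turn_le.
have rho_itv y : 0 <= rho y <= C.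
  have /andP[p0 pT] := pos_itv y; rewrite /rho divr_ge0 ?mulr_ge0 ?(ltW T0) //=.
  by rewrite ler_pdivrMr // mulrC ler_wpM2l.
have rho_homo : {homo rho : x y / x <= y}.
  move=> x y xy; rewrite /rho ler_wpM2r ?invr_ge0 ?(ltW T0) // ler_wpM2r //.
  exact: prefix_turn_homo.
have rhoK y : T * rho y / C = pos y.
  by rewrite /rho; field; rewrite !gt_eqF.
pose q y := tc (rho y).
have qS y : sphere2 (q y).
  by have /andP[r0 rC] := rho_itv y; exact: limit_sphere2.
have close : path (fun x x' => (x < x') &&
    (enorm (enorm (g x' - g x) *: q x' - (g x' - g x)) <= l * (x' - x))) 0 xs.
  apply: path_of_splits => X y y' Y E.
  have yy' : y < y'.
    have : path.sorted <%R (0 :: xs) by [].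
    by rewrite E => /cat_sorted2[_] /= /andP[].
  rewrite yy' /=; have [e00|ne] := eqVneq (g y' - g y) 0.
    by rewrite e00 enorm0 scale0r subr0 enorm0 mulr_ge0 ?subr_ge0 ?(ltW l0) ?(ltW yy').
  have yin : y \in 0 :: xs by rewrite E mem_cat mem_head orbT.
  have y'in : y' \in 0 :: xs by rewrite E mem_cat !inE eqxx !orbT.
  have uptoE : points_upto xs y' = X ++ [:: y; y'].
    have E' : 0 :: xs = (X ++ [:: y; y']) ++ Y by rewrite E -catA.
    rewrite /points_upto E' filter_cat.
    have -> : [seq x <- X ++ [:: y; y'] | x <= y'] = X ++ [:: y; y'].
      apply/all_filterP/allP => x xin.
      move: sx; rewrite E' => /cat_sorted2[sX _].
      by have := le_sorted_last 0 sX xin; rewrite last_cat.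
    rewrite (_ : [seq x <- Y | x <= y'] = [::]) ?cats0 //.
    apply/eqP; rewrite -[_ == _]negbK -has_filter; apply/hasPn => x xin.
    rewrite -ltNge.
    have : path.sorted <%R (0 :: xs) by [].
    rewrite E -cat_rcons => /cat_sorted2[_ h].
    by have /allP := order_path_min lt_trans h; apply.
  have sx' := sx; have hf' := hf.
  rewrite E -[[:: y, y' & Y]]/(y :: [:: y'] ++ Y) in sx' hf'.
  have [|x1 [y1 []]] := indicatrix_prefix sx' hf'; first by rewrite -subr_eq0.
  rewrite -uptoE -/(pos y') !inE => /orP[]/eqP -> /orP[]/eqP -> //; rewrite ?ltxx //.
    move=> _ _ fpos; have /andP[r0 rC] := rho_itv y'.
    have [] := hd1 xs f f1 hf (rho y') r0 rC; rewrite -/T rhoK fpos => dS qd.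
    rewrite {2}[g y' - g y]dirE -scalerBr enormZ ger0_norm ?enorm_ge0 //.
    rewrite mulrC ler_pM ?enorm_ge0 //.
      by rewrite enormBC; apply: enorm_le_sphere_dist => //; exact: ltW.
    have /andP[? _] := bx _ yin; have /andP[_ ?] := bx _ y'in.
    by apply: (arclength_lip hg) => //; exact: ltW.
  by move=> h; have := lt_trans yy' h; rewrite ltxx.
pose w := walk g q (g 0) 0 xs.
have w_close y : y \in 0 :: xs -> enorm (w y - g y) <= e / 2.
  move=> yin; apply: le_trans (walk_close (g 0) (ltW l0) close yin) _.
  rewrite subrr enorm0 add0r subr0; have /andP[_ yL] := bx _ yin.
  have -> : e / 2 = l * L by rewrite /l; field; rewrite gt_eqF.
  by rewrite ler_wpM2l // ltW.
have bzs : between 0 L (0 :: zs).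
  move=> z zin; rewrite (le_sorted_head szs zin) /= -lzs.
  exact: (le_sorted_last 0 szs zin).
have hh : {in 0 :: zs, forall z, enorm ((w \o floor_in xs) z - g z) <= e}.
  move=> z zin; apply: le_trans (enormB _ (g (floor_in xs z)) _) _.
  have h1 := w_close _ (floor_in_mem xs z).
  have h2 := floor_in_close hg (ltW e20) (lexx _) f3 bzs zin.
  by apply: le_trans (lerD h1 h2) _; rewrite -splitr.
have [ns sub nsE] := @walk_directions g q (g 0) 0 xs pxs (fun y _ => qS y).
pose rs := rcons (map rho ns) C.
exists rs; split.
- have sns : sorted ns by apply: (subseq_sorted le_trans sub); exact: path_sorted sx.
  rewrite -cat1s /rs -cats1; apply: sorted_cat_le => //.
    apply: sorted_cat_le => //; first exact: sorted_map_homo.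
    move=> x y /mapP[z _ ->]; rewrite inE => /eqP ->.
    by case/andP: (rho_itv z).
  move=> x y; rewrite inE => /eqP ->; rewrite mem_cat inE.
  by case/orP => [/mapP[z _ ->]|/eqP ->//]; case/andP: (rho_itv z).
- by rewrite /rs last_rcons.
have nsS u : u \in tc 0 :: map q ns -> sphere2 u.
  rewrite inE => /predU1P[->|/mapP[y _ ->]]; [exact: limit_sphere2|exact: qS].
have polygonal_le : turn b (map w (0 :: xs)) <= plength sphere_dist (map tc (0 :: rs)).
  rewrite /turn nsE; apply: le_trans
    (plength_cyc_del sphere_dist_ge0 sphere_dist_triangle b (s1 := [::]) nsS) _.
  have -> : map tc (0 :: rs) = rcons (tc 0 :: map q ns) (tc C).
    by rewrite /rs map_cons map_rcons -map_comp.
  case: (boolP b) => [bT|_]; first by rewrite /cyc /= take0 cats1 limit_closed.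
  rewrite /cyc -cats1 -[X in plength _ X <= _]cats0.
  apply: (plength_del sphere_dist_ge0 sphere_dist_triangle) => u.
  rewrite mem_cat inE => /orP[/nsS//|/eqP->].
  exact: limit_sphere2.
apply: le_trans polygonal_le; have := turn_floor_in w b f3 szs lzs.
by have := he _ hh; rewrite map_comp; lra.
Qed.

End Local.
End LimitCurve.

(** * Lengths of curves *)

Section CurveLength.
Context {R : realType}.
Notation E3 := 'rV[R]_3.
Notation sorted := (sorted <=%R).
Implicit Types (x y z s k : R) (xs ys zs : seq R) (f : R -> E3).

Lemma partition_sorted x y xs : itv_partition x y xs ->
  sorted (x :: xs) /\ last x xs = y.
Proof. by case=> h /eqP l; split=> //; apply: sub_path h => ? ? /ltW. Qed.

Lemma sorted_between x xs : sorted (x :: xs) -> between x (last x xs) (x :: xs).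
Proof.
move=> h z zin; rewrite (le_sorted_head h zin).
exact: (le_sorted_last x h zin).
Qed.

(** Weakly increasing sequences of parameters can stand for partitions. *)
Lemma sorted_partition x xs : sorted (x :: xs) -> exists2 ys,
  itv_partition x (last x xs) ys & undup (x :: xs) = x :: ys.
Proof.
move=> h; have u := undup_uniq (x :: xs); have l := undup_last x (x :: xs).
have s := undup_sorted le_trans h; have := undup_sorted_head (x - 1) h.
move: u l s; case: (undup _) => [_ _ _ /= ?|y ys u l s /= yx]; first by exfalso; lra.
exists ys; last by rewrite yx.
split; last by move: l => /= <-; rewrite yx.
have : path.sorted <%R (y :: ys) by rewrite lt_sorted_uniq_le u s.
by rewrite yx.
Qed.

Section Distance.
Context (d : E3 -> E3 -> R).

Lemma plength_undup f xs : sorted xs -> (forall x, x \in xs -> d (f x) (f x) = 0) ->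
  plength d (map f (undup xs)) = plength d (map f xs).
Proof.
elim: xs => [//|x [//|y xs] ih] sx hd.
have sy : sorted (y :: xs) by case/andP: sx.
have hd' z : z \in y :: xs -> d (f z) (f z) = 0.
  by move=> zin; apply: hd; rewrite inE zin orbT.
rewrite undup_cons [map f [:: x, y & xs]]/= plength_cons2.
rewrite -[f y :: _]/(map f (y :: xs)); case: ifP => [xin|xnin].
  have -> : x = y.
    apply/le_anti; case/andP: (sx) => -> /= s.
    exact: le_sorted_head s xin.
  by rewrite hd' ?mem_head // add0r ih.
have := undup_sorted_head x sy; move: (ih sy hd').
case: (undup _) => [_ /= xy|z zs ihz /= zy].
  by move: xnin; rewrite xy inE eqxx.
by rewrite plength_cons2 -[_ :: map f zs]/(map f (z :: zs)) ihz zy.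
Qed.

Lemma curve_length_ub f x xs : sorted (x :: xs) ->
  (forall y, y \in x :: xs -> d (f y) (f y) = 0) ->
  ((plength d (map f (x :: xs)))%:E <= curve_length d x (last x xs) f)%E.
Proof.
move=> sx h0; have [ys hys E] := sorted_partition sx.
rewrite -(plength_undup sx h0) E; apply: ereal_sup_ubound.
by exists ys.
Qed.

Lemma curve_length_le f x y k :
  (forall xs, sorted (x :: xs) -> last x xs = y ->
     plength d (map f (x :: xs)) <= k) -> (curve_length d x y f <= k%:E)%E.
Proof.
move=> h; apply: ge_ereal_sup => _ [xs /partition_sorted[sx lx] <-].
by rewrite lee_fin; exact: h.
Qed.

Lemma curve_length_adherent f x y l k : curve_length d x y f = l%:E -> 0 < k ->
  exists xs, [/\ sorted (x :: xs), last x xs = y &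
    l - k < plength d (map f (x :: xs))].
Proof.
move=> hl k0; have fn : curve_length d x y f \is a fin_num by rewrite hl.
have [_ [xs hxs <-]] := ub_ereal_sup_adherent k0 fn.
rewrite -/(curve_length d x y f) hl -EFinB lte_fin => h.
by have [sx lx] := partition_sorted hxs; exists xs.
Qed.

End Distance.

Lemma TC_adherent f x y C k : TC f x y = C%:E -> 0 < k -> exists xs,
  [/\ sorted (x :: xs), last x xs = y &
    C - k <= turn (f x == f y) (map f (x :: xs))].
Proof.
move=> hC k0; have fn : TC f x y \is a fin_num by rewrite hC.
have [_ [xs hxs <-]] := ub_ereal_sup_adherent k0 fn.
rewrite -/(TC f x y) hC -EFinB lte_fin => /ltW h.
have [sx lx] := partition_sorted hxs; exists xs; split=> //.
by move: h; rewrite TC_polygonalE /closed_polygonal /inscribed /= last_map lx.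
Qed.

Lemma TC_ub f x C xs : sorted (x :: xs) -> TC f x (last x xs) = C%:E ->
  turn (f x == f (last x xs)) (map f (x :: xs)) <= C.
Proof.
move=> sx hC; have [ys hys E] := sorted_partition sx.
rewrite -(turn_undup _ _ sx) E -lee_fin -hC; apply: ereal_sup_ubound.
exists ys => //; congr EFin; rewrite TC_polygonalE /closed_polygonal /=.
by rewrite last_map; case: hys => _ /eqP ->.
Qed.

(** ** Finite total curvature bounds the length of small pieces *)

Lemma turn_cat_ge_at (V : seq E3) p W :
  turn false (rcons V p) + turn false (p :: W) <= turn false (V ++ p :: W).
Proof.
rewrite /turn /cyc directions_cat.
apply: (plength_cat_ge sphere_dist_ge0 sphere_dist_triangle) => x; rewrite mem_cat.
by case/orP => /directions_sphere2.
Qed.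

Lemma split_turn v (vs ps : seq E3) k : turn false (v :: ps) <= k ->
  k < turn false (v :: ps ++ vs) -> exists (p : seq E3) (x : E3) (q : seq E3),
  [/\ ps ++ vs = p ++ x :: q, turn false (v :: p) <= k &
    k < turn false (v :: rcons p x)].
Proof.
elim: vs ps => [|x vs ih] ps h1; first by rewrite cats0 ltNge h1.
move=> h2; have [h|h] := leP (turn false (v :: rcons ps x)) k.
  have [|p [y [q [E ? ?]]]] := ih _ h; first by rewrite cat_rcons.
  by exists p, y, q; rewrite -E cat_rcons.
by exists ps, x, vs.
Qed.

(** A polygonal of turning at most 1 has length at most its chord divided by
    cos 1. A polygonal of turning at most n is cut greedily into n + 1 pieces of
    this kind, at most, joined by single segments, each new piece starting
    when the turning has exceeded 1. *)
Lemma length_le_diam (n : nat) (V : seq E3) D : 0 <= D ->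
  (forall u v, u \in V -> v \in V -> enorm (v - u) <= D) ->
  turn false V <= n%:R ->
  plength edist V <= ((cos 1)^-1 + 1) * n.+1%:R * D.
Proof.
move=> D0; have c0 := @cos1_gt0 R.
have pi1 : 1 <= pi :> R by have := @pi_ge2 R; lra.
have ci0 : 0 <= (cos 1 : R)^-1 by rewrite invr_ge0 ltW.
have base (W : seq E3) : (forall u v, u \in W -> v \in W -> enorm (v - u) <= D) ->
    turn false W <= 1 -> plength edist W <= (cos 1)^-1 * D.
  move=> hD h; rewrite mulrC ler_pdivlMr // mulrC.
  apply: le_trans (chord_ge ler01 pi1 h) _.
  case: W hD {h} => [|w W] hD; first by rewrite subrr enorm0.
  by apply: hD; [exact: mem_head|rewrite /=; exact: mem_last].
elim: n V => [|n ih] V hD hV.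
  have := base V hD (le_trans hV ler01); nra.
have [h|h] := leP (turn false V) 1.
  have := base V hD h; have : 0 <= n%:R :> R by []; rewrite -natr1 => n0.
  have : 0 <= ((cos 1)^-1 + 1) * (n%:R + 1) * D.
    by rewrite !mulr_ge0 ?addr_ge0.
  by rewrite -natr1 => q1 q2; nra.
case: V hD hV h => [|v vs] hD hV h.
  by move: h; rewrite ltNge; case/negP; apply: le_trans ler01; rewrite /turn plength0.
have [|p [x [q [E h1 h2]]]] := @split_turn v vs [::] 1 _ h.
  by rewrite turn1.
rewrite /= in E; rewrite E -cat_cons in hD hV *.
have hp u : u \in v :: p -> u \in (v :: p) ++ x :: q by rewrite mem_cat => ->.
have hq u : u \in x :: q -> u \in (v :: p) ++ x :: q.
  by move=> uin; rewrite mem_cat uin orbT.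
have tq : turn false (x :: q) <= n%:R.
  have := turn_cat_ge_at (v :: p) x q; rewrite rcons_cons.
  by move: hV; rewrite -natr1; lra.
have := ih (x :: q) (fun u w uin win => hD u w (hq u uin) (hq w win)) tq.
have := base (v :: p) (fun u w uin win => hD u w (hp u uin) (hp w win)) h1.
rewrite plength_cat lastI plength_rcons2 -lastI.
have : edist (last v p) x <= D.
  by apply: hD; [apply/hp/mem_last|apply/hq/mem_head].
have : 0 <= (cos 1 : R)^-1 * D by rewrite mulr_ge0.
rewrite -[n.+2%:R]natr1; move: (plength _ _) (plength _ _) => l1 l2; nra.
Qed.

End CurveLength.

(** * Parameterization by arc length *)

Section ArcLength.
Context {R : realType}.
Notation E3 := 'rV[R]_3.
Notation sorted := (sorted <=%R).
Implicit Types (x y z s k : R) (xs ys zs : seq R).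

Context (c : R -> E3) (a b C : R).
Hypothesis hab : a < b.
Hypothesis hc : {within `[a, b], continuous c}.
Hypothesis hTC : TC c a b = C%:E.

Lemma plength_edist_ge0 (V : seq E3) : 0 <= plength edist V.
Proof.
by apply: (@plength_ge0 _ edist setT) => [u v _ _|//]; exact: euclid_dist_ge0.
Qed.

Lemma curve_continuous x k : a <= x <= b -> 0 < k -> exists2 d, 0 < d &
  forall y, a <= y <= b -> `|x - y| < d -> enorm (c y - c x) <= k.
Proof.
move=> xab k0; have k20 : 0 < k / 2 by rewrite divr_gt0.
have xin : `[a, b]%classic x by rewrite /= in_itv.
have /cvgrPdist_le /(_ _ k20) := (subspace_continuousP _ _).1 hc x xin.
move=> /nbhs_ballP[d d0 hd]; exists d => // y yab xy.
have := hd y; rewrite -ball_normE /= in_itv /= => /(_ xy yab) h.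
rewrite enormBC; apply: le_trans (enorm_le_norm _) _; lra.
Qed.

Lemma curve_bounded : exists2 D, 0 <= D &
  forall y z, a <= y <= b -> a <= z <= b -> enorm (c z - c y) <= D.
Proof.
have hn : {within `[a, b], continuous (fun x => `|c x|)}.
  apply/subspace_continuousP => x xin; apply: cvg_norm.
  exact: (subspace_continuousP _ _).1 hc x xin.
have [m _ hm] := EVT_max (ltW hab) hn.
exists (4 * `|c m|) => [|y z yab zab]; first by rewrite mulr_ge0.
have hy := hm y; have hz := hm z; rewrite !in_itv /= yab zab in hy hz.
have := enormD (c z) (- c y); rewrite enormN.
have := enorm_le_norm (c y); have := enorm_le_norm (c z).
have := hy isT; have := hz isT; lra.
Qed.

Lemma inscribed_turn_le xs : sorted xs -> between a b xs ->
  turn (c a == c b) (map c xs) <= C.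
Proof.
apply: (@turn_between_le _ c (c a == c b) a b C); first exact: ltW.
by move=> ys sy ly; have := @TC_ub _ c a C ys sy; rewrite ly; apply.
Qed.

(** The factor M depends only on the total curvature, so small diameter implies
    small length: this gives the continuity of the arc-length coordinate. *)
Lemma length_bound : exists2 M, 0 < M & forall D x y xs, 0 <= D -> a <= x ->
  y <= b -> sorted xs -> between x y xs ->
  (forall z z', x <= z <= y -> x <= z' <= y -> enorm (c z' - c z) <= D) ->
  plength edist (map c xs) <= M * D.
Proof.
pose n := Num.bound `|C|.
have c0 := @cos1_gt0 R.
exists (((cos 1)^-1 + 1) * n.+1%:R).
  by rewrite mulr_gt0 // ltr_wpDl // invr_ge0 ltW.
move=> D x y xs D0 ax yb sx hx hD; apply: length_le_diam => //.
  by move=> _ _ /mapP[z zin ->] /mapP[z' z'in ->]; apply: hD; exact: hx.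
apply: le_trans (turn_le_cyc (c a == c b) _) _.
apply: le_trans (inscribed_turn_le sx _) _.
  move=> z /hx /andP[xz zy]; by rewrite (le_trans ax) // (le_trans zy).
by apply: le_trans (ler_norm _) _; apply/ltW/archi_boundP.
Qed.

Definition arc_len x y : R := fine (curve_length edist x y c).

Lemma arc_lenE x y : a <= x -> x <= y -> y <= b ->
  curve_length edist x y c = (arc_len x y)%:E.
Proof.
move=> ax xy yb; have [D D0 hD] := curve_bounded; have [M M0 hM] := length_bound.
rewrite /arc_len fineK // fin_numElt; apply/andP; split.
  apply: lt_le_trans (ltNyr 0) _.
  apply: le_trans (@curve_length_ub _ _ c x [:: y] _ _); last 2 first.
  - by rewrite /= andbT.
  - by move=> z _; exact: euclid_distxx.
  by rewrite lee_fin plength_edist_ge0.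
apply: le_lt_trans (ltry (M * D)); apply: curve_length_le => xs sxs lxs.
have bx := sorted_between sxs; rewrite lxs in bx.
apply: (hM D x y) => // z z' /andP[xz zy] /andP[xz' z'y].
by apply: hD; apply/andP; split; lra.
Qed.

Lemma arc_len_ub x xs : a <= x -> last x xs <= b -> sorted (x :: xs) ->
  plength edist (map c (x :: xs)) <= arc_len x (last x xs).
Proof.
move=> ax lb sx; rewrite -lee_fin -arc_lenE //.
  by apply: curve_length_ub => // y _; exact: euclid_distxx.
exact: (le_sorted_last x sx (mem_head _ _)).
Qed.

Lemma arc_len_adherent x y k : a <= x -> x <= y -> y <= b -> 0 < k ->
  exists xs, [/\ sorted (x :: xs), last x xs = y &
    arc_len x y - k < plength edist (map c (x :: xs))].
Proof. by move=> ax xy yb; apply: curve_length_adherent; exact: arc_lenE. Qed.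

Lemma arc_len_ge0 x y : a <= x -> x <= y -> y <= b -> 0 <= arc_len x y.
Proof.
move=> ax xy yb; apply: le_trans (@arc_len_ub x [:: y] ax yb _).
  exact: plength_edist_ge0.
by rewrite /= andbT.
Qed.

Lemma arc_lenD x y z : a <= x -> x <= y -> y <= z -> z <= b ->
  arc_len x z = arc_len x y + arc_len y z.
Proof.
move=> ax xy yz zb; have yb := le_trans yz zb; have ay := le_trans ax xy.
apply/le_anti/andP; split; apply/ler_addgt0Pr => k k0.
  have [xs [sx lx /ltW h]] := arc_len_adherent ax (le_trans xy yz) zb k0.
  rewrite -lerBlDr; apply: le_trans h _.
  pose X1 := [seq w <- xs | w <= y]; pose X2 := [seq w <- xs | y < w].
  have sxs : sorted xs by exact: path_sorted sx.
  have s1 : sorted (x :: X1).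
    have := sorted_filter le_trans (fun w => w <= y) sx.
    by rewrite /= xy.
  have s2 : sorted X2 by apply: sorted_filter => //; exact: le_trans.
  have sy2 : sorted (y :: X2).
    rewrite -cat1s; apply: sorted_cat_le => // u w; rewrite inE => /eqP ->.
    by rewrite mem_filter => /andP[/ltW].
  have s1y : sorted (x :: rcons X1 y).
    rewrite -rcons_cons -cats1; apply: sorted_cat_le => // u w.
    rewrite !inE => /predU1P[->|]; first by move/eqP ->.
    by rewrite mem_filter => /andP[uy _] /eqP ->.
  have l2 : last y X2 = z.
    case E2 : X2 => [|w X2' /=].
      have : z <= y.
        rewrite -lx; have := mem_last x xs; rewrite inE => /predU1P[->//|].
        by rewrite (sorted_split y sxs) -/X1 -/X2 E2 cats0 mem_filter => /andP[].
      by move=> zy; apply/le_anti; rewrite /= yz zy.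
    by rewrite -lx (sorted_split y sxs) -/X1 -/X2 E2 last_cat.
  rewrite (sorted_split y sxs) -/X1 -/X2.
  have del : plength edist (map c (x :: X1) ++ map c X2) <=
      plength edist (map c (x :: X1) ++ c y :: map c X2).
    apply: (@plength_del _ _ setT) => // [u v _ _|v u w _ _ _].
      exact: euclid_dist_ge0.
    exact: euclid_dist_triangle.
  rewrite map_cons map_cat -cat_cons -map_cons; apply: le_trans del _.
  rewrite plength_cat -map_rcons rcons_cons; apply: lerD.
    have := @arc_len_ub x (rcons X1 y) ax; rewrite last_rcons; exact.
  by have := @arc_len_ub y X2 ay; rewrite l2; apply.
have k20 : 0 < k / 2 by rewrite divr_gt0.
have [s1 [ss1 l1 h1]] := arc_len_adherent ax xy yb k20.
have [s2 [ss2 l2 h2]] := arc_len_adherent ay yz zb k20.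
have s12 : sorted (x :: s1 ++ s2).
  move: ss1 ss2; rewrite /= cat_path l1 => -> -> //.
have := @arc_len_ub x (s1 ++ s2) ax; rewrite last_cat l1 l2 => /(_ zb s12).
have -> : map c (x :: s1 ++ s2) = map c (belast x s1) ++ c y :: map c s2.
  by rewrite -cat_cons lastI l1 map_cat map_rcons cat_rcons.
rewrite plength_cat -map_rcons -l1 -lastI -[_ :: map c s2]/(map c (last x s1 :: s2)).
rewrite l1; lra.
Qed.

Lemma arc_len_chord x y : a <= x -> x <= y -> y <= b ->
  enorm (c y - c x) <= arc_len x y.
Proof.
move=> ax xy yb; have := @arc_len_ub x [:: y] ax yb.
by rewrite /= plength_cons2 plength1 addr0 andbT; apply.
Qed.

Lemma arc_len_small : exists2 M, 0 < M & forall D x y, 0 <= D -> a <= x ->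
  x <= y -> y <= b ->
  (forall z z', x <= z <= y -> x <= z' <= y -> enorm (c z' - c z) <= D) ->
  arc_len x y <= M * D.
Proof.
have [M M0 hM] := length_bound; exists M => // D x y D0 ax xy yb hD.
rewrite -lee_fin -arc_lenE //; apply: curve_length_le => xs sxs lxs.
have bx := sorted_between sxs; rewrite lxs in bx.
exact: (hM D x y).
Qed.

Definition arc_coord x := arc_len a x.

Lemma arc_coordB x y : a <= x -> x <= y -> y <= b ->
  arc_coord y - arc_coord x = arc_len x y.
Proof. by move=> ax xy yb; rewrite /arc_coord (arc_lenD _ ax) // addrC addKr. Qed.

Lemma arc_coord_homo x y : a <= x -> x <= y -> y <= b ->
  arc_coord x <= arc_coord y.
Proof.
by move=> ax xy yb; rewrite -subr_ge0 arc_coordB // arc_len_ge0.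
Qed.

Lemma arc_coord_a : arc_coord a = 0.
Proof.
have := arc_lenD (lexx a) (lexx a) (lexx a) (ltW hab).
by rewrite /arc_coord => h; lra.
Qed.

Lemma arc_coord_continuous : {within `[a, b], continuous arc_coord}.
Proof.
apply/subspace_continuousP => x /=; rewrite in_itv /= => xab.
apply/cvgrPdist_le => e e0; have [M M0 hM] := arc_len_small.
pose k := e / M; have k0 : 0 < k by rewrite divr_gt0.
have k20 : 0 < k / 2 by rewrite divr_gt0.
have kE : M * k = e by rewrite /k mulrC divfK // gt_eqF.
have [d d0 hd] := curve_continuous xab k20.
apply/nbhs_ballP; exists d => // y; rewrite -ball_normE /= => xy.
rewrite in_itv /= => yab; move/andP: xab => [ax xb]; move/andP: yab => [ay yb].
have near_x z : a <= z -> z <= b -> `|x - z| < d -> enorm (c z - c x) <= k / 2.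
  by move=> az zb; apply: hd; rewrite az zb.
have close z z' : a <= z -> z <= b -> a <= z' -> z' <= b -> `|x - z| < d ->
    `|x - z'| < d -> enorm (c z' - c z) <= k.
  move=> az zb az' z'b hz hz'; apply: le_trans (enormB _ (c x) _) _.
  have := near_x z az zb hz; have := near_x z' az' z'b hz'.
  by rewrite (enormBC (c x)); lra.
rewrite -kE; have [le|/ltW le] := leP x y.
  rewrite distrC ger0_norm ?subr_ge0 ?arc_coord_homo // arc_coordB //.
  apply: hM => //; first exact: ltW.
  rewrite ler0_norm ?subr_le0 // in xy.
  have near_z z : x <= z <= y -> [/\ a <= z, z <= b & `|x - z| < d].
    clear -ax yb xy => /andP[? ?]; split; [lra|lra|].
    by rewrite ler0_norm ?subr_le0 //; lra.
  by move=> z z' /near_z[? ? ?] /near_z[? ? ?]; exact: close.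
rewrite ger0_norm ?subr_ge0 ?arc_coord_homo // arc_coordB //.
apply: hM => //; first exact: ltW.
rewrite ger0_norm ?subr_ge0 // in xy.
have near_z z : y <= z <= x -> [/\ a <= z, z <= b & `|x - z| < d].
  clear -ay xb xy => /andP[? ?]; split; [lra|lra|].
  by rewrite ger0_norm ?subr_ge0 //; lra.
by move=> z z' /near_z[? ? ?] /near_z[? ? ?]; exact: close.
Qed.

(** Some parameter of given arc-length coordinate; the curve does not depend
    on the choice, since it is constant where the coordinate is. *)
Definition arc_param s : R := get [set x | a <= x <= b /\ arc_coord x = s].

Let L := arc_coord b.

Lemma arc_paramP s : 0 <= s -> s <= L ->
  a <= arc_param s <= b /\ arc_coord (arc_param s) = s.
Proof.
move=> s0 sL; have ex : exists x, [set x | a <= x <= b /\ arc_coord x = s] x.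
  have [|x xin xs] := @IVT R arc_coord a b s (ltW hab) arc_coord_continuous.
    by rewrite arc_coord_a ge_min le_max s0 sL orbT.
  by exists x; split=> //; rewrite in_itv /= in xin.
case: ex => x hx.
exact: (@getPex _ [set x | a <= x <= b /\ arc_coord x = s] (ex_intro _ x hx)).
Qed.

Lemma arc_coord_inj x y : a <= x <= b -> a <= y <= b ->
  arc_coord x = arc_coord y -> c x = c y.
Proof.
have main u v : a <= u <= b -> a <= v <= b -> u <= v ->
    arc_coord u = arc_coord v -> c u = c v.
  move=> /andP[au ub] /andP[av vb] uv h.
  apply/esym/eqP; rewrite -subr_eq0 -enorm_eq0; apply/eqP/le_anti.
  rewrite enorm_ge0 andbT; apply: le_trans (arc_len_chord au uv vb) _.
  by rewrite -arc_coordB // h subrr.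
move=> hx hy h; have [xy|/ltW yx] := leP x y; first exact: main.
by apply/esym/main.
Qed.

Lemma arc_param_homo s t : 0 <= s -> s <= t -> t <= L ->
  arc_param s <= arc_param t.
Proof.
move=> s0 st tL; have [<- //|ne] := eqVneq s t.
have [/andP[as1 sb] sE] := arc_paramP s0 (le_trans st tL).
have [/andP[at1 tb] tE] := arc_paramP (le_trans s0 st) tL.
rewrite leNgt; apply/negP => /ltW h; move/negP: ne; apply; apply/eqP/le_anti.
by rewrite st -{1}tE -{1}sE arc_coord_homo.
Qed.

Definition arc_curve s : E3 := c (arc_param s).

Lemma arc_coord_itv x : a <= x <= b -> 0 <= arc_coord x <= L.
Proof.
by move=> /andP[ax xb]; rewrite -{1}arc_coord_a !arc_coord_homo.
Qed.

Lemma arc_curveK x : a <= x <= b -> arc_curve (arc_coord x) = c x.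
Proof.
move=> xab; have /andP[c0 cL] := arc_coord_itv xab.
by have [? ?] := arc_paramP c0 cL; exact: arc_coord_inj.
Qed.

Lemma map_arc_curve xs : between a b xs ->
  map arc_curve (map arc_coord xs) = map c xs.
Proof.
by move=> hx; rewrite -map_comp; apply/eq_in_map => x /hx; exact: arc_curveK.
Qed.

Lemma sorted_arc_coord xs : sorted xs -> between a b xs ->
  sorted (map arc_coord xs).
Proof.
elim: xs => [//|x [//|y xs] ih] /= /andP[xy sx] hx.
have hx' : between a b (y :: xs) by move=> z zin; apply: hx; rewrite inE zin orbT.
have /= -> := ih sx hx'; rewrite andbT; have /andP[ax _] := hx x (mem_head _ _).
by have /andP[_ yb] := hx' y (mem_head _ _); exact: arc_coord_homo.
Qed.

Lemma sorted_arc_param xs : sorted xs -> between 0 L xs ->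
  sorted (map arc_param xs).
Proof.
elim: xs => [//|x [//|y xs] ih] /= /andP[xy sx] hx.
have hx' : between 0 L (y :: xs) by move=> z zin; apply: hx; rewrite inE zin orbT.
have /= -> := ih sx hx'; rewrite andbT; have /andP[ax _] := hx x (mem_head _ _).
by have /andP[_ yb] := hx' y (mem_head _ _); exact: arc_param_homo.
Qed.

Lemma arc_curve_arclength : 0 < L -> arclength_curve arc_curve L.
Proof.
move=> L0; split=> // [x y x0 xy yL|x y k x0 xy yL k0].
  have [/andP[ax xb] xE] := arc_paramP x0 (le_trans xy yL).
  have [/andP[ay yb] yE] := arc_paramP (le_trans x0 xy) yL.
  apply: le_trans (arc_len_chord ax (arc_param_homo x0 xy yL) yb) _.
  by rewrite -arc_coordB ?xE ?yE // arc_param_homo.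
have [/andP[ax xb] xE] := arc_paramP x0 (le_trans xy yL).
have [/andP[ay yb] yE] := arc_paramP (le_trans x0 xy) yL.
have pxy := arc_param_homo x0 xy yL.
have [xs [sx lx h]] := arc_len_adherent ax pxy yb k0.
have bx : between a b (arc_param x :: xs).
  move=> z /(sorted_between sx); rewrite lx => /andP[xz zy].
  by rewrite (le_trans ax xz) (le_trans zy yb).
have E : x :: map arc_coord xs = map arc_coord (arc_param x :: xs).
  by rewrite /= xE.
exists (map arc_coord xs); rewrite E map_arc_curve //; split.
- exact: sorted_arc_coord.
- by rewrite -xE last_map lx yE.
- by apply/ltW; move: h; rewrite -arc_coordB // xE yE.
Qed.

(** The two curves have the same inscribed polygonals up to null segments,
    except that the parameters chosen for 0 and L may differ from a and b. *)
Lemma arc_curve_total_turning : total_turning (c a == c b) arc_curve L C.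
Proof.
split=> [xs sx lx|k k0].
  have bx := sorted_between sx; rewrite lx in bx.
  have E : map arc_curve (0 :: xs) = map c (map arc_param (0 :: xs)).
    by rewrite -map_comp.
  have bp : between a b (map arc_param (0 :: xs)).
    by move=> _ /mapP[z /bx /andP[z0 zL] ->]; have [] := arc_paramP z0 zL.
  by rewrite E; apply: inscribed_turn_le => //; exact: sorted_arc_param.
have [xs [sx lx h]] := TC_adherent hTC k0.
have bx := sorted_between sx; rewrite lx in bx.
have E0 : 0 :: map arc_coord xs = map arc_coord (a :: xs).
  by rewrite /= arc_coord_a.
exists (map arc_coord xs); rewrite E0 map_arc_curve //; split=> //.
  exact: sorted_arc_coord.
by rewrite -arc_coord_a last_map lx.
Qed.

Lemma arc_curve_param : arc_length_param c a b L arc_curve.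
Proof.
split; first exact: (arc_lenE (lexx a) (ltW hab) (lexx b)).
by move=> x; rewrite in_itv /= => xab; exact: arc_curveK.
Qed.

End ArcLength.

(** * Tangents and derivatives *)

Section TangentDerivative.
Context {R : realType}.
Notation E3 := 'rV[R]_3.
Implicit Types (x y z s k : R) (g : R -> E3) (u : E3).

(** The difference quotient has almost the direction u, and its norm is at
    least the cosine of the deviation, as g is parameterized by arc length. *)
Lemma difference_quotient g L x y u k : arclength_curve g L -> sphere2 u ->
  0 <= k -> k <= pi / 2 -> 0 <= x -> x < y -> y <= L ->
  (forall x' y', x <= x' -> x' < y' -> y' <= y ->
     sphere_dist (dir (g y' - g x')) u <= k) ->
  enorm ((y - x)^-1 *: (g y - g x) - u) ^+ 2 <= 2 * k.
Proof.
move=> hg uS k0 kpi x0 xy yL h.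
have c0 : 0 <= cos k by apply: cos_ge0_pihalf; apply/andP; split => //; lra.
have c1 := cos_le1 k.
have yx : 0 < y - x by rewrite subr_gt0.
have low : (y - x) * cos k <= dot (g y - g x) u.
  apply/ler_addgt0Pr => e e0.
  have [xs [sxs lxs len]] := arclength_adherent hg x0 (ltW xy) yL e0.
  have bx := sorted_between sxs; rewrite lxs in bx.
  have kpi' : k <= pi by have := @pi_ge0 R; lra.
  have dirs v : v \in directions (map g (x :: xs)) -> sphere_dist u v <= k.
    move=> /(directionsP sxs)[x' [y' [xin yin xy' ->]]]; rewrite sphere_distC.
    by apply: h => //; [case/andP: (bx _ xin)|case/andP: (bx _ yin)].
  have := dot_chord_ge uS k0 kpi' dirs; rewrite /= last_map lxs.
  have : cos k * (y - x - e) <= cos k * plength edist (map g (x :: xs)).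
    by rewrite ler_wpM2l.
  by rewrite /=; nra.
have up : enorm ((y - x)^-1 *: (g y - g x)) <= 1.
  rewrite enormZ ger0_norm ?invr_ge0 ?(ltW yx) // mulrC ler_pdivrMr // mul1r.
  exact: (arclength_lip hg x0 (ltW xy) yL).
set q := _ *: _ in up *.
have qu : cos k <= dot q u.
  by rewrite /q dotZl mulrC ler_pdivlMr // mulrC.
have qq : dot q q <= 1 by rewrite -enorm_sqr exprn_ile1 // enorm_ge0.
have uu : dot u u = 1 by apply/sphere2P.
clearbody q.
have := cos_lip k0; rewrite cos0 enorm_sqr !dotE uu (dotC u q); lra.
Qed.

(** At a point of differentiability, quotients from the right are enough. *)
Lemma derive1_close g x u k : derivable g x 1 ->
  (exists2 d, 0 < d & forall h, 0 < h -> h < d ->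
    enorm (h^-1 *: (g (x + h) - g x) - u) <= k) ->
  enorm (derive1 g x - u) <= k.
Proof.
move=> dg [d d0 hd]; apply/ler_addgt0Pr => e e0.
have cv : h^-1 *: (g (h + x) - g x) @[h --> 0^'] --> derive1 g x.
  suff E : (fun h => h^-1 *: (g (h + x) - g x)) =
      (fun h : R => h^-1 *: ((g \o shift x) (h *: 1) - g x)).
    by rewrite /derive1 E; exact: dg.
  by apply/funext => h; rewrite /= [h *: 1](mulr1 h).
have e20 : 0 < e / 2 by rewrite divr_gt0.
move/cvgrPdist_le : cv => /(_ _ e20) /nbhs_ballP[r r0 hr].
pose h := Num.min (d / 2) (r / 2).
have h0 : 0 < h by rewrite lt_min !divr_gt0.
have hd' : h < d.
  by have : h <= d / 2 by [rewrite ge_min lexx]; lra.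
have hrh : h < r.
  by have : h <= r / 2 by [rewrite ge_min lexx orbT]; lra.
have hD : `|derive1 g x - h^-1 *: (g (h + x) - g x)| <= e / 2.
  apply: hr; last by rewrite gt_eqF.
  by rewrite -ball_normE /= sub0r normrN gtr0_norm.
apply: le_trans (enormB _ (h^-1 *: (g (h + x) - g x)) _) _.
have := hd h h0 hd'; have := enorm_le_norm (derive1 g x - h^-1 *: (g (h + x) - g x)).
by rewrite (addrC x); lra.
Qed.

Lemma chord_limit_right_tangent g L s u : arclength_curve g L -> 0 <= s ->
  s < L -> chord_limit_right g L s u -> tangent_right g s u.
Proof.
move=> hg s0 sL [uS hu]; apply/cvgrPdist_le => e e0.
pose k := Num.min (e ^+ 2 / 2) 1.
have k0 : 0 < k by rewrite lt_min ltr01 divr_gt0 // exprn_gt0.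
have k1 : k <= pi / 2 by apply: le_trans (pihalf_ge1 R); rewrite ge_min lexx orbT.
have ke : 2 * k <= e ^+ 2.
  have : k <= e ^+ 2 / 2 by rewrite ge_min lexx.
  by lra.
have [d d0 hd] := hu k k0; pose r := Num.min d (L - s).
have r0 : 0 < r by rewrite lt_min d0 subr_gt0.
have rd : r <= d by rewrite ge_min lexx.
have rL : r <= L - s by rewrite ge_min lexx orbT.
apply/nbhs_ballP; exists r => // x; rewrite -ball_normE /= => xr sx dx.
rewrite ler0_norm ?subr_le0 ?(ltW sx) // in xr.
apply: le_trans (norm_le_enorm _) _; rewrite enormBC; apply: derive1_close => //.
exists (s + r - x); first by lra.
move=> h h0 hlt; rewrite -(@ler_pXn2r _ 2) ?nnegrE ?enorm_ge0 ?(ltW e0) //.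
have xh : x < x + h by lra.
have xhL : x + h <= L by lra.
apply: le_trans ke; have -> : h^-1 = (x + h - x)^-1 by rewrite addrC addKr.
have x0 : 0 <= x by lra.
apply: (difference_quotient hg uS (ltW k0) k1 x0 xh xhL) => x' y' xx' xy' yx'.
apply: (hd x' y' _ xy' _ _).2; clear -xx' yx' xhL hlt sx rd s0; lra.
Qed.

Lemma chord_limit_left_tangent g L s u : arclength_curve g L -> 0 < s ->
  s <= L -> chord_limit_left g s u -> tangent_left g s u.
Proof.
move=> hg s0 sL [uS hu]; apply/cvgrPdist_le => e e0.
pose k := Num.min (e ^+ 2 / 2) 1.
have k0 : 0 < k by rewrite lt_min ltr01 divr_gt0 // exprn_gt0.
have k1 : k <= pi / 2 by apply: le_trans (pihalf_ge1 R); rewrite ge_min lexx orbT.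
have ke : 2 * k <= e ^+ 2.
  have : k <= e ^+ 2 / 2 by rewrite ge_min lexx.
  by lra.
have [d d0 hd] := hu k k0; pose r := Num.min d s.
have r0 : 0 < r by rewrite lt_min d0.
have rd : r <= d by rewrite ge_min lexx.
have rs : r <= s by rewrite ge_min lexx orbT.
apply/nbhs_ballP; exists r => // x; rewrite -ball_normE /= => xr sx dx.
rewrite ger0_norm ?subr_ge0 ?(ltW sx) // in xr.
apply: le_trans (norm_le_enorm _) _; rewrite enormBC; apply: derive1_close => //.
exists (s - x); first by lra.
move=> h h0 hlt; rewrite -(@ler_pXn2r _ 2) ?nnegrE ?enorm_ge0 ?(ltW e0) //.
have xh : x < x + h by lra.
have xhL : x + h <= L by lra.
apply: le_trans ke; have -> : h^-1 = (x + h - x)^-1 by rewrite addrC addKr.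
have x0 : 0 <= x by lra.
apply: (difference_quotient hg uS (ltW k0) k1 x0 xh xhL) => x' y' xx' xy' yx'.
apply: (hd x' y' _ _ xy' _).2; clear -xx' yx' xhL hlt sx rd rs xr sL x0 ; lra.
Qed.

End TangentDerivative.

(** * Fineness in arc length *)

Section Conclusion.
Context {R : realType}.
Notation E3 := 'rV[R]_3.
Notation sorted := (sorted <=%R).
Implicit Types (x y z s k d r : R) (xs ys zs : seq R).

(** The distance of g s and g t has a positive minimum over the pairs of
    parameters at distance at least k, by compactness. *)
Lemma injective_inverse_continuous (g : R -> E3) L k : arclength_curve g L ->
  (forall s t, 0 <= s -> s <= t -> t <= L -> g s = g t -> s = t) -> 0 < k ->
  exists2 d, 0 < d & forall s t, 0 <= s -> s <= t -> t <= L ->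
    enorm (g t - g s) < d -> t - s <= k.
Proof.
move=> hg inj k0; have L0 := arclength_gt0 hg.
pose A := `[0, L]%classic `*` `[0, L]%classic : set (R * R)%type.
(* the second term vanishes for parameters at distance at least k and is
   positive for the others, in particular on the diagonal: F > 0 on A *)
pose F (p : R * R) : R := enorm (g p.2 - g p.1) + Num.max 0 (k - `|p.2 - p.1|).
have cA : compact A by apply: compact_setX; exact: segment_compact.
have A0 : A !=set0 by exists (0, 0); split; rewrite /= in_itv /= lexx ltW.
have AE p : A p -> 0 <= p.1 <= L /\ 0 <= p.2 <= L.
  by rewrite /A /= !in_itv /= => -[].
have Fc : {within A, continuous F}.
  apply/subspace_continuousP => p /AE[p1 p2]; apply/cvgrPdist_le => e e0.
  pose d := e / 4; have d0 : 0 < d by rewrite divr_gt0.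
  apply/nbhs_ballP; exists d => // q [q1 q2] /AE[hq1 hq2].
  move: q1 q2; rewrite -ball_normE /= => q1 q2.
  have n1 := norm_lip hg p1 hq1; have n2 := norm_lip hg p2 hq2.
  rewrite distrC in n1; rewrite distrC in n2.
  have t1 := enormB (g p.2) (g q.2) (g p.1); have t2 := enormB (g q.2) (g q.1) (g p.1).
  have t3 := enormB (g q.2) (g p.2) (g q.1); have t4 := enormB (g p.2) (g p.1) (g q.1).
  rewrite (enormBC (g p.2) (g q.2)) in t1; rewrite (enormBC (g p.1) (g q.1)) in t4.
  have a1 : `| `|p.2 - p.1| - `|q.2 - q.1| | <= 2 * d.
    apply: le_trans (ler_dist_dist _ _) _.
    have -> : p.2 - p.1 - (q.2 - q.1) = (p.2 - q.2) - (p.1 - q.1) by ring.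
    by apply: le_trans (ler_normB _ _) _; lra.
  have a2 : `|Num.max 0 (k - `|p.2 - p.1|) - Num.max 0 (k - `|q.2 - q.1|)| <= 2 * d.
    move: a1; rewrite !ler_norml => /andP[a1 a1'].
    clear -a1 a1' k0; rewrite /Num.max.
    by case: ltP => ?; case: ltP => ?; apply/andP; split; lra.
  have E1 : enorm (g p.2 - g p.1) - enorm (g q.2 - g q.1) <= 2 * d.
    by clear -t1 t2 n1 n2 q1 q2; lra.
  have E2 : enorm (g q.2 - g q.1) - enorm (g p.2 - g p.1) <= 2 * d.
    by clear -t3 t4 n1 n2 q1 q2; lra.
  rewrite /from_subspace /F; set m1 := Num.max _ _ in a2 *.
  set m2 := Num.max _ _ in a2 *.
  move: a2; rewrite !ler_norml => /andP[a2 a2']; rewrite /d in E1 E2 a2 a2'.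
  by clear -E1 E2 a2 a2'; apply/andP; split; lra.
have [p pin hp] := compact_EVT_min A0 cA Fc.
have /AE[/andP[p1 p1'] /andP[p2 p2']] : A p by move: pin; rewrite inE.
have Fp : 0 < F p.
  rewrite /F; have [far|near] := leP k `|p.2 - p.1|; last first.
    rewrite ltr_wpDl ?enorm_ge0 // lt_max subr_gt0 near orbT //.
  have -> : Num.max 0 (k - `|p.2 - p.1|) = 0 by apply/max_idPl; lra.
  rewrite addr0 enorm_gt0 subr_eq0; apply/eqP => e.
  have pp : p.1 = p.2.
    have [le|/ltW le] := leP p.1 p.2; first exact: inj.
    by apply/esym/inj.
  by move: far; rewrite pp subrr normr0; lra.
exists (F p) => // s t s0 st tL h; rewrite leNgt; apply/negP => far.
have : F p <= F (s, t).
  apply: hp; rewrite inE /A; split; rewrite /= in_itv /=; apply/andP; split; lra.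
have ts : 0 <= t - s by rewrite subr_ge0.
rewrite /F /= (ger0_norm ts).
have -> : Num.max 0 (k - (t - s)) = 0 by apply/max_idPl; lra.
by move: h; rewrite /F; lra.
Qed.

Section Curve.
Context (c : R -> E3) (a b C : R).
Hypothesis hab : a < b.
Hypothesis hc : {within `[a, b], continuous c}.
Hypothesis hTC : TC c a b = C%:E.

Let L := arc_coord c a b.
Let g := arc_curve c a b.

Lemma fine_of_steps D k : itv_partition a b D ->
  (forall i, (i < size D)%N ->
     arc_len c (nth a (a :: D) i) (nth a D i) <= k) ->
  fine_partition k L (map (arc_coord c a) D).
Proof.
move=> hD h; have [sD lD] := partition_sorted hD.
have bD := sorted_between sD; rewrite lD in bD.
split; last by rewrite -(arc_coord_a hab hc hTC) last_map lD.
rewrite -(arc_coord_a hab hc hTC) path_map; apply/(pathP a) => i iD /=.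
have i1 : nth a (a :: D) i \in a :: D by rewrite mem_nth //= ltnW.
have i2 : nth a D i \in a :: D by rewrite inE mem_nth ?orbT.
have /andP[ai _] := bD _ i1; have /andP[_ ib] := bD _ i2.
have le : nth a (a :: D) i <= nth a D i by move/(pathP a): sD; apply.
rewrite (arc_coord_homo hab hc hTC) //= -lerBlDl (arc_coordB hab hc hTC) //.
exact: h.
Qed.

(** The length of an arc is at most a constant times its diameter. *)
Lemma arcs_shrink_fine (D : nat -> seq R) k : (forall h, itv_partition a b (D h)) ->
  arcs_shrink c a D -> 0 < k ->
  \forall h \near \oo, fine_partition k L (map (arc_coord c a) (D h)).
Proof.
move=> hD hs k0; have [M M0 hM] := arc_len_small hab hc hTC.
have kM : 0 < k / M by rewrite divr_gt0.
apply: filterS (hs _ kM) => h hh; apply: fine_of_steps => // i iD.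
have [sD lD] := partition_sorted (hD h).
have bD := sorted_between sD; rewrite lD in bD.
have i1 : nth a (a :: D h) i \in a :: D h by rewrite mem_nth //= ltnW.
have i2 : nth a (D h) i \in a :: D h by rewrite inE mem_nth ?orbT.
have /andP[ai _] := bD _ i1; have /andP[_ ib] := bD _ i2.
have le : nth a (a :: D h) i <= nth a (D h) i by move/(pathP a): sD; apply.
have -> : k = M * (k / M) by rewrite mulrC divfK // gt_eqF.
apply: hM => //; first exact: ltW.
move=> z z' hz hz'; apply/ltW; rewrite -[enorm _]/(edist (c z) (c z')).
by apply: (hh i iD); rewrite in_itv.
Qed.

Lemma segment_le_mesh (V : seq E3) i : (i < size (behead V))%N ->
  enorm (nth 0 (behead V) i - nth 0 V i) <= mesh V.
Proof.
case: V => [//|w V] /= iV; rewrite /mesh /edges /=.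
set e := _ - _; have [->|e0] := eqVneq e 0; first by rewrite enorm0 bigmax_ge_id.
apply: le_bigmax_seq => //; rewrite mem_filter e0 /=.
have -> : e = nth 0 (pairmap (fun u v : E3 => v - u) w V) i by rewrite (nth_pairmap 0).
by rewrite mem_nth // size_pairmap.
Qed.

(** Without loops the arc-length parameterization is injective, since c is
    constant between two parameters of the same point; then short chords join
    close parameters. *)
Lemma loop_free_fine (D : nat -> seq R) k : 0 < L ->
  (forall h, itv_partition a b (D h)) -> loop_free c a b ->
  mesh (inscribed c a (D h)) @[h --> \oo] --> 0 -> 0 < k ->
  \forall h \near \oo, fine_partition k L (map (arc_coord c a) (D h)).
Proof.
move=> L0 hD lf hm k0; have hg := arc_curve_arclength hab hc hTC L0.
have inj s t : 0 <= s -> s <= t -> t <= L -> g s = g t -> s = t.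
  move=> s0 st tL e.
  have [/andP[as1 sb] sE] := arc_paramP hab hc hTC s0 (le_trans st tL).
  have [/andP[at1 tb] tE] := arc_paramP hab hc hTC (le_trans s0 st) tL.
  have p := arc_param_homo hab hc hTC s0 st tL.
  have cst := lf _ _ as1 p tb e.
  have [M M0 hM] := arc_len_small hab hc hTC.
  have := hM 0 _ _ (lexx 0) as1 p tb; rewrite mulr0 -(arc_coordB hab hc hTC) //.
  rewrite sE tE => h; apply/le_anti; rewrite st /= -subr_le0; apply: h => z z' hz hz'.
  by rewrite (cst z hz) (cst z' hz') subrr enorm0.
have [d d0 hd] := injective_inverse_continuous hg inj k0.
have d20 : 0 < d / 2 by rewrite divr_gt0.
move/cvgrPdist_le : hm => /(_ _ d20); apply: filterS => h hh.
apply: fine_of_steps => // i iD.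
have [sD lD] := partition_sorted (hD h).
have bD := sorted_between sD; rewrite lD in bD.
have i1 : nth a (a :: D h) i \in a :: D h by rewrite mem_nth //= ltnW.
have i2 : nth a (D h) i \in a :: D h by rewrite inE mem_nth ?orbT.
have b1 := bD _ i1; have b2 := bD _ i2.
have /andP[ai _] := b1; have /andP[_ ib] := b2.
have le : nth a (a :: D h) i <= nth a (D h) i by move/(pathP a): sD; apply.
rewrite -(arc_coordB hab hc hTC) //.
have /andP[c1 _] := arc_coord_itv hab hc hTC b1.
have /andP[_ c2] := arc_coord_itv hab hc hTC b2.
apply: hd => //; first exact: (arc_coord_homo hab hc hTC).
rewrite /g !(arc_curveK hab hc hTC) //.
apply: (@le_lt_trans _ _ (d / 2)); last by lra.
apply: le_trans hh; rewrite sub0r normrN; apply: le_trans (ler_norm _).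
have := @segment_le_mesh (inscribed c a (D h)) i.
rewrite /inscribed /= size_map => /(_ iD).
by rewrite (nth_map a) // -[c a :: _]/(map c (a :: D h)) (nth_map a) //= ltnW.
Qed.

End Curve.
End Conclusion.

(** * Convergence of the indicatrices and of their lengths *)

Section LimitProperties.
Context {R : realType}.
Notation E3 := 'rV[R]_3.
Notation sorted := (sorted <=%R).
Implicit Types (x y z s k d r : R) (xs ys zs : seq R) (f : R -> E3).

Lemma plength_lip f x y xs : x <= y -> sorted xs -> between x y xs ->
  (forall r r', x <= r -> r <= r' -> r' <= y -> sphere_dist (f r) (f r') <= r' - r) ->
  plength sphere_dist (map f xs) <= y - x.
Proof.
move=> xy; elim: xs x xy => [|z xs ih] x xy sx hx lip.
  by rewrite plength0 subr_ge0.
have /andP[xz zy] := hx z (mem_head _ _).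
have hz : between z y (z :: xs).
  move=> w win; rewrite (le_sorted_head sx win).
  by case/andP: (hx w win).
suff h : plength sphere_dist (map f (z :: xs)) <= y - z.
  by apply: le_trans h _; rewrite lerD2l lerN2.
case: xs sx hx hz ih => [_ _ _ _|w xs sx hx hz ih].
  by rewrite plength1 subr_ge0.
rewrite /= plength_cons2; have win : w \in z :: w :: xs by rewrite !inE eqxx orbT.
have /andP[zw wy] := hz w win.
have lip' r r' : w <= r -> r <= r' -> r' <= y -> sphere_dist (f r) (f r') <= r' - r.
  by move=> wr; apply: lip; rewrite (le_trans xz) // (le_trans zw).
have hw : between w y (w :: xs).
  move=> v vin; have /andP[_ ->] : z <= v <= y by apply: hz; rewrite inE vin orbT.
  by rewrite andbT; apply: le_sorted_head vin; case/andP: sx.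
have h1 : sphere_dist (f z) (f w) <= w - z by exact: lip.
have h2 : plength sphere_dist (map f (w :: xs)) <= y - w.
  by apply: ih => //; case/andP: sx.
by move: h2; rewrite /=; lra.
Qed.

Lemma curve_length_lip f x y : x <= y ->
  (forall r r', x <= r -> r <= r' -> r' <= y -> sphere_dist (f r) (f r') <= r' - r) ->
  (curve_length sphere_dist x y f <= (y - x)%:E)%E.
Proof.
move=> xy lip; apply: curve_length_le => xs sx lx.
have := sorted_between sx; rewrite lx => bx.
exact: plength_lip.
Qed.

Section Local.
Context (g : R -> E3) (L C : R) (b : bool) (tc : R -> E3).
Hypothesis hg : arclength_curve g L.
Hypothesis hC : total_turning b g L C.
Hypothesis htc : forall r, 0 <= r -> r <= C -> fine_limit g L C b r (tc r).

Lemma limit_continuous : {within `[0, C], continuous tc}.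
Proof.
apply/subspace_continuousP => r; rewrite /= in_itv /= => /andP[r0 rC].
apply/cvgrPdist_le => e e0; pose d := e ^+ 2 / 2.
have d0 : 0 < d by rewrite divr_gt0 // exprn_gt0.
apply/nbhs_ballP; exists d => // r'; rewrite -ball_normE /= in_itv /= => rr'.
move=> /andP[r'0 r'C]; apply: le_trans (norm_le_enorm _) _.
have S := limit_sphere2 htc r0 rC; have S' := limit_sphere2 htc r'0 r'C.
apply: enorm_le_sphere_dist => //; first exact: ltW.
have [le|/ltW le] := leP r r'.
  rewrite ler0_norm ?subr_le0 // in rr'.
  by apply: le_trans (limit_lip hg hC htc r0 le r'C) _; rewrite -/d; lra.
rewrite ger0_norm ?subr_ge0 // in rr'; rewrite sphere_distC.
by apply: le_trans (limit_lip hg hC htc r'0 le rC) _; rewrite -/d; lra.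
Qed.

(** The limit is 1-Lipschitz and its total length is C, so no piece of it can
    be shorter than the interval of its parameters. *)
Lemma limit_curve_length s s' : 0 <= s -> s <= s' -> s' <= C ->
  curve_length sphere_dist s s' tc = (s' - s)%:E.
Proof.
move=> s0 ss' s'C; apply/le_anti/andP; split.
  apply: curve_length_lip => // r r' sr rr' r's'.
  by apply: (limit_lip hg hC htc) => //; [exact: le_trans sr|exact: le_trans s'C].
apply/lee_addgt0Pr => k k0; have [rs [srs lrs h]] := limit_length hg hC htc k0.
have brs := sorted_between srs; rewrite lrs in brs.
pose X1 := [seq x <- 0 :: rs | x <= s].
pose X := [seq x <- 0 :: rs | s < x].
pose X2 := [seq x <- X | x <= s']; pose X3 := [seq x <- X | s' < x].
have sX : sorted X by apply: sorted_filter srs; exact: le_trans.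
have s1 : sorted X1 by apply: sorted_filter srs; exact: le_trans.
have s2 : sorted X2 by apply: sorted_filter sX; exact: le_trans.
have s3 : sorted X3 by apply: sorted_filter sX; exact: le_trans.
have E : 0 :: rs = X1 ++ X2 ++ X3.
  by rewrite (sorted_split s srs) -/X -/X1 {1}(sorted_split s' sX).
have m1 x : x \in X1 -> 0 <= x <= s.
  by rewrite mem_filter => /andP[-> /brs /andP[->]].
have m2 x : x \in X2 -> s <= x <= s'.
  by rewrite mem_filter => /andP[->]; rewrite mem_filter => /andP[/ltW -> _].
have m3 x : x \in X3 -> s' <= x <= C.
  rewrite mem_filter => /andP[/ltW -> ]; rewrite mem_filter => /andP[_ /brs].
  by case/andP.
have sS x : 0 <= x <= C -> sphere2 (tc x).
  by move=> /andP[x0 xC]; exact: (limit_sphere2 htc).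
have s1s : sorted (rcons X1 s).
  rewrite -cats1; apply: sorted_cat_le => // x y /m1/andP[_ xs].
  by rewrite inE => /eqP ->.
have s2s : sorted (s :: rcons X2 s').
  rewrite -cat1s -cats1; apply: sorted_cat_le => //.
    apply: sorted_cat_le => // x y /m2/andP[_ xs']; by rewrite inE => /eqP ->.
  move=> x y; rewrite inE => /eqP ->; rewrite mem_cat mem_seq1.
  by case/orP => [/m2/andP[]//|/eqP ->].
have s3s : sorted (s' :: X3).
  by rewrite -cat1s; apply: sorted_cat_le => // x y; rewrite inE => /eqP ->;
    case/m3/andP.
have lip x y : 0 <= x -> y <= C -> forall r r', x <= r -> r <= r' -> r' <= y ->
    sphere_dist (tc r) (tc r') <= r' - r.
  move=> x0 yC r r' xr rr' r'y; apply: (limit_lip hg hC htc) => //.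
    exact: le_trans xr.
  exact: le_trans yC.
have sC : s <= C by exact: le_trans s'C.
have p1 : plength sphere_dist (map tc (rcons X1 s)) <= s - 0.
  apply: plength_lip => // [x|]; last exact: lip.
  by rewrite mem_rcons inE => /predU1P[->|/m1//]; rewrite s0 lexx.
have p3 : plength sphere_dist (map tc (s' :: X3)) <= C - s'.
  apply: plength_lip => // [x|].
    by rewrite inE => /predU1P[->|/m3//]; rewrite s'C lexx.
  by apply: lip => //; exact: le_trans ss'.
have p2 : ((plength sphere_dist (map tc (s :: rcons X2 s')))%:E
    <= curve_length sphere_dist s s' tc)%E.
  have := @curve_length_ub _ sphere_dist tc s (rcons X2 s') s2s.
  rewrite last_rcons; apply => y yin; apply/sphere_distxx/sS.
  move: yin; rewrite inE mem_rcons inE => /or3P[/eqP->|/eqP->|/m2/andP[sy ys']].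
  - by rewrite s0.
  - by rewrite s'C (le_trans s0).
  - by rewrite (le_trans s0) // (le_trans ys').
have ins : plength sphere_dist (map tc (0 :: rs)) <=
    plength sphere_dist (map tc (X1 ++ s :: X2 ++ s' :: X3)).
  have hS u : u \in map tc (X1 ++ s :: X2 ++ s' :: X3) -> sphere2 u.
    case/mapP => x xin ->; apply: sS; move: xin.
    rewrite mem_cat inE mem_cat inE.
    case/or4P => [/m1/andP[-> h1]|/eqP->|/m2/andP[h1 h2]|/predU1P[->|/m3/andP[h1 ->]]].
    - by rewrite (le_trans h1).
    - by rewrite s0.
    - by rewrite (le_trans s0) // (le_trans h2).
    - by rewrite s'C (le_trans s0).
    - by rewrite andbT (le_trans s0) // (le_trans ss').
  have sub : subseq (0 :: rs) (X1 ++ s :: X2 ++ s' :: X3).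
    rewrite E; apply: cat_subseq => //; apply: subseq_trans (subseq_cons _ _).
    by apply: cat_subseq => //; exact: subseq_cons.
  exact: (plength_cyc_subseq sphere_dist_ge0 sphere_dist_triangle false (map_subseq tc sub) hS).
have dec : plength sphere_dist (map tc (X1 ++ s :: X2 ++ s' :: X3)) =
    plength sphere_dist (map tc (rcons X1 s)) +
    (plength sphere_dist (map tc (s :: rcons X2 s')) +
     plength sphere_dist (map tc (s' :: X3))).
  rewrite map_cat [map tc (s :: _)]/= plength_cat -map_rcons; congr (_ + _).
  by rewrite map_cat -cat_cons [map tc (s' :: X3)]/= plength_cat /= map_rcons.
rewrite -leeBlDr // -EFinB; apply: le_trans p2; rewrite lee_fin.
move: h ins; rewrite dec; lra.
Qed.

Section Sequence.
Context (xs : nat -> seq R) (f : nat -> R -> E3).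
Hypothesis fine_xs : forall d, 0 < d ->
  \forall h \near \oo, fine_partition d L (xs h).
Hypothesis hf : forall h, is_indicatrix b (map g (0 :: xs h)) (f h).

Let t h s := f h (turn b (map g (0 :: xs h)) * s / C).

Lemma limit_cvg_uniform : {uniform `[0, C], t @ \oo --> tc}.
Proof.
move=> P /uniform_nbhs[E [entE sub]].
move: entE; rewrite -entourage_ballE => -[e /= e0 he].
have k0 : 0 < (e / 2) ^+ 2 / 2 by rewrite divr_gt0 // exprn_gt0 // divr_gt0.
have [d d0 hd] := limit_uniform hg hC htc k0.
apply: filterS (fine_xs d0) => h fxs; apply: sub => r /=.
rewrite in_itv /= => /andP[r0 rC]; apply: he => /=.
rewrite -ball_normE /=; apply: le_lt_trans (norm_le_enorm _) _.
have [tS tr] := hd (xs h) (f h) fxs (hf h) r r0 rC.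
apply: (@le_lt_trans _ _ (e / 2)); last by lra.
apply: enorm_le_sphere_dist => //; first exact: (limit_sphere2 htc).
  by rewrite ltW // divr_gt0.
by rewrite sphere_distC.
Qed.

(** Upper bound by the Lipschitz condition; lower bound by the convergence at
    the finitely many points of a polygonal nearly as long as the limit. *)
Lemma limit_cvg_length :
  curve_length sphere_dist 0 C (t h) @[h --> \oo] --> C%:E.
Proof.
have C0 := total_turning_ge0 hg hC.
have upper h d : fine_partition d L (xs h) ->
    (curve_length sphere_dist 0 C (t h) <= C%:E)%E.
  move=> fxs; rewrite -[C in X in (_ <= X)%E]subr0; apply: curve_length_lip => //.
  move=> r r' r0 rr' r'C.
  by have [_ _] := rescaled_lip hg hC fxs (hf h) r0 rr' r'C.
have lower k : 0 < k -> \forall h \near \oo,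
    ((C - k)%:E <= curve_length sphere_dist 0 C (t h))%E.
  move=> k0; have k20 : 0 < k / 2 by rewrite divr_gt0.
  have [rs [srs lrs len]] := limit_length hg hC htc k20.
  have brs := sorted_between srs; rewrite lrs in brs.
  pose n : R := (size (0 :: rs))%:R.
  have n0 : 0 < n by rewrite ltr0n.
  have e0 : 0 < k / (4 * n) by rewrite divr_gt0 // mulr_gt0.
  have [d d0 hd] := limit_uniform hg hC htc e0.
  apply: filterS (fine_xs d0) => h fxs.
  have tS x : x \in 0 :: rs -> sphere2 (t h x) /\
      sphere_dist (t h x) (tc x) <= k / (4 * n).
    by move=> /brs /andP[x0 xC]; exact: (hd (xs h)).
  apply: (@le_trans _ _ (plength sphere_dist (map (t h) (0 :: rs)))%:E); last first.
    rewrite -lrs; apply: curve_length_ub => // x /tS[S _].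
    exact: sphere_distxx.
  have all_close : all2 (fun u v => sphere_dist u v <= k / (4 * n))
      (map (t h) (0 :: rs)) (map tc (0 :: rs)).
    elim: (0 :: rs) tS => [//|x l ih] hl /=; rewrite (hl x (mem_head _ _)).2 /=.
    by apply: ih => y yin; apply: hl; rewrite inE yin orbT.
  have := plength_close (ltW e0) all_close.
  have S1 u : u \in map (t h) (0 :: rs) -> sphere2 u by case/mapP => x /tS[S _] ->.
  have S2 u : u \in map tc (0 :: rs) -> sphere2 u.
    by case/mapP => x /brs /andP[x0 xC] ->; exact: (limit_sphere2 htc).
  move=> /(_ S1 S2); rewrite size_map -/n lee_fin.
  have -> : k / (4 * n) * 2 * n = k / 2 by field; rewrite gt_eqF.
  lra.
apply/fine_cvgP; split.
  near=> h; rewrite fin_numElt; apply/andP; split.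
    apply: (@lt_le_trans _ _ (C - 1)%:E); first exact: ltNyr.
    by near: h; exact: lower.
  apply: (@le_lt_trans _ _ C%:E); last exact: ltry.
  by near: h; apply: filterS (fine_xs ltr01) => h; exact: upper.
apply/cvgrPdist_le => e e0.
near=> h.
have lo : ((C - e)%:E <= curve_length sphere_dist 0 C (t h))%E.
  by near: h; exact: lower.
have up : (curve_length sphere_dist 0 C (t h) <= C%:E)%E.
  by near: h; apply: filterS (fine_xs ltr01) => h; exact: upper.
rewrite /=; move: lo up; case: (curve_length _ _ _ _) => [l||] //=.
rewrite !lee_fin => lo up; rewrite ger0_norm ?subr_ge0 //; lra.
Unshelve. all: by end_near.
Qed.

End Sequence.
End Local.
End LimitProperties.

(** * Curves without points of return *)

Section Degenerate.
Context {R : realType}.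
Notation E3 := 'rV[R]_3.

Lemma directions_const (V : seq E3) p : {in V, forall u, u = p} ->
  directions V = [::].
Proof.
elim: V => [//|u [//|v V] ih] h; rewrite directions_cons2 ih => [|w win].
  by rewrite (h u (mem_head _ _)) (h v) ?inE ?eqxx ?orbT // subrr /dir_seq eqxx.
by apply: h; rewrite inE win orbT.
Qed.

Lemma curve_length_point (f : R -> E3) s : sphere2 (f s) ->
  curve_length sphere_dist s s f = 0%:E.
Proof.
move=> hf; apply/le_anti/andP; split.
  apply: curve_length_le => xs sx lx; have := sorted_between sx; rewrite lx.
  elim: xs {sx lx} => [|x xs ih] bx; first by rewrite plength1.
  have -> : x = s by apply/esym/le_anti/bx; rewrite !inE eqxx orbT.
  rewrite /= plength_cons2 sphere_distxx // add0r; apply: ih => z zin.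
  by apply: bx; move: zin; rewrite !inE => /orP[->//|->]; rewrite !orbT.
have := @curve_length_ub _ sphere_dist f s [::] isT.
rewrite plength1 /=; apply => y; rewrite inE => /eqP ->; exact: sphere_distxx.
Qed.

End Degenerate.

Theorem proposition4p5 (R : realType) (a b : R) (c : R -> 'rV[R]_3) (C : R)
    (hab : a < b) (hc : {within `[a, b], continuous c})
    (hC : TC c a b = C%:E)
    (hret : forall p, ~ point_of_return c a b p) :
  exists tc : R -> 'rV[R]_3,
    [/\ (forall s, s \in `[0, C] -> sphere2 (tc s)),
        {within `[0, C], continuous tc},
        (forall s s', 0 <= s -> s <= s' -> s' <= C ->
           curve_length sphere_dist s s' tc = (s' - s)%:E),
        curve_length sphere_dist 0 C tc = TC c a b &
        forall (D : nat -> seq R) (f : nat -> R -> 'rV[R]_3),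
          (forall h, itv_partition a b (D h)) ->
          (forall h, tangent_indicatrix (inscribed c a (D h)) (f h)) ->
          mesh (inscribed c a (D h)) @[h --> \oo] --> 0 ->
          loop_free c a b \/ arcs_shrink c a D ->
          let t h := constant_velocity (inscribed c a (D h)) C (f h) in
          {uniform `[0, C], t @ \oo --> tc} /\
          curve_length sphere_dist 0 C (t h) @[h --> \oo]
            --> curve_length sphere_dist 0 C tc].
Proof.
pose L := arc_coord c a b; pose g := arc_curve c a b.
have aab : a <= a <= b by rewrite lexx ltW.
have bab : a <= b <= b by rewrite lexx ltW.
have /andP[_ L0] := arc_coord_itv hab hc hC aab.
rewrite (arc_coord_a hab hc hC) -/L in L0.
have closedE D : itv_partition a b D ->
    closed_polygonal (inscribed c a D) = (c a == c b).
  move=> /partition_sorted[_ lD].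
  by rewrite /closed_polygonal /inscribed /= last_map lD.
(* a constant curve has total curvature 0, and its inscribed polygonals have no
   indicatrix *)
have [L00|Ln0] := eqVneq L 0.
  have cst x : a <= x <= b -> c x = c a.
    move=> hx; apply: (arc_coord_inj hab hc hC hx aab).
    have := arc_coord_itv hab hc hC hx; rewrite -/L L00 (arc_coord_a hab hc hC).
    by move/le_anti.
  have nodir D : sorted <=%R (a :: D) -> last a D = b ->
      directions (map c (a :: D)) = [::].
    move=> sD lD; apply: (@directions_const _ _ (c a)) => _ /mapP[x xin ->].
    by apply: cst; rewrite -lD; exact: sorted_between.
  have turn0 D : sorted <=%R (a :: D) -> last a D = b ->
      turn (c a == c b) (map c (a :: D)) = 0.
    by move=> sD lD; rewrite /turn nodir //; case: (_ == _); rewrite plength0.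
  have C0 : C = 0.
    apply/le_anti/andP; split.
      apply/ler_addgt0Pr => k k0; have [D [sD lD]] := TC_adherent hC k0.
      by rewrite turn0 //; lra.
    have sab : sorted <=%R [:: a; b] by rewrite /= andbT ltW.
    have := @TC_ub _ c a C [:: b] sab hC; rewrite -{1}(turn0 [:: b] sab (erefl _)).
    exact.
  have [u uS] := @ex_sphere2 R; exists (fun=> u); rewrite hC C0; split=> //.
  - by move=> x; exact: cst_continuous.
  - move=> s s' s0 ss' s'0; have -> : s = 0 by lra.
    have -> : s' = 0 by lra.
    by rewrite subrr curve_length_point.
  - by rewrite curve_length_point.
  move=> D f hD /(_ 0) + _ _; rewrite tangent_indicatrixE /is_indicatrix.
  have [sD lD] := partition_sorted (hD 0%N).
  have -> : directions (inscribed c a (D 0%N)) = [::] := nodir _ sD lD.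
  by case: (closed_polygonal _).
have Lgt0 : 0 < L by rewrite lt0r Ln0.
have hg : arclength_curve g L := arc_curve_arclength hab hc hC Lgt0.
have hT : total_turning (c a == c b) g L C := arc_curve_total_turning hab hc hC.
have param := arc_curve_param hab hc hC.
have noret s u v : 0 < s -> s < L -> chord_limit_left g s u ->
    chord_limit_right g L s v -> v <> - u.
  move=> s0 sL hu hv vu; apply: (hret (g s)); exists L, g; split=> //.
  exists u; first by case: hu.
  left; exists s; split=> //; first by rewrite s0.
    exact: (chord_limit_left_tangent hg s0 (ltW sL) hu).
  by rewrite -vu; exact: (chord_limit_right_tangent hg (ltW s0) sL hv).
have noret0 : c a == c b -> forall u v, chord_limit_left g L u ->
    chord_limit_right g L 0 v -> v <> - u.
  move=> /eqP cab u v hu hv vu; apply: (hret (c a)); exists L, g; split=> //.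
  exists u; first by case: hu.
  right; split=> //.
    exact: (chord_limit_left_tangent hg Lgt0 (lexx L) hu).
  by rewrite -vu; exact: (chord_limit_right_tangent hg (lexx 0) Lgt0 hv).
have lim r : exists w, 0 <= r -> r <= C -> fine_limit g L C (c a == c b) r w.
  have [r0|_] := leP 0 r; last by exists 0.
  have [rC|_] := leP r C; last by exists 0.
  by have [w hw] := pointwise_limit hg hT noret noret0 r0 rC; exists w.
have [tc htc] := choice lim.
exists tc; have C0 := total_turning_ge0 hg hT.
have len := limit_curve_length hg hT htc.
have lenC : curve_length sphere_dist 0 C tc = C%:E by rewrite len // subr0.
split=> //.
- by move=> s; rewrite in_itv /= => /andP[s0 sC]; exact: (limit_sphere2 htc).
- exact: (limit_continuous hg hT htc).
- by rewrite lenC hC.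
move=> D f hD hf hm hfine t.
pose xs h := map (arc_coord c a) (D h).
have VE h : inscribed c a (D h) = map g (0 :: xs h).
  have [sD lD] := partition_sorted (hD h).
  have bD := sorted_between sD; rewrite lD in bD.
  have -> : 0 :: xs h = map (arc_coord c a) (a :: D h).
    by rewrite /xs /= (arc_coord_a hab hc hC).
  by rewrite (map_arc_curve hab hc hC bD).
have hf' h : is_indicatrix (c a == c b) (map g (0 :: xs h)) (f h).
  by rewrite -VE -(closedE _ (hD h)) -tangent_indicatrixE.
have fine d : 0 < d -> \forall h \near \oo, fine_partition d L (xs h).
  case: hfine => hfine; last exact: (arcs_shrink_fine hab hc hC).
  exact: (loop_free_fine hab hc hC Lgt0 hD hfine hm).
have tE : t = fun h s => f h (turn (c a == c b) (map g (0 :: xs h)) * s / C).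
  apply/funext => h; apply/funext => s; rewrite /t /constant_velocity.
  by rewrite TC_polygonalE (closedE _ (hD h)) VE.
rewrite tE lenC; split; first exact: (limit_cvg_uniform hg hT htc).
exact: (limit_cvg_length hg hT htc).
Qed.
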